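(* Let $q\in\mathbb{C}$ with $0<|q|<1$, let $k$ be a positive integer, and let $f$ be a nonconstant meromorphic function on $\mathbb{C}$ of order zero. Then $$m\Big(r,\frac{D_{q}^{k}f(z)}{f(z)}\Big)=o(T(r,f))$$ on a set of logarithmic density $1$; that is, there is a set $E\subset(1,\infty)$ of logarithmic density $1$ such that $m(r,D_q^kf/f)/T(r,f)\to 0$ as $r\to\infty$, $r\in E$.
   Context: The Jackson difference operator is $D_qf(z)=\frac{f(qz)-f(z)}{qz-z}$, with iterates $D_q^0f=f$, $D_q^kf=D_q(D_q^{k-1}f)$. Nevanlinna notation for a meromorphic function $f$ on $\mathbb{C}$: $m(r,f)=\frac1{2\pi}\int_0^{2\pi}\log^+|f(re^{i\theta})|\,d\theta$; $N(r,f)=\int_0^r\frac{n(t,f)-n(0,f)}{t}\,dt+n(0,f)\log r$, where $n(t,f)$ is the number of poles of $f$ in $\{|z|<t\}$ counted with multiplicity and $n(0,f)$ is the multiplicity of the pole at $0$ (zero if there is none); $T(r,f)=m(r,f)+N(r,f)$. The order is $\sigma(f)=\limsup_{r\to\infty}\frac{\log T(r,f)}{\log r}$. A measurable set $E\subset(1,\infty)$ has logarithmic density $1$ if $\lim_{r\to\infty}\frac{1}{\log r}\int_{E\cap[1,r]}\frac{dt}{t}=1$. *)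

(* Defs.v *)
From HB Require Import structures.
From mathcomp Require Import all_boot all_order all_algebra.
From mathcomp Require Import complex.
From mathcomp Require Import all_classical all_reals all_analysis.

Set Implicit Arguments.
Unset Strict Implicit.
Unset Printing Implicit Defensive.

Export Order.TTheory GRing.Theory Num.Theory numFieldNormedType.Exports.

Local Open Scope classical_set_scope.
Local Open Scope complex_scope.
Local Open Scope ring_scope.

(** The complex plane is [R[i]^o]: the alias [^o] provides the topology of
    [R[i]] and its structure of normed module over itself, so that
    [derivable f w 1] is complex differentiability at [w].  The real-valued
    modulus is [Normc.normc]. *)

Section MeromorphicFunctions.
Variable R : realType.
Implicit Types (f g : R[i]^o -> R[i]^o) (z : R[i]^o) (m : nat).

Definition holomorphic_at f z : Prop := \forall w \near z, derivable f w 1.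

(** The value of [f] at the pole [z] itself is unconstrained. *)
Definition pole_of_order f z m : Prop :=
  (0 < m)%N /\
  exists g, [/\ holomorphic_at g z, g z <> 0 &
    \forall w \near z^', f w = g w / (w - z) ^+ m].

(** Removable singularities are not allowed: [f] may take arbitrary values
    only at its poles. *)
Definition meromorphic f : Prop :=
  forall z, holomorphic_at f z \/ exists m, pole_of_order f z m.

(** The order of a pole is unique; the value is [0] where there is no pole. *)
Definition pole_mult f z : nat := xget 0%N [set m | pole_of_order f z m].

Definition jackson (q : R[i]^o) f : R[i]^o -> R[i]^o :=
  fun z => (f (q * z) - f z) / (q * z - z).

End MeromorphicFunctions.

Section Nevanlinna.
Variable R : realType.
Implicit Types (f : R[i]^o -> R[i]^o) (r t : R).

Local Notation mu := (@lebesgue_measure R).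

(** [ln 0 = 0] in the library, so [logp 0 = 0] as it should be. *)
Definition logp (x : R) : R := Num.max (ln x) 0.

Definition circle_pt r t : R[i]^o := (r * cos t) +i* (r * sin t).

Definition nev_m r f : R :=
  (2 * pi)^-1 *
  \int[mu]_(t in `[0, 2 * pi]) logp (Normc.normc (f (circle_pt r t))).

(** The sum has finite support: a meromorphic function has finitely many
    poles in a disc. *)
Definition nev_n t f : R :=
  \sum_(z \in [set z : R[i]^o | Normc.normc z < t]) ((pole_mult f z)%:R : R).

Definition nev_N r f : R :=
  \int[mu]_(t in `[0, r]) ((nev_n t f - (pole_mult f 0)%:R) / t)
  + (pole_mult f 0)%:R * ln r.

Definition nev_T r f : R := nev_m r f + nev_N r f.

Definition growth_order f : \bar R :=
  limf_esup (fun r => (ln (nev_T r f) / ln r)%:E) (+oo : set_system R).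

Definition log_density_one (E : set R) : Prop :=
  [/\ measurable E, E `<=` `]1, +oo[ &
    (ln r)^-1 * (\int[mu]_(t in E `&` `[1, r]) t^-1) @[r --> +oo] --> (1 : R)].

End Nevanlinna.

(* Main.v *)
(* Let [T r] be the characteristic of [f].  Jensen's formula and the Schwarz
   formula for the zero-free part of [f] in a disc bound [m s (f (q^j z) / f z)]
   by a constant times [(s / (r - s) + 1 / ln (r' / r)) (T r' + 1)], plus a
   constant, for all [2 s <= r] and [2 r <= r'].  Since [D_q^k f (z)] is
   [z^-k] times a fixed linear combination of the [f (q^j z)], [j <= k], the
   same holds for [D_q^k f / f].  With [s ~ 2^n], [r ~ 2^(n+J)] and
   [r' ~ 2^(n+2J)] the factor in brackets is [O(1/J)], so the quotient by [T s]
   is small whenever [T (2^(n+2J)) <= C T (2^n)].  As [f] has order zero,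
   [ln (T (2^n)) = o(n)], and by telescoping the [n] violating this form a set of
   small density when [C] is large.  A diagonal argument then yields a set of [n]
   of density one, whose dyadic intervals make up [E].  Radii of circles through
   zeros or poles of some [f (q^j z)] form a countable set and are discarded;
   this makes all circle means means of continuous functions. *)

(* The two gaps, from [s] to [r] and from [r] to [r'], serve two error terms. Between [z] and
   [q^j z] on the circle of radius [s] the logarithm of the zero-free part of [f] varies by
   [O(s / (r - s))] times the mean of [|ln |f||] at radius [r]. Each zero or pole in the disc of
   radius [r] adds a bounded amount, wherever it lies: the mean of [ln |z - a|] is known exactly and
   [ln |z - a|] is bounded above, and this bounds the mean of its absolute value despite the
   singularity. The number of these points is at most [(2 T r' + |L|) / ln (r' / r)], with [L] the
   constant of the first main theorem; hence the second term.

   Blaschke factors have modulus one on the circle of radius [r], so there the zero-free part has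
   the modulus of [f] and its mean is controlled by [T r].

   Comparing [T] at separated radii loses a constant factor, which enters the density argument as
   [ln 11], whatever [J] is. So the admissible growth [C] can be fixed first, from the density
   wanted, and [J] afterwards, from [C].

   Cauchy's theory is developed through circle means: in the variable [log z] circles become
   vertical segments, and Goursat's theorem for rectangles applies. *)
Require Import Defs.
From HB Require Import structures.
From mathcomp Require Import all_boot all_order all_algebra.
From mathcomp Require Import complex.
From mathcomp Require Import all_classical all_reals all_analysis.
From mathcomp Require Import zify ring lra.

Set Implicit Arguments.
Unset Strict Implicit.
Unset Printing Implicit Defensive.

Local Open Scope classical_set_scope.
Local Open Scope complex_scope.
Local Open Scope ring_scope.

(** * Continuity and the modulus *)

(* An inductive wrapper: unification must not unfold continuity statements. *)
Inductive cont_at {T U : topologicalType} (f : T -> U) (x : T) : Prop :=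
  ContAt of {for x, continuous f}.

Lemma cont_comp {S T U : topologicalType} (f : S -> T) (g : T -> U) x :
  cont_at f x -> cont_at g (f x) -> cont_at (fun y => g (f y)) x.
Proof. by move=> [hf] [hg]; split; exact: (@continuous_comp S T U f g x hf hg). Qed.

Section RealContinuity.
Context {R : realType} {T : topologicalType}.
Implicit Types (f g : T -> R).

Lemma rcontP f x : cont_at f x <->
  forall e : R, 0 < e -> \forall y \near x, `|f y - f x| < e.
Proof.
split => [[/cvgrPdist_lt h] e /h|h].
  by apply: filterS => y; rewrite distrC.
by split; apply/cvgrPdist_lt => e /h; apply: filterS => y; rewrite distrC.
Qed.

Lemma rcont_cst (c : R) x : cont_at (fun _ : T => c) x.
Proof. by split; exact: (@cst_continuous T R c x). Qed.

Lemma rcontD f g x : cont_at f x -> cont_at g x -> cont_at (fun y => f y + g y) x.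
Proof. by move=> [hf] [hg]; split; exact: (@continuousD R R^o T f g x hf hg). Qed.

Lemma rcontB f g x : cont_at f x -> cont_at g x -> cont_at (fun y => f y - g y) x.
Proof. by move=> [hf] [hg]; split; exact: (@continuousB R R^o T f g x hf hg). Qed.

Lemma rcontM f g x : cont_at f x -> cont_at g x -> cont_at (fun y => f y * g y) x.
Proof. by move=> [hf] [hg]; split; exact: (@continuousM R T f g x hf hg). Qed.

Lemma rcontV f x : f x != 0 -> cont_at f x -> cont_at (fun y => (f y)^-1) x.
Proof. by move=> h [hf]; split; exact: (@continuousV R T f x h hf). Qed.

Lemma rcont_norm f x : cont_at f x -> cont_at (fun y => `|f y|) x.
Proof.
move=> /rcontP h; apply/rcontP => e /h; apply: filterS => y.
exact/le_lt_trans/ler_dist_dist.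
Qed.

Lemma rcont_max0 f x : cont_at f x -> cont_at (fun y => Num.max (f y) 0) x.
Proof.
move=> hf; have -> : (fun y => Num.max (f y) 0) = (fun y => (f y + `|f y|) * 2^-1).
  by apply/funext => y; have [a0|a0] := lerP (f y) 0; [rewrite ler0_norm|rewrite gtr0_norm]; lra.
by apply: rcontM; [apply: rcontD => //; exact: rcont_norm|exact: rcont_cst].
Qed.

Lemma rcont_ln f x : 0 < f x -> cont_at f x -> cont_at (fun y => ln (f y)) x.
Proof. by move=> h hf; apply: cont_comp hf _; split; exact: continuous_ln. Qed.

End RealContinuity.

Section Modulus.
Context {R : realType}.
Local Notation C := (R[i]^o).
Local Notation nc := (@Normc.normc R).
Implicit Types (z w : C).

Lemma nc_normE z : `|z| = (nc z)%:C.
Proof. by rewrite normc_def; case: z. Qed.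

Lemma nc_ge0 z : 0 <= nc z.
Proof. by case: z => a b /=; rewrite sqrtr_ge0. Qed.

Lemma nc_eq0 z : (nc z == 0) = (z == 0).
Proof.
apply/eqP/eqP => [/Normc.eq0_normc//|->]; exact: Normc.normc0.
Qed.

Lemma nc_gt0 z : (0 < nc z) = (z != 0).
Proof. by rewrite lt_neqAle nc_ge0 andbT eq_sym nc_eq0. Qed.

Lemma ncM z w : nc (z * w) = nc z * nc w.
Proof. exact: Normc.normcM. Qed.

Lemma ncV z : nc z^-1 = (nc z)^-1.
Proof. exact: Normc.normcV. Qed.

Lemma nc0 : nc 0 = 0. Proof. exact: Normc.normc0. Qed.
Lemma nc1 : nc 1 = 1. Proof. exact: Normc.normc1. Qed.

Lemma ncX z n : nc (z ^+ n) = nc z ^+ n.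
Proof. by elim: n => [|n IH]; rewrite ?expr0 ?nc1 // !exprS ncM IH. Qed.

Lemma ncN z : nc (- z) = nc z.
Proof. exact: normcN. Qed.

Lemma ncD z w : nc (z + w) <= nc z + nc w.
Proof. exact: le_normcD. Qed.

Lemma ncB z w : nc (z - w) = nc (w - z).
Proof. by rewrite -ncN opprB. Qed.

Lemma ncB_le z w : nc (z - w) <= nc z + nc w.
Proof. by rewrite -(ncN w) ncD. Qed.

Lemma nc_triangle u z w : nc (z - w) <= nc (z - u) + nc (u - w).
Proof. by rewrite -[z - w](subrKA u) ncD. Qed.

Lemma nc_sub_ge z w : nc z - nc w <= nc (z - w).
Proof. by rewrite lerBlDr -{1}(subrK w z) ncD. Qed.

Lemma nc_Re_le z : `|Re z| <= nc z.
Proof.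
case: z => a b /=; rewrite -(@sqrtr_sqr _ a) ler_wsqrtr // lerDl; exact: sqr_ge0.
Qed.

Lemma nc_Im_le z : `|Im z| <= nc z.
Proof.
case: z => a b /=; rewrite -(@sqrtr_sqr _ b) ler_wsqrtr // lerDr; exact: sqr_ge0.
Qed.

Lemma nc_le_ReIm z : nc z <= `|Re z| + `|Im z|.
Proof.
case: z => a b /=; rewrite -(@ger0_norm _ (`|a| + `|b|)); last exact: addr_ge0.
rewrite -sqrtr_sqr ler_wsqrtr // -(real_normK (num_real a)) -(real_normK (num_real b)).
by have := mulr_ge0 (normr_ge0 a) (normr_ge0 b); nra.
Qed.

Lemma nc_real (x : R) : nc x%:C = `|x|.
Proof. by rewrite /= expr0n /= addr0 sqrtr_sqr. Qed.

Lemma sqr_nc z : nc z ^+ 2 = Re z ^+ 2 + Im z ^+ 2.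
Proof. by case: z => a b /=; rewrite sqr_sqrtr // addr_ge0 // sqr_ge0. Qed.

Lemma mulJc z : z * z^* = (nc z ^+ 2)%:C.
Proof. by rewrite sqr_nc; case: z => a b /=; congr (_ +i* _); ring. Qed.

Lemma ReM z w : Re (z * w) = Re z * Re w - Im z * Im w.
Proof. by case: z; case: w. Qed.

Lemma ImM z w : Im (z * w) = Re z * Im w + Im z * Re w.
Proof. by case: z; case: w => /= *; ring. Qed.

Lemma ReD z w : Re (z + w) = Re z + Re w.
Proof. by case: z; case: w. Qed.
Lemma ImD z w : Im (z + w) = Im z + Im w.
Proof. by case: z; case: w. Qed.
Lemma ReN z : Re (- z) = - Re z.
Proof. by case: z. Qed.
Lemma ImN z : Im (- z) = - Im z.
Proof. by case: z. Qed.

Lemma ncJ z : nc z^* = nc z.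
Proof. by case: z => a b /=; rewrite sqrrN. Qed.

Lemma nbhsCP z (P : set C) :
  nbhs z P <-> exists2 e : R, 0 < e & forall w, nc (w - z) < e -> P w.
Proof.
rewrite nbhs_ballP; split => [[e /= e0 h]|[e e0 h]].
- have e0' : e = (Re e)%:C.
    by have := e0; case: e {h e0} => a b; rewrite ltcE /= => /andP[/eqP -> _].
  exists (Re e); first by move: e0; rewrite e0' ltcR.
  move=> w hw; apply: h; rewrite -ball_normE /= e0' -[X in X < _]/(`|z - w|).
  by rewrite nc_normE ltcR ncB.
- exists e%:C; first by rewrite /= ltcR.
  move=> w; rewrite -ball_normE /= -[X in X < _]/(`|z - w|) nc_normE ltcR ncB.
  exact: h.
Qed.

Lemma dnbhsCP z (P : set C) : (\forall w \near z^', P w) <->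
  exists2 e : R, 0 < e & forall w, nc (w - z) < e -> w != z -> P w.
Proof.
rewrite /prop_near1 /dnbhs /within /=.
by split => [/nbhsCP[e e0 h]|[e e0 h]]; [exists e|apply/nbhsCP; exists e].
Qed.

Lemma continuousCP {T : topologicalType} (f : T -> C) x : cont_at f x <->
  forall e : R, 0 < e -> \forall y \near x, nc (f y - f x) < e.
Proof.
split => [[h] e e0|h]; last split => A /nbhsCP[e e0 hA].
  have := h [set w | nc (w - f x) < e]; apply.
  by apply/nbhsCP; exists e.
by near=> y; apply: hA; near: y; exact: h.
Unshelve. all: by end_near. Qed.

Lemma ccontP (f : C -> C) z : cont_at f z <->
  forall e : R, 0 < e -> exists2 d : R, 0 < d &
    forall w, nc (w - z) < d -> nc (f w - f z) < e.
Proof.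
rewrite continuousCP; split=> h e e0; first by have /nbhsCP := h _ e0.
exact/nbhsCP/h.
Qed.

Section Topological.
Context {T : topologicalType}.
Implicit Types (f g : T -> C).

Lemma ccont_cst (c : C) x : cont_at (fun _ : T => c) x.
Proof. by split; exact: cst_continuous. Qed.

Lemma ccontD f g x : cont_at f x -> cont_at g x ->
  cont_at (fun y => f y + g y) x.
Proof. by move=> [hf] [hg]; split; exact: (@continuousD R[i] R[i]^o T f g x hf hg). Qed.

Lemma ccontN f x : cont_at f x ->
  cont_at (fun y => - f y) x.
Proof. by move=> [hf]; split; exact: (@continuousN R[i] R[i]^o T f x hf). Qed.

Lemma ccontB f g x : cont_at f x -> cont_at g x ->
  cont_at (fun y => f y - g y) x.
Proof. by move=> [hf] [hg]; split; exact: (@continuousB R[i] R[i]^o T f g x hf hg). Qed.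

Lemma ccontM f g x : cont_at f x -> cont_at g x ->
  cont_at (fun y => f y * g y) x.
Proof. by move=> [hf] [hg]; split; exact: (@continuousM R[i] T f g x hf hg). Qed.

Lemma ccontV f x : f x != 0 -> cont_at f x ->
  cont_at (fun y => (f y)^-1) x.
Proof. by move=> h [hf]; split; exact: (@continuousV R[i] T f x h hf). Qed.

Lemma cont_nc f x : cont_at f x -> cont_at (fun y => nc (f y)) x.
Proof.
move=> /continuousCP h; apply/rcontP => e /h; apply: filterS => y; apply: le_lt_trans.
have h1 := nc_sub_ge (f y) (f x); have h2 := nc_sub_ge (f x) (f y).
by rewrite ncB in h2; rewrite ler_norml; apply/andP; split; lra.
Qed.

Lemma cont_Re f x : cont_at f x -> cont_at (fun y => Re (f y)) x.
Proof.
move=> /continuousCP h; apply/rcontP => e /h; apply: filterS => y; apply: le_lt_trans.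
by apply: le_trans (nc_Re_le _); rewrite ReD ReN.
Qed.

Lemma cont_Im f x : cont_at f x -> cont_at (fun y => Im (f y)) x.
Proof.
move=> /continuousCP h; apply/rcontP => e /h; apply: filterS => y; apply: le_lt_trans.
by apply: le_trans (nc_Im_le _); rewrite ImD ImN.
Qed.

Lemma ccont_ReIm (a b : T -> R) x : cont_at a x -> cont_at b x ->
  cont_at (fun y => (a y +i* b y : C)) x.
Proof.
move=> /rcontP ha /rcontP hb; apply/continuousCP => e e0.
have e2 : 0 < e / 2 by rewrite divr_gt0.
apply: filterS2 (ha _ e2) (hb _ e2) => y h1 h2.
by apply: le_lt_trans (nc_le_ReIm _) _; rewrite /= [ltRHS]Num.Theory.splitr ltrD.
Qed.
End Topological.

Lemma ccont_id z : cont_at (fun w : C => w) z.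
Proof. by split=> A. Qed.

Lemma ccont_near (f g : C -> C) z : (\forall w \near z, f w = g w) ->
  cont_at g z -> cont_at f z.
Proof.
move=> h /continuousCP cg; apply/continuousCP => e /cg ge.
by have hz := nbhs_singleton h; apply: filterS2 h ge => w ->; rewrite hz.
Qed.

(** The centre is a limit of its punctured neighbourhood. This carries identities known off a point,
    such as those of a local form, to the point itself. *)
Lemma ccont_eq (f g : C -> C) z : cont_at f z -> cont_at g z ->
  (\forall w \near z^', f w = g w) -> f z = g z.
Proof.
move=> /ccontP cf /ccontP cg /dnbhsCP[d d0 hd].
apply/eqP; rewrite -subr_eq0 -nc_eq0 eq_le nc_ge0 andbT.
apply/ler_addgt0Pl => e e0; rewrite addr0.
have e2 : 0 < e / 2 by rewrite divr_gt0.
have [d1 d10 h1] := cf _ e2; have [d2 d20 h2] := cg _ e2.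
pose m := Num.min d (Num.min d1 d2); have m0 : 0 < m by rewrite !lt_min d0 d10 d20.
pose w : C := z + (m / 2)%:C.
have hw : nc (w - z) = m / 2.
  by rewrite /w addrAC subrr add0r nc_real ger0_norm // ltW // divr_gt0.
have hwm : nc (w - z) < m by rewrite hw ltr_pdivrMr // mulr_natr mulr2n ltrDl.
have [md md1 md2] : [/\ m <= d, m <= d1 & m <= d2] by rewrite !ge_min !lexx !orbT.
have wz : w != z by rewrite -subr_eq0 -nc_eq0 hw gt_eqF // divr_gt0.
rewrite (le_trans (nc_triangle (f w) _ _)) // [leRHS]Num.Theory.splitr lerD // ltW //.
  by rewrite ncB h1 // (lt_le_trans hwm).
by rewrite hd ?h2 // (lt_le_trans hwm).
Qed.

End Modulus.

(** * Cousin's lemma and complex derivatives *)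

Section Cousin.
Context {R : realType}.
Implicit Types (I J : R * R).

Let half (c : bool) I : R * R :=
  if c then ((I.1 + I.2) / 2, I.2) else (I.1, (I.1 + I.2) / 2).

Let half_le c I : I.1 <= I.2 ->
  [/\ (half c I).1 <= (half c I).2, I.1 <= (half c I).1, (half c I).2 <= I.2 &
      (half c I).2 - (half c I).1 = (I.2 - I.1) / 2].
Proof. by case: c => /= h; split; lra. Qed.

Lemma geo_small (L d : R) : 0 < d -> exists n, L / 2 ^+ n < d.
Proof.
move=> d0; exists (Num.bound (L / d)).
rewrite ltr_pdivrMr ?exprn_gt0 // mulrC -ltr_pdivrMr //.
apply: le_lt_trans (ler_norm _) _; apply: lt_trans (archi_boundP (normr_ge0 _)) _.
by rewrite /Num.bound normr_id -natrX ltr_nat ltn_expl.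
Qed.

Let nested (I : nat -> R * R) : (I 0%N).1 <= (I 0%N).2 ->
  (forall n, exists c, I n.+1 = half c (I n)) ->
  exists x, forall n, [/\ (I n).1 <= x <= (I n).2, (I 0%N).1 <= (I n).1,
    (I n).2 <= (I 0%N).2 & (I n).2 - (I n).1 = ((I 0%N).2 - (I 0%N).1) / 2 ^+ n].
Proof.
move=> I0 hI.
have le n : (I n).1 <= (I n).2.
  elim: n => // n IH; have [c ->] := hI n; by have [] := half_le c IH.
have up m n : (m <= n)%N -> (I m).1 <= (I n).1 /\ (I n).2 <= (I m).2.
  elim: n => [|n IH]; first by rewrite leqn0 => /eqP ->.
  rewrite leq_eqVlt => /orP[/eqP ->//|/IH[h1 h2]].
  have [c ->] := hI n; have [_ h3 h4 _] := half_le c (le n).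
  by split; [exact: le_trans h3|exact: le_trans h2].
have cross m n : (I m).1 <= (I n).2.
  have [/up[h _]|/ltnW/up[_ h]] := leqP m n; first exact: le_trans h (le _).
  exact: le_trans (le _) h.
pose A := range (fun n => (I n).1).
have ubA n : ubound A (I n).2 by move=> _ [m _ <-]; exact: cross.
have supA : has_sup A by split; [exists (I 0%N).1; exists 0%N|exists (I 0%N).2].
exists (sup A) => n; have [h1 h2] := up _ _ (leq0n n); split => //.
  apply/andP; split; first by apply: sup_upper_bound => //; exists n.
  by apply: ge_sup => //; exact: supA.1.
elim: n {h1 h2} => [|n IH]; first by rewrite expr0 divr1.
have [c ->] := hI n; have [_ _ _ ->] := half_le c (le n).
by rewrite IH exprSr invfM mulrA.
Qed.

(* Cousin's lemma: bisecting a rectangle on which [P] fails produces nested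
   rectangles shrinking to a point at which [P] fails locally. *)
Lemma cousin (P : R -> R -> R -> R -> Prop) (a1 a2 b1 b2 : R) :
  a1 <= a2 -> b1 <= b2 ->
  (forall a a' b b', let m := (a + a') / 2 in let n := (b + b') / 2 in
     [/\ a1 <= a, a <= a' & a' <= a2] -> [/\ b1 <= b, b <= b' & b' <= b2] ->
     P a m b n -> P m a' b n -> P a m n b' -> P m a' n b' -> P a a' b b') ->
  (forall x y, a1 <= x <= a2 -> b1 <= y <= b2 -> exists2 d, 0 < d &
     forall a a' b b', [/\ a1 <= a, a <= x, x <= a' & a' <= a2] ->
       [/\ b1 <= b, b <= y, y <= b' & b' <= b2] ->
       a' - a < d -> b' - b < d -> P a a' b b') ->
  P a1 a2 b1 b2.
Proof.
move=> ha hb glue loc.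
pose PP (Q : (R * R) * (R * R)) := P Q.1.1 Q.1.2 Q.2.1 Q.2.2.
pose sub Q (cd : bool * bool) := (half cd.1 Q.1, half cd.2 Q.2).
(* A quarter on which [P] fails. The default [(false, false)] could only arise if [P] held on all
   four quarters, and then [glue] gives [P] on [Q]. *)
pose step Q := sub Q (xget (false, false) [set cd | ~ PP (sub Q cd)]).
pose Q n := iter n step ((a1, a2), (b1, b2)).
apply: contrapT => nP.
have [x hx] : exists x, forall n, [/\ (Q n).1.1 <= x <= (Q n).1.2, a1 <= (Q n).1.1,
    (Q n).1.2 <= a2 & (Q n).1.2 - (Q n).1.1 = (a2 - a1) / 2 ^+ n].
  have hs n : exists c, (Q n.+1).1 = half c (Q n).1 by rewrite /Q iterS /=; eexists.
  exact: (@nested (fun n => (Q n).1) ha hs).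
have [y hy] : exists x, forall n, [/\ (Q n).2.1 <= x <= (Q n).2.2, b1 <= (Q n).2.1,
    (Q n).2.2 <= b2 & (Q n).2.2 - (Q n).2.1 = (b2 - b1) / 2 ^+ n].
  have hs n : exists c, (Q n.+1).2 = half c (Q n).2 by rewrite /Q iterS /=; eexists.
  exact: (@nested (fun n => (Q n).2) hb hs).
have nPQ n : ~ PP (Q n).
  elim: n => // n IH; rewrite /Q iterS -/(Q n).
  have [/andP[x1 x2] x3 x4 _] := hx n; have [/andP[y1 y2] y3 y4 _] := hy n.
  suff : exists cd, [set cd | ~ PP (sub (Q n) cd)] cd.
    by move=> [cd hcd]; exact: (xgetPex (false, false) (ex_intro _ cd hcd)).
  apply: contrapT => /forallNP h; apply: IH.
  have {}h c d : PP (sub (Q n) (c, d)) by apply: contrapT; exact: (h (c, d)).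
  apply: glue.
  - by split => //; exact: le_trans x1 x2.
  - by split => //; exact: le_trans y1 y2.
  - exact: (h false false).
  - exact: (h true false).
  - exact: (h false true).
  - exact: (h true true).
have [/andP[x1 x2] _ _ _] := hx 0%N; have [/andP[y1 y2] _ _ _] := hy 0%N.
have [||d d0 hd] := loc x y; [exact/andP|exact/andP|].
have [n hn] := geo_small (Num.max (a2 - a1) (b2 - b1)) d0.
apply: (nPQ n); apply: hd.
- by have [/andP[? ?] ? ? _] := hx n; split.
- by have [/andP[? ?] ? ? _] := hy n; split.
- have [_ _ _ ->] := hx n; apply: le_lt_trans hn.
  by rewrite ler_wpM2r ?invr_ge0 ?exprn_ge0 // le_max lexx.
- have [_ _ _ ->] := hy n; apply: le_lt_trans hn.
  by rewrite ler_wpM2r ?invr_ge0 ?exprn_ge0 // le_max lexx orbT.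
Qed.

End Cousin.

Section ComplexDerivative.
Context {R : realType}.
Local Notation C := (R[i]^o).
Local Notation nc := (@Normc.normc R).
Implicit Types (f g : C -> C) (z w : C).

(* Caratheodory's form of complex differentiability. *)
Definition cdiff f z := exists2 phi : C -> C, cont_at phi z &
  forall w, f w - f z = phi w * (w - z).

(** The factor is the difference quotient, completed by [l] at [z]. Its value at [z] is recorded
    because differentiating the logarithm requires the derivative of [cexp] to be nonzero. *)
Lemma cdiff_of_eps f z (l : C) :
  (forall e : R, 0 < e -> exists2 d : R, 0 < d & forall w, nc (w - z) < d ->
    nc (f w - f z - l * (w - z)) <= e * nc (w - z)) ->
  exists phi : C -> C, [/\ cont_at phi z, phi z = l &
    forall w, f w - f z = phi w * (w - z)].
Proof.
move=> hl; exists (fun w => if w == z then l else (f w - f z) / (w - z)).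
rewrite eqxx; split => //.
  apply/ccontP => e e0; have e2 : 0 < e / 2 by rewrite divr_gt0.
  have [d d0 hd] := hl _ e2; exists d => // w hw; rewrite eqxx.
  case: eqP => [_|/eqP wz]; first by rewrite subrr nc0.
  have wz0 : w - z != 0 by rewrite subr_eq0.
  have -> : (f w - f z) / (w - z) - l = (f w - f z - l * (w - z)) / (w - z).
    by rewrite [RHS]mulrBl mulfK.
  rewrite ncM ncV ltr_pdivrMr ?nc_gt0 //; apply: le_lt_trans (hd _ hw) _.
  by rewrite ltr_pM2r ?nc_gt0 // ltr_pdivrMr // mulr_natr mulr2n ltrDl.
move=> w; case: eqP => [->|/eqP wz]; first by rewrite !subrr mulr0.
by rewrite divfK // subr_eq0.
Qed.

Lemma cdiff_eps f z : cdiff f z <-> exists l : C, forall e : R, 0 < e ->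
  exists2 d : R, 0 < d & forall w, nc (w - z) < d ->
    nc (f w - f z - l * (w - z)) <= e * nc (w - z).
Proof.
split=> [[phi /ccontP cphi hphi]|[l /cdiff_of_eps[phi [? _ ?]]]]; last by exists phi.
exists (phi z) => e e0; have [d d0 hd] := cphi _ e0; exists d => // w hw.
by rewrite hphi -mulrBl ncM ler_wpM2r ?nc_ge0 // ltW // hd.
Qed.

Lemma derivable_cdiff f z : derivable f z 1 -> cdiff f z.
Proof.
move=> /cvg_ex[/= l hl]; apply/cdiff_eps; exists l => e e0.
have : \forall h \near (0 : C)^', nc (h^-1 * (f (h * 1 + z) - f z) - l) < e.
  have := hl [set w | nc (w - l) < e]; apply.
  by apply/nbhsCP; exists e.
move=> /dnbhsCP[d d0 hd]; exists d => // w hw.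
have [->|wz] := eqVneq w z; first by rewrite !subrr mulr0 subrr nc0 mulr0.
have wz0 : w - z != 0 by rewrite subr_eq0.
have := hd (w - z); rewrite subr0 => /(_ hw wz0).
rewrite mulr1 subrK => /ltW h.
rewrite -(ler_pM2r (x := nc (w - z))) ?nc_gt0 // -ncM in h.
by rewrite mulrBl mulrAC mulVf // mul1r in h.
Qed.

Lemma cdiff_cont f z : cdiff f z -> cont_at f z.
Proof.
move=> [phi cphi hphi].
have -> : f = (fun w => f z + phi w * (w - z)).
  by apply/funext => w; rewrite -hphi addrC subrK.
apply: ccontD; first exact: ccont_cst.
by apply: ccontM => //; apply: ccontB; [exact: ccont_id|exact: ccont_cst].
Qed.

Lemma cdiff_cst (c : C) z : cdiff (fun=> c) z.
Proof.
by exists (fun=> 0) => [|w]; [exact: ccont_cst|rewrite subrr mul0r].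
Qed.

Lemma cdiff_id z : cdiff (fun w => w) z.
Proof. by exists (fun=> 1) => [|w]; [exact: ccont_cst|rewrite mul1r]. Qed.

Lemma cdiffD f g z : cdiff f z -> cdiff g z -> cdiff (fun w => f w + g w) z.
Proof.
move=> [p cp hp] [q cq hq]; exists (fun w => p w + q w); first exact: ccontD.
by move=> w; rewrite mulrDl -hp -hq; ring.
Qed.

Lemma cdiffM f g z : cdiff f z -> cdiff g z -> cdiff (fun w => f w * g w) z.
Proof.
move=> df dg; have cg := cdiff_cont dg; move: df dg => [p cp hp] [q cq hq].
exists (fun w => p w * g w + f z * q w).
  by apply: ccontD; apply: ccontM => //; exact: ccont_cst.
move=> w; have -> : (p w * g w + f z * q w) * (w - z) =
  (p w * (w - z)) * g w + f z * (q w * (w - z)) by ring.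
by rewrite -hp -hq; ring.
Qed.

Lemma cdiffN f z : cdiff f z -> cdiff (fun w => - f w) z.
Proof.
move=> [p cp hp]; exists (fun w => - p w); first exact: ccontN.
by move=> w; rewrite mulNr -hp; ring.
Qed.

Lemma cdiffB f g z : cdiff f z -> cdiff g z -> cdiff (fun w => f w - g w) z.
Proof. by move=> df dg; apply: cdiffD => //; exact: cdiffN. Qed.

Lemma cdiff_near f g z : (\forall w \near z, f w = g w) -> cdiff g z -> cdiff f z.
Proof.
move=> h; have hz := nbhs_singleton h; move: h => /nbhsCP[d d0 hd].
move=> /cdiff_eps[l hl]; apply/cdiff_eps; exists l => e e0.
have [d' d'0 hd'] := hl _ e0; exists (Num.min d d'); first by rewrite lt_min d0.
by move=> w; rewrite lt_min => /andP[h1 h2]; rewrite hz hd // hd'.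
Qed.

Lemma cdiff_comp f g z : cdiff f z -> cdiff g (f z) -> cdiff (fun w => g (f w)) z.
Proof.
move=> df; have cf := cdiff_cont df; move: df => [p cp hp] [q cq hq].
exists (fun w => q (f w) * p w); last by move=> w; rewrite hq hp mulrA.
by apply: ccontM => //; exact: cont_comp cf cq.
Qed.

Lemma cdiffV f z : f z != 0 -> cdiff f z -> cdiff (fun w => (f w)^-1) z.
Proof.
move=> fz df; apply: (@cdiff_comp f (fun w => w^-1) z df).
apply/cdiff_eps; exists (- (f z)^-2) => e e0.
set a := f z in fz *; have na : 0 < nc a by rewrite nc_gt0.
(* The first bound gives [nc w > nc a / 2]. The remainder [(w - a)^2 / (w a^2)] is then at most
   [2 nc (w - a)^2 / nc a ^+ 3], which explains the second. *)
pose d := Num.min (nc a / 2) (e * nc a ^+ 3 / 2).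
have d0 : 0 < d by rewrite lt_min !divr_gt0 // mulr_gt0 // exprn_gt0.
exists d => // w; rewrite lt_min => /andP[h1 h2].
have nw : nc a / 2 < nc w.
  have := nc_sub_ge a w; rewrite ncB => h3.
  by rewrite -subr_gt0; move: h1 h3; lra.
have nw0 : 0 < nc w by apply: lt_trans nw; rewrite divr_gt0.
have w0 : w != 0 by rewrite -nc_gt0.
have -> : w^-1 - a^-1 - - (a^-2) * (w - a) = (w - a) / w / a ^+ 2 * (w - a).
  by field; apply/andP; split.
rewrite ncM ler_wpM2r ?nc_ge0 // !ncM !ncV ncX.
rewrite ler_pdivrMr ?exprn_gt0 // ler_pdivrMr //.
apply: le_trans (ltW h2) _.
have := mulr_gt0 (mulr_gt0 e0 (exprn_gt0 2 na)) na; rewrite !exprS expr0 mulr1.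
have : 0 <= (nc w - nc a / 2) * (e * (nc a * nc a)).
  by rewrite !mulr_ge0 ?subr_ge0 ?(ltW nw) ?(ltW e0) ?(ltW na).
nra.
Qed.

Lemma cdiff_div f g z : g z != 0 -> cdiff f z -> cdiff g z ->
  cdiff (fun w => f w / g w) z.
Proof. by move=> ? ? ?; apply: cdiffM => //; exact: cdiffV. Qed.

Lemma cdiffX f z n : cdiff f z -> cdiff (fun w => f w ^+ n) z.
Proof.
move=> df; elim: n => [|n IH].
  by under [X in cdiff X]eq_fun do rewrite expr0; exact: cdiff_cst.
by under [X in cdiff X]eq_fun do rewrite exprS; exact: cdiffM.
Qed.

Lemma cdiff_sum {I : Type} (s : seq I) (P : pred I) (F : I -> C -> C) z :
  (forall i, P i -> cdiff (F i) z) ->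
  cdiff (fun w => \sum_(i <- s | P i) F i w) z.
Proof.
move=> h; elim: s => [|i s IH].
  by under [X in cdiff X]eq_fun do rewrite big_nil; exact: cdiff_cst.
under [X in cdiff X]eq_fun do rewrite big_cons.
by case Pi: (P i) => //; apply: cdiffD => //; exact: h.
Qed.

Lemma cdiff_prod {I : Type} (s : seq I) (P : pred I) (F : I -> C -> C) z :
  (forall i, P i -> cdiff (F i) z) ->
  cdiff (fun w => \prod_(i <- s | P i) F i w) z.
Proof.
move=> h; elim: s => [|i s IH].
  by under [X in cdiff X]eq_fun do rewrite big_nil; exact: cdiff_cst.
under [X in cdiff X]eq_fun do rewrite big_cons.
by case Pi: (P i) => //; apply: cdiffM => //; exact: h.
Qed.

End ComplexDerivative.

(** * Integrals over intervals and circle means *)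

Section IntervalIntegral.
Context {R : realType}.
Local Notation mu := (@lebesgue_measure R).
Implicit Types (F G : R -> R) (a b c : R).

Definition itv_cont F a b := forall x, a <= x <= b -> cont_at F x.

Definition itv_int F a b : R := \int[mu]_(x in `[a, b]) F x.

Lemma itv_integrable F a b : itv_cont F a b ->
  mu.-integrable `[a, b] (EFin \o F).
Proof.
move=> h; apply: continuous_compact_integrable; first exact: segment_compact.
apply: continuous_in_subspaceT => x; by rewrite inE /= in_itv /= => /h[].
Qed.

Lemma itv_cont_sub F a b a' b' : a <= a' -> b' <= b -> itv_cont F a b -> itv_cont F a' b'.
Proof. by move=> h1 h2 h x /andP[h3 h4]; apply: h; rewrite (le_trans h1) ?(le_trans h4). Qed.

Lemma eq_itv_int F G a b : (forall x, a <= x <= b -> F x = G x) ->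
  itv_int F a b = itv_int G a b.
Proof. by move=> h; apply: eq_Rintegral => x; rewrite inE /= in_itv /=; exact: h. Qed.

Lemma itv_intD F G a b : itv_cont F a b -> itv_cont G a b ->
  itv_int (fun x => F x + G x) a b = itv_int F a b + itv_int G a b.
Proof. by move=> hF hG; apply: RintegralD => //; exact: itv_integrable. Qed.

Lemma itv_intB F G a b : itv_cont F a b -> itv_cont G a b ->
  itv_int (fun x => F x - G x) a b = itv_int F a b - itv_int G a b.
Proof. by move=> hF hG; apply: RintegralB => //; exact: itv_integrable. Qed.

Lemma itv_intZ F a b c : itv_cont F a b ->
  itv_int (fun x => c * F x) a b = c * itv_int F a b.
Proof. by move=> hF; apply: RintegralZl => //; exact: itv_integrable. Qed.

Lemma itv_cont_cst c a b : itv_cont (fun=> c) a b.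
Proof. by move=> x _; exact: rcont_cst. Qed.

Lemma itv_int_cst c a b : a <= b -> itv_int (fun=> c) a b = c * (b - a).
Proof.
move=> ab; rewrite /itv_int Rintegral_cst //.
rewrite -[LHS]/(c * fine (lebesgue_measure (`[a, b]%classic : set R))) lebesgue_measure_itv /= lte_fin.
by move: ab; rewrite le_eqVlt => /orP[/eqP ->|->]; rewrite ?ltxx ?subrr.
Qed.

Lemma le_itv_int F G a b : itv_cont F a b -> itv_cont G a b ->
  (forall x, a <= x <= b -> F x <= G x) -> itv_int F a b <= itv_int G a b.
Proof.
move=> hF hG h; apply: le_Rintegral => //; try exact: itv_integrable.
Qed.

Lemma itv_int_norm_le F a b c : a <= b -> itv_cont F a b ->
  (forall x, a <= x <= b -> `|F x| <= c) -> `|itv_int F a b| <= c * (b - a).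
Proof.
move=> ab hF h; rewrite ler_norml -mulNr.
rewrite -(itv_int_cst c ab) -(itv_int_cst (- c) ab); apply/andP; split;
  apply: le_itv_int => //; try exact: itv_cont_cst.
  by move=> x /h; rewrite ler_norml => /andP[].
by move=> x /h; rewrite ler_norml => /andP[].
Qed.

Lemma itv_int_split F a b c : a <= c -> c <= b -> itv_cont F a b ->
  itv_int F a b = itv_int F a c + itv_int F c b.
Proof.
move=> ac cb hF; have iF := itv_integrable hF.
have := @Rintegral_itvB R F (BLeft a) (BRight b) c iF.
rewrite !bnd_simp => /(_ ac cb) h.
have h2 : mu.-integrable `]c, b] (EFin \o F).
  apply: (@integrableS _ _ _ mu `[a, b]) => //.
  by move=> x /=; rewrite !in_itv /= => /andP[h1 ->]; rewrite (le_trans ac (ltW h1)).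
by move: h; rewrite (Rintegral_itv_obnd_cbnd h2) /itv_int => <-; rewrite addrC subrK.
Qed.

End IntervalIntegral.

Section CircleMean.
Context {R : realType}.
Local Notation mu := (@lebesgue_measure R).
Local Notation C := (R[i]^o).
Local Notation nc := (@Normc.normc R).
Implicit Types (u v : C -> R) (g k : C -> C) (r : R).

Lemma nc_circle r t : 0 <= r -> nc (circle_pt r t : C) = r.
Proof.
move=> r0; rewrite /= !exprMn -mulrDr cos2Dsin2 mulr1 sqrtr_sqr ger0_norm //.
Qed.

Lemma circle_continuous r t : cont_at (circle_pt r : R -> C) t.
Proof.
by apply: ccont_ReIm; apply: rcontM; try exact: rcont_cst; split;
  [exact: continuous_cos|exact: continuous_sin].
Qed.

Definition circ_cont u r := forall z : C, nc z = r -> cont_at u z.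

Definition cmean u r : R := (2 * pi)^-1 * itv_int (fun t => u (circle_pt r t)) 0 (2 * pi).

Lemma circ_cont_itv u r a b : 0 <= r -> circ_cont u r ->
  itv_cont (fun t => u (circle_pt r t)) a b.
Proof.
move=> r0 h t _; apply: (@cont_comp R C R (circle_pt r)).
  exact: circle_continuous.
by apply: h; rewrite nc_circle.
Qed.

Let pi2_gt0 : 0 < 2 * pi :> R. Proof. by rewrite mulr_gt0 // pi_gt0. Qed.

Lemma eq_cmean u v r : 0 <= r -> (forall z, nc z = r -> u z = v z) -> cmean u r = cmean v r.
Proof.
by move=> r0 h; congr (_ * _); apply: eq_itv_int => t _; rewrite h // nc_circle.
Qed.

Lemma cmeanD u v r : 0 <= r -> circ_cont u r -> circ_cont v r ->
  cmean (fun z => u z + v z) r = cmean u r + cmean v r.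
Proof.
by move=> r0 hu hv; rewrite /cmean itv_intD ?mulrDr //; exact: circ_cont_itv.
Qed.

Lemma cmeanB u v r : 0 <= r -> circ_cont u r -> circ_cont v r ->
  cmean (fun z => u z - v z) r = cmean u r - cmean v r.
Proof.
by move=> r0 hu hv; rewrite /cmean itv_intB ?mulrBr //; exact: circ_cont_itv.
Qed.

Lemma cmeanZ u r c : 0 <= r -> circ_cont u r ->
  cmean (fun z => c * u z) r = c * cmean u r.
Proof.
by move=> r0 hu; rewrite /cmean itv_intZ; [exact: mulrCA|exact: circ_cont_itv].
Qed.

Lemma cmean_cst r c : cmean (fun=> c) r = c.
Proof.
have aux (P : R) : 0 < P -> P^-1 * itv_int (fun=> c) 0 P = c.
  by move=> P0; rewrite itv_int_cst ?ltW // subr0 mulrCA mulVf ?mulr1 // gt_eqF.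
exact: (aux _ pi2_gt0).
Qed.

Lemma circ_cont_cst r c : circ_cont (fun=> c) r.
Proof. by move=> z _; exact: rcont_cst. Qed.

Lemma circ_contD u v r : circ_cont u r -> circ_cont v r ->
  circ_cont (fun z => u z + v z) r.
Proof. by move=> hu hv z hz; apply: rcontD; [exact: hu|exact: hv]. Qed.

Lemma circ_contB u v r : circ_cont u r -> circ_cont v r ->
  circ_cont (fun z => u z - v z) r.
Proof. by move=> hu hv z hz; apply: rcontB; [exact: hu|exact: hv]. Qed.

Lemma circ_contM u v r : circ_cont u r -> circ_cont v r ->
  circ_cont (fun z => u z * v z) r.
Proof. by move=> hu hv z hz; apply: rcontM; [exact: hu|exact: hv]. Qed.

Lemma circ_cont_norm u r : circ_cont u r -> circ_cont (fun z => `|u z|) r.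
Proof. by move=> hu z hz; apply: rcont_norm; exact: hu. Qed.

Lemma circ_cont_sum {I : eqType} (s : seq I) (F : I -> C -> R) r :
  (forall i, i \in s -> circ_cont (F i) r) ->
  circ_cont (fun z => \sum_(i <- s) F i z) r.
Proof.
elim: s => [|i s IH] h.
  under [X in circ_cont X]eq_fun do rewrite big_nil; exact: circ_cont_cst.
under [X in circ_cont X]eq_fun do rewrite big_cons.
apply: circ_contD; first by apply: h; rewrite mem_head.
by apply: IH => j js; apply: h; rewrite in_cons js orbT.
Qed.

Lemma cmean_sum {I : eqType} (s : seq I) (F : I -> C -> R) r : 0 <= r ->
  (forall i, i \in s -> circ_cont (F i) r) ->
  cmean (fun z => \sum_(i <- s) F i z) r = \sum_(i <- s) cmean (F i) r.
Proof.
move=> r0; elim: s => [|i s IH] h.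
  by under [X in cmean X]eq_fun do rewrite big_nil; rewrite cmean_cst big_nil.
under [X in cmean X]eq_fun do rewrite big_cons.
have hs j : j \in s -> circ_cont (F j) r.
  by move=> js; apply: h; rewrite in_cons js orbT.
rewrite cmeanD //; [|by apply: h; rewrite mem_head|exact: circ_cont_sum].
by rewrite big_cons IH.
Qed.

Lemma le_cmean u v r : 0 <= r -> circ_cont u r -> circ_cont v r ->
  (forall z, nc z = r -> u z <= v z) -> cmean u r <= cmean v r.
Proof.
move=> r0 hu hv h; rewrite ler_wpM2l ?invr_ge0 ?(ltW pi2_gt0) //.
apply: le_itv_int; try exact: circ_cont_itv.
by move=> t _; apply: h; rewrite nc_circle.
Qed.

Lemma cmean_norm_le u r c : 0 <= r -> circ_cont u r ->
  (forall z, nc z = r -> `|u z| <= c) -> `|cmean u r| <= c.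
Proof.
move=> r0 hu h; rewrite ler_norml -(cmean_cst r c) -(cmean_cst r (- cmean (fun=> c) r)).
rewrite [X in - X]cmean_cst; apply/andP; split; apply: le_cmean => //; try exact: circ_cont_cst.
  by move=> z /h; rewrite ler_norml => /andP[].
by move=> z /h; rewrite ler_norml => /andP[].
Qed.

Lemma norm_cmean_le u r : 0 <= r -> circ_cont u r ->
  `|cmean u r| <= cmean (fun z => `|u z|) r.
Proof.
move=> r0 hu; rewrite ler_norml -mulN1r -cmeanZ //; last exact: circ_cont_norm.
apply/andP; split; apply: le_cmean => //.
- by apply: circ_contM; [exact: circ_cont_cst|exact: circ_cont_norm].
- by move=> z _; rewrite mulN1r lerNl ler_normr lexx orbT.
- exact: circ_cont_norm.
- by move=> z _; rewrite ler_normr lexx.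
Qed.

Lemma cmean_ge0 u r : 0 <= r -> (forall z, nc z = r -> 0 <= u z) -> 0 <= cmean u r.
Proof.
move=> r0 h; rewrite mulr_ge0 ?invr_ge0 ?(ltW pi2_gt0) //.
by apply: Rintegral_ge0 => t _; apply: h; rewrite nc_circle.
Qed.

(** Admitting radius [0] turns the mean value property into constancy of the mean as a function of
    the radius. *)
Lemma cmean0 u : cmean u 0 = u 0.
Proof.
rewrite -[RHS](cmean_cst 0); apply: eq_cmean => // z /eqP; rewrite nc_eq0 => /eqP -> //.
Qed.

Lemma circle_dist r r0 t s : 0 <= r0 ->
  nc ((circle_pt r t : C) - circle_pt r0 s) <= `|r - r0| + nc ((circle_pt r0 t : C) - circle_pt r0 s).
Proof.
move=> h0; apply: le_trans (nc_triangle (circle_pt r0 t) _ _) _; rewrite lerD2r.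
have -> : (circle_pt r t : C) - circle_pt r0 t = (r - r0)%:C * circle_pt 1 t.
  by rewrite /circle_pt; congr (_ +i* _) => /=; ring.
by rewrite ncM nc_circle // mulr1 nc_real.
Qed.

Lemma circ_unif_cont u r0 e : 0 <= r0 -> circ_cont u r0 -> 0 < e ->
  exists2 d, 0 < d & forall r t, 0 <= t <= 2 * pi -> `|r - r0| < d ->
    `|u (circle_pt r t) - u (circle_pt r0 t)| <= e.
Proof.
move=> h0 hu e0.
pose P (a a' b b' : R) := exists2 d, 0 < d & forall r t, b <= t <= b' -> `|r - r0| < d ->
    `|u (circle_pt r t) - u (circle_pt r0 t)| <= e.
(* With the first side degenerate, Cousin's lemma is compactness of the interval of angles. *)
apply: (@cousin R P 0 0 0 (2 * pi)) => //; first exact: ltW.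
- move=> a a' b b' m n _ [_ bb' _] [d d0 hd] _ [d' d'0 hd'] _.
  exists (Num.min d d'); first by rewrite lt_min d0.
  move=> r t /andP[t1 t2]; rewrite lt_min => /andP[h1 h2].
  have [tn|nt] := lerP t n; first by apply: hd => //; rewrite t1.
  by apply: hd' => //; rewrite (ltW nt).
- move=> x0 s _ _; have cs : nc (circle_pt r0 s : C) = r0 by rewrite nc_circle.
  have e2 : 0 < e / 2 by rewrite divr_gt0.
  have : \forall z \near (circle_pt r0 s : C), `|u z - u (circle_pt r0 s)| < e / 2.
    by move/rcontP: (hu _ cs); apply.
  move=> /nbhsCP[d d0 hd]; have d2 : 0 < d / 2 by rewrite divr_gt0.
  have := circle_continuous r0 s => /continuousCP/(_ _ d2)/nbhs_ballP[d' /= d'0 hd'].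
  exists d' => // a a' b b' _ [_ bs sb' _] _ hbb'.
  exists (d / 2) => // r t /andP[t1 t2] hr.
  have ht : nc ((circle_pt r0 t : C) - circle_pt r0 s) < d / 2.
    apply: hd'; rewrite /ball /= ltr_norml; apply/andP; split; lra.
  have h1 := hd (circle_pt r t) (le_lt_trans (circle_dist _ _ _ h0) _).
  have h2 := hd (circle_pt r0 t) _.
  rewrite -[X in `|X|](subrKA (u (circle_pt r0 s))).
  apply: le_trans (ler_normD _ _) _; rewrite [leRHS]Num.Theory.splitr lerD // ltW //.
    by apply: h1; lra.
  by rewrite distrC; apply: h2; lra.
Qed.

Lemma circ_cont_Re g r : (forall z, nc z = r -> cont_at g z) ->
  circ_cont (fun z => Re (g z)) r.
Proof. by move=> h z hz; apply: cont_Re; exact: h. Qed.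

Lemma circ_cont_Im g r : (forall z, nc z = r -> cont_at g z) ->
  circ_cont (fun z => Im (g z)) r.
Proof. by move=> h z hz; apply: cont_Im; exact: h. Qed.

End CircleMean.

(** * Goursat's theorem on an annulus *)

Section ComplexExponential.
Context {R : realType}.
Local Notation C := (R[i]^o).
Local Notation nc := (@Normc.normc R).
Implicit Types (z w : C).

Lemma is_derive_eps (F : R -> R) (l x e : R) : is_derive x 1 F l -> 0 < e ->
  exists2 d : R, 0 < d & forall h, `|h| < d -> `|F (x + h) - F x - l * h| <= e * `|h|.
Proof.
move=> [dF <-] e0.
have : h^-1 *: (F (h *: 1 + x) - F x) @[h --> (0:R)^'] --> 'D_1 F x by exact: dF.
move=> /cvgrPdist_lt/(_ _ e0); rewrite /prop_near1 /dnbhs /within /=.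
move=> /nbhs_ballP[d /= d0 hd]; exists d => // h hh.
have [->|h0] := eqVneq h 0; first by rewrite addr0 subrr mulr0 subrr normr0 mulr0.
have := hd h; rewrite /ball /= sub0r normrN => /(_ hh h0) /ltW.
rewrite -[h *: 1]/(h * 1) mulr1 -[_ *: _]/(h^-1 * (F (h + x) - F x)) (addrC h x).
move=> h1; have -> : F (x + h) - F x - 'D_1 F x * h =
  h * (h^-1 * (F (x + h) - F x) - 'D_1 F x).
  by rewrite mulrBr mulVKf // (mulrC h).
by rewrite normrM mulrC ler_wpM2r // distrC.
Qed.

(** The complex exponential. In terms of [circle_pt], a vertical segment is mapped to a circle with
    the very parametrization that [cmean] integrates over. *)
Definition cexp z : C := circle_pt (expR (Re z)) (Im z).

Lemma cexpD z w : cexp (z + w) = cexp z * cexp w.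
Proof.
case: z w => a b [c d]; rewrite /cexp /circle_pt /= expRD cosD sinD.
by congr (_ +i* _) => /=; ring.
Qed.

Lemma cexp0 : cexp 0 = 1.
Proof. by rewrite /cexp /circle_pt /= expR0 cos0 sin0 mulr1 mulr0. Qed.

Lemma nc_cexp z : nc (cexp z) = expR (Re z).
Proof. by rewrite /cexp nc_circle // expR_ge0. Qed.

Lemma cexp_neq0 z : cexp z != 0.
Proof. by rewrite -nc_gt0 nc_cexp expR_gt0. Qed.

(** First-order expansion of the exponential at [0]: [E], [K], [S] stand for [exp x], [cos y],
    [sin y] and [n] for the modulus of [x + i y]. The four remainders add up to at most
    [7 * (e * n)], so the constant [12] has room to spare. *)
Lemma euler_estimate (x y n e E S K : R) : 0 <= n -> 0 < e -> e <= 1 / 12 -> n <= e ->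
  `|x| <= n -> `|y| <= n ->
  `|E - 1 - x| <= e * `|x| -> `|K - 1| <= e * `|y| -> `|S - y| <= e * `|y| ->
  `|E * K - 1 - x| + `|E * S - y| <= 12 * (e * n).
Proof.
move=> n0 e0 e1 ne xn yn hE hK hS.
have en : 0 <= e * n by rewrite mulr_ge0 // ltW.
have en1 : e * n <= n / 12 by have := ler_wpM2r n0 e1; lra.
have {}hE : `|E - 1 - x| <= e * n by apply: le_trans hE _; rewrite ler_wpM2l // ltW.
have {}hK : `|K - 1| <= e * n by apply: le_trans hK _; rewrite ler_wpM2l // ltW.
have {}hS : `|S - y| <= e * n by apply: le_trans hS _; rewrite ler_wpM2l // ltW.
have E2 : `|E - 1| <= 2 * n by have := ler_normD (E - 1 - x) x; rewrite subrK; lra.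
have Eb : `|E| <= 2 by have := ler_normD (E - 1) 1; rewrite subrK normr1; lra.
have -> : E * K - 1 - x = E * (K - 1) + (E - 1 - x) by ring.
have -> : E * S - y = E * (S - y) + (E - 1) * y by ring.
have k1 : `|E * (K - 1)| <= 2 * (e * n) by rewrite normrM ler_pM.
have k2 : `|E * (S - y)| <= 2 * (e * n) by rewrite normrM ler_pM.
have k3 : `|(E - 1) * y| <= 2 * n * e by rewrite normrM ler_pM // (le_trans yn).
by apply: le_trans (lerD (ler_normD _ _) (ler_normD _ _)) _; lra.
Qed.

Lemma cexp_eps (e : R) : 0 < e -> exists2 d : R, 0 < d & forall w, nc (w - 0) < d ->
  nc (cexp w - cexp 0 - 1 * (w - 0)) <= e * nc (w - 0).
Proof.
move=> e0; pose e' := Num.min 1 e / 12.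
have m0 : 0 < Num.min 1 e by rewrite lt_min ltr01.
have m1 : Num.min 1 e <= 1 by rewrite ge_min lexx.
have me : Num.min 1 e <= e by rewrite ge_min lexx orbT.
have e'0 : 0 < e' by rewrite divr_gt0.
have [d1 d10 h1] := is_derive_eps (is_derive_expR (0:R)) e'0.
have [d2 d20 h2] := is_derive_eps (is_derive_cos (0:R)) e'0.
have [d3 d30 h3] := is_derive_eps (is_derive_sin (0:R)) e'0.
pose d := Num.min d1 (Num.min d2 (Num.min d3 e')).
exists d; first by rewrite !lt_min d10 d20 d30.
move=> w; rewrite subr0 cexp0 mul1r !lt_min => /and4P[w1 w2 w3 w4].
have rw := nc_Re_le w; have iw := nc_Im_le w.
have := h1 _ (le_lt_trans rw w1); have := h2 _ (le_lt_trans iw w2).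
have := h3 _ (le_lt_trans iw w3).
rewrite !add0r sin0 cos0 expR0 oppr0 mul0r mul1r !subr0.
apply: (fun H a b c => le_trans (nc_le_ReIm _) (H a b c)).
have := nc_ge0 w; move: w4 rw iw {w1 w2 w3}; move: (nc w) => n.
case: w => x y /=; rewrite ?subr0 ?mul1r ?oppr0 ?addr0.
set S := sin y; set K := cos y; set E := expR x; move=> n4 xn yn n0.
have e'1 : e' <= 1/12 by rewrite /e'; lra.
have ee : 12 * e' <= e by rewrite /e'; lra.
move=> s1 c1 x1; apply: le_trans (euler_estimate n0 e'0 e'1 (ltW n4) xn yn x1 c1 s1) _.
by rewrite mulrA; apply: ler_wpM2r.
Qed.

Lemma cexp_caratheodory z : exists phi : C -> C, [/\ cont_at phi z, phi z = cexp z &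
  forall w, cexp w - cexp z = phi w * (w - z)].
Proof.
have [phi [cphi phi0 hphi]] := cdiff_of_eps cexp_eps.
exists (fun w => cexp z * phi (w - z)); split.
- apply: ccontM; first exact: ccont_cst.
  apply: (@cont_comp _ _ _ (fun w => w - z)); last by rewrite subrr.
  by apply: ccontB; [exact: ccont_id|exact: ccont_cst].
- by rewrite subrr phi0 mulr1.
move=> w; have := hphi (w - z); rewrite subr0 cexp0 -mulrA => <-.
by rewrite mulrBr mulr1 -cexpD (addrC z) subrK.
Qed.

Lemma cdiff_cexp z : cdiff cexp z.
Proof. by have [phi [cphi _ hphi]] := cexp_caratheodory z; exists phi. Qed.

End ComplexExponential.

Section Goursat.
Context {R : realType}.
Local Notation C := (R[i]^o).
Local Notation nc := (@Normc.normc R).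
Implicit Types (G g : C -> C) (a b : R).

(* The real part of the integral of [G] along the boundary of a rectangle. *)
Let bdry G a1 a2 b1 b2 : R :=
  itv_int (fun s => Re (G (s +i* b1)) - Re (G (s +i* b2))) a1 a2 -
  itv_int (fun t => Im (G (a2 +i* t)) - Im (G (a1 +i* t))) b1 b2.

Let cont_hor G a1 a2 b : (forall x, a1 <= x <= a2 -> cont_at G (x +i* b)) ->
  itv_cont (fun s => Re (G (s +i* b))) a1 a2.
Proof.
move=> h x hx; apply: cont_Re; apply: (@cont_comp R C C (fun s => s +i* b)); last exact: h.
by apply: ccont_ReIm; [split=> A|exact: rcont_cst].
Qed.

Let cont_ver G a b1 b2 : (forall y, b1 <= y <= b2 -> cont_at G (a +i* y)) ->
  itv_cont (fun t => Im (G (a +i* t))) b1 b2.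
Proof.
move=> h x hx; apply: cont_Im; apply: (@cont_comp R C C (fun s => a +i* s)); last exact: h.
by apply: ccont_ReIm; [exact: rcont_cst|split=> A].
Qed.

Let itv_contB (F K : R -> R) a b : itv_cont F a b -> itv_cont K a b ->
  itv_cont (fun x => F x - K x) a b.
Proof. by move=> h1 h2 x hx; apply: rcontB; [exact: h1|exact: h2]. Qed.

(** For two opposite sides: [u] and [v] are values of [G] on them, [p] and [p'] the linear parts at
    these points, and [c] the difference of the linear parts, constant along the side. *)
Let half_diff (u v u0 p p' c e D : R) : p - p' = c ->
  `|v - u0 - p'| <= e / 2 * D -> `|u - u0 - p| <= e / 2 * D -> `|u - v - c| <= e * D.
Proof.
move=> <- hv hu; have -> : u - v - (p - p') = (u - u0 - p) - (v - u0 - p') by ring.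
have -> : e * D = e / 2 * D + e / 2 * D by field.
by apply: le_trans (ler_normB _ _) (lerD hu hv).
Qed.

(** Cousin's lemma for the estimate of the boundary integral by [e] times the square of the
    half-perimeter. Inner sides cancel, and the four quarters have squares adding up to the whole,
    so the estimate passes from quarters to rectangle. Near a point the affine part of [G]
    integrates to zero and the remainder is small. *)
Lemma goursat G a1 a2 b1 b2 : a1 <= a2 -> b1 <= b2 ->
  (forall x y, a1 <= x <= a2 -> b1 <= y <= b2 -> cdiff G (x +i* y)) ->
  itv_int (fun s => Re (G (s +i* b1)) - Re (G (s +i* b2))) a1 a2 =
  itv_int (fun t => Im (G (a2 +i* t)) - Im (G (a1 +i* t))) b1 b2.
Proof.
move=> ha hb dG.
have cG x y : a1 <= x <= a2 -> b1 <= y <= b2 -> cont_at G (x +i* y).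
  by move=> hx hy; apply: cdiff_cont; exact: dG.
suff small e : 0 < e -> `|bdry G a1 a2 b1 b2| <= e * ((a2 - a1) + (b2 - b1)) ^+ 2.
  apply/eqP; rewrite -subr_eq0 -/(bdry G a1 a2 b1 b2) -normr_eq0 eq_le normr_ge0 andbT.
  set D := ((a2 - a1) + (b2 - b1)) ^+ 2 in small.
  have D0 : 0 <= D by exact: sqr_ge0.
  apply/ler_addgt0Pl => e e0; rewrite addr0.
  have D1 : 0 < D + 1 by rewrite ltr_wpDl.
  apply: le_trans (small (e / (D + 1)) _) _; first by rewrite divr_gt0.
  by rewrite mulrAC ler_pdivrMr // ler_wpM2l ?ltW // ltrDl.
move=> e0; pose P a a' b b' := `|bdry G a a' b b'| <= e * ((a' - a) + (b' - b)) ^+ 2.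
apply: (@cousin R P) => //.
- move=> a a' b b' m n [h1 h2 h3] [k1 k2 k3] P1 P2 P3 P4.
  have am : a <= m by rewrite /m; lra.
  have ma : m <= a' by rewrite /m; lra.
  have bn : b <= n by rewrite /n; lra.
  have nb : n <= b' by rewrite /n; lra.
  have ch y : b <= y <= b' -> itv_cont (fun s => Re (G (s +i* y))) a a'.
    move=> /andP[y1 y2]; apply: cont_hor => x /andP[x1 x2]; apply: cG.
      by rewrite (le_trans h1) ?(le_trans x2).
    by rewrite (le_trans k1) ?(le_trans y2).
  have cv x : a <= x <= a' -> itv_cont (fun t => Im (G (x +i* t))) b b'.
    move=> /andP[x1 x2]; apply: cont_ver => y /andP[y1 y2]; apply: cG.
      by rewrite (le_trans h1) ?(le_trans x2).
    by rewrite (le_trans k1) ?(le_trans y2).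
  have chb := ch b; have chn := ch n; have chb' := ch b'.
  have cva := cv a; have cvm := cv m; have cva' := cv a'.
  have add : bdry G a a' b b' = bdry G a m b n + bdry G m a' b n +
      bdry G a m n b' + bdry G m a' n b'.
    have {}chb : itv_cont (fun s => Re (G (s +i* b))) a a' by apply: ch; rewrite lexx.
    have {}chn : itv_cont (fun s => Re (G (s +i* n))) a a' by apply: ch; rewrite bn.
    have {}chb' : itv_cont (fun s => Re (G (s +i* b'))) a a' by apply: ch; rewrite lexx andbT.
    have {}cva : itv_cont (fun s => Im (G (a +i* s))) b b' by apply: cv; rewrite lexx.
    have {}cvm : itv_cont (fun s => Im (G (m +i* s))) b b' by apply: cv; rewrite am.
    have {}cva' : itv_cont (fun s => Im (G (a' +i* s))) b b' by apply: cv; rewrite lexx andbT.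
    have sl F : itv_cont F a a' -> itv_cont F a m.
      by apply: itv_cont_sub.
    have sr F : itv_cont F a a' -> itv_cont F m a'.
      by apply: itv_cont_sub.
    have tl F : itv_cont F b b' -> itv_cont F b n.
      by apply: itv_cont_sub.
    have tr F : itv_cont F b b' -> itv_cont F n b'.
      by apply: itv_cont_sub.
    have E x1 x2 y1 y2 : itv_cont (fun s => Re (G (s +i* y1))) x1 x2 ->
        itv_cont (fun s => Re (G (s +i* y2))) x1 x2 ->
        itv_cont (fun t => Im (G (x2 +i* t))) y1 y2 ->
        itv_cont (fun t => Im (G (x1 +i* t))) y1 y2 ->
        bdry G x1 x2 y1 y2 =
          itv_int (fun s => Re (G (s +i* y1))) x1 x2 - itv_int (fun s => Re (G (s +i* y2))) x1 x2 -
          (itv_int (fun t => Im (G (x2 +i* t))) y1 y2 - itv_int (fun t => Im (G (x1 +i* t))) y1 y2).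
      by move=> c1 c2 c3 c4; rewrite /bdry (itv_intB c1 c2) (itv_intB c3 c4).
    rewrite (E a a' b b' chb chb' cva' cva).
    rewrite (E a m b n (sl _ chb) (sl _ chn) (tl _ cvm) (tl _ cva)).
    rewrite (E m a' b n (sr _ chb) (sr _ chn) (tl _ cva') (tl _ cvm)).
    rewrite (E a m n b' (sl _ chn) (sl _ chb') (tr _ cvm) (tr _ cva)).
    rewrite (E m a' n b' (sr _ chn) (sr _ chb') (tr _ cva') (tr _ cvm)).
    rewrite (itv_int_split am ma chb) (itv_int_split am ma chb').
    by rewrite (itv_int_split bn nb cva) (itv_int_split bn nb cva'); ring.
  rewrite /P add; apply: le_trans (ler_normD _ _) _.
  apply: le_trans (lerD (ler_normD _ _) (lexx _)) _.
  apply: le_trans (lerD (lerD (ler_normD _ _) (lexx _)) (lexx _)) _.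
  move: P1 P2 P3 P4; rewrite /P /m /n.
  have -> : (a + a') / 2 - a = (a' - a) / 2 by field.
  have -> : a' - (a + a') / 2 = (a' - a) / 2 by field.
  have -> : (b + b') / 2 - b = (b' - b) / 2 by field.
  have -> : b' - (b + b') / 2 = (b' - b) / 2 by field.
  have -> : ((a' - a) / 2 + (b' - b) / 2) ^+ 2 = (a' - a + (b' - b)) ^+ 2 / 4 by field.
  by rewrite mulrA; move: (e * _) => E; lra.
- move=> x y hx hy; have /cdiff_eps[l hl] := dG _ _ hx hy.
  have e2 : 0 < e / 2 by rewrite divr_gt0.
  have [d d0 hd] := hl _ e2; exists (d / 2); first by rewrite divr_gt0.
  move=> a a' b b' [h1 ax xa h2] [h3 by_ yb h4] da db.
  pose D := (a' - a) + (b' - b); have D0 : 0 <= D by rewrite /D; lra.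
  have app s t : a <= s <= a' -> b <= t <= b' ->
      nc (G (s +i* t) - G (x +i* y) - l * ((s +i* t) - (x +i* y))) <= e / 2 * D.
    move=> /andP[s1 s2] /andP[t1 t2].
    have near : nc ((s +i* t : C) - (x +i* y)) <= D.
      apply: le_trans (nc_le_ReIm _) _; rewrite /= /D lerD // ler_norml; lra.
    apply: le_trans (hd _ _) _; first by apply: le_lt_trans near _; rewrite /D; lra.
    by rewrite ler_wpM2l // ltW.
  have appR s t : a <= s <= a' -> b <= t <= b' ->
    `|Re (G (s +i* t)) - Re (G (x +i* y)) - (Re l * (s - x) - Im l * (t - y))| <= e / 2 * D.
    move=> hs ht; apply: le_trans (app _ _ hs ht).
    by apply: le_trans (nc_Re_le _); rewrite !ReD !ReN ReM.
  have appI s t : a <= s <= a' -> b <= t <= b' ->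
    `|Im (G (s +i* t)) - Im (G (x +i* y)) - (Re l * (t - y) + Im l * (s - x))| <= e / 2 * D.
    move=> hs ht; apply: le_trans (app _ _ hs ht).
    by apply: le_trans (nc_Im_le _); rewrite !ImD !ImN ImM.
  have aa : a <= a' by lra.
  have bb : b <= b' by lra.
  have ch t : b <= t <= b' -> itv_cont (fun s => Re (G (s +i* t))) a a'.
    move=> /andP[y1 y2]; apply: cont_hor => s /andP[x1 x2]; apply: cG.
      by rewrite (le_trans h1) ?(le_trans x2).
    by rewrite (le_trans h3) ?(le_trans y2).
  have cv s : a <= s <= a' -> itv_cont (fun t => Im (G (s +i* t))) b b'.
    move=> /andP[x1 x2]; apply: cont_ver => t /andP[y1 y2]; apply: cG.
      by rewrite (le_trans h1) ?(le_trans x2).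
    by rewrite (le_trans h3) ?(le_trans y2).
  have bl : b <= b <= b' by rewrite lexx.
  have br : b <= b' <= b' by rewrite lexx andbT.
  have al : a <= a <= a' by rewrite lexx.
  have ar : a <= a' <= a' by rewrite lexx andbT.
  have cH := itv_contB (ch _ bl) (ch _ br).
  have cV := itv_contB (cv _ ar) (cv _ al).
  (* The differences of the linear part [l * (w - w0)] across the two pairs of opposite sides. Their
     integrals [c * (a' - a)] and [c' * (b' - b)] coincide, so the linear part cancels. *)
  pose c := Im l * (b' - b); pose c' := Im l * (a' - a).
  have H : `|itv_int (fun s => Re (G (s +i* b)) - Re (G (s +i* b'))) a a' - c * (a' - a)|
      <= e * D * (a' - a).
    rewrite -itv_int_cst // -itv_intB //; last exact: itv_cont_cst.
    apply: itv_int_norm_le => //; first by apply: itv_contB => //; exact: itv_cont_cst.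
    move=> s hs; have := appR _ _ hs bl; have := appR _ _ hs br.
    by apply: half_diff; rewrite /c; ring.
  have V : `|itv_int (fun t => Im (G (a' +i* t)) - Im (G (a +i* t))) b b' - c' * (b' - b)|
      <= e * D * (b' - b).
    rewrite -itv_int_cst // -itv_intB //; last exact: itv_cont_cst.
    apply: itv_int_norm_le => //; first by apply: itv_contB => //; exact: itv_cont_cst.
    move=> t ht; have := appI _ _ ar ht; have := appI _ _ al ht.
    by apply: half_diff; rewrite /c'; ring.
  rewrite /P /bdry -/D; move: H V.
  have -> : c * (a' - a) = c' * (b' - b) by rewrite /c /c'; ring.
  have -> : e * D ^+ 2 = e * D * (a' - a) + e * D * (b' - b) by rewrite /D; ring.
  set I := itv_int _ _ _; set I' := itv_int _ _ _; set x0 := c' * _ => hI hI'.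
  have -> : I - I' = (I - x0) - (I' - x0) by ring.
  exact: le_trans (ler_normB _ _) (lerD hI hI').
Qed.

(* Goursat's theorem for [w |-> i g (exp w)] on a rectangle of height [2 pi]: by
   periodicity the horizontal sides cancel. *)
Lemma cmean_annulus g (r1 r2 : R) : 0 < r1 -> r1 <= r2 ->
  (forall z, r1 <= nc z <= r2 -> cdiff g z) ->
  cmean (fun z => Re (g z)) r1 = cmean (fun z => Re (g z)) r2.
Proof.
move=> r10 r12 dg; have r20 := lt_le_trans r10 r12.
pose G (w : C) : C := (0 +i* 1 : C) * g (cexp w).
have lnr : ln r1 <= ln r2 by rewrite ler_ln.
have E1 : expR (ln r1) = r1 by rewrite lnK // posrE.
have E2 : expR (ln r2) = r2 by rewrite lnK // posrE.
have dG x y : ln r1 <= x <= ln r2 -> 0 <= y <= 2 * pi -> cdiff G (x +i* y).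
  move=> /andP[x1 x2] _; apply: cdiffM; first exact: cdiff_cst.
  apply: (@cdiff_comp _ cexp g); first exact: cdiff_cexp.
  apply: dg; rewrite nc_cexp /=.
  by rewrite -E1 -E2 !ler_expR x1.
have ImG x y : Im (G (x +i* y)) = Re (g (circle_pt (expR x) y)).
  by rewrite /G ImM /= mul0r mul1r add0r.
have pp : 0 <= 2 * pi :> R by rewrite mulr_ge0 // pi_ge0.
have := goursat lnr pp dG.
have -> : itv_int (fun s => Re (G (s +i* 0)) - Re (G (s +i* (2 * pi)))) (ln r1) (ln r2) = 0.
  rewrite -[RHS](mul0r (ln r2 - ln r1)) -itv_int_cst //; apply: eq_itv_int => s _.
  rewrite /G /cexp /circle_pt /=.
  have -> : cos (2 * pi) = cos 0 :> R by rewrite mulr_natl cos2pi cos0.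
  have -> : sin (2 * pi) = sin 0 :> R by rewrite mulr_natl sin2pi sin0.
  by rewrite subrr.
under eq_itv_int do rewrite !ImG E1 E2.
have cc r : r1 <= r <= r2 -> circ_cont (fun z => Re (g z)) r.
  by move=> hr; apply: circ_cont_Re => z hz; apply: cdiff_cont; apply: dg; rewrite hz.
have c1 : circ_cont (fun z => Re (g z)) r1 by apply: cc; rewrite lexx.
have c2 : circ_cont (fun z => Re (g z)) r2 by apply: cc; rewrite r12 lexx.
have := itv_intB (circ_cont_itv (a := 0) (b := 2 * pi) (ltW r20) c2) (circ_cont_itv (ltW r10) c1).
move=> -> /eqP; rewrite eq_sym subr_eq0 => /eqP h.
by rewrite /cmean h.
Qed.

End Goursat.

(** * Mean value, Schwarz and Cauchy formulas *)

Section MeanValue.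
Context {R : realType}.
Local Notation C := (R[i]^o).
Local Notation nc := (@Normc.normc R).
Implicit Types (u : C -> R) (g k : C -> C) (r rho : R) (w z : C).

Lemma eq_from_eps (a b : R) : (forall e, 0 < e -> `|a - b| <= e) -> a = b.
Proof.
move=> h; apply/eqP; rewrite -subr_eq0 -normr_eq0 eq_le normr_ge0 andbT.
by apply/ler_addgt0Pl => e e0; rewrite addr0; exact: h.
Qed.

Lemma cmean_continuous u r0 r1 e : (forall r, 0 <= r < r1 -> circ_cont u r) ->
  0 <= r0 < r1 -> 0 < e ->
  exists2 d, 0 < d & forall r, 0 <= r < r1 -> `|r - r0| < d ->
    `|cmean u r - cmean u r0| <= e.
Proof.
move=> hu hr0 e0; have /andP[r00 r01] := hr0.
have [d d0 hd] := circ_unif_cont r00 (hu _ hr0) e0; exists d => // r hr rd.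
have /andP[h1 h2] := hr.
have c1 := circ_cont_itv (a := 0) (b := 2 * pi) h1 (hu _ hr).
have c2 := circ_cont_itv (a := 0) (b := 2 * pi) r00 (hu _ hr0).
have P0 : 0 < 2 * pi :> R by rewrite mulr_gt0 // pi_gt0.
rewrite /cmean -mulrBr -itv_intB // normrM.
have : `|itv_int (fun t => u (circle_pt r t) - u (circle_pt r0 t)) 0 (2 * pi)|
   <= e * (2 * pi - 0).
  apply: itv_int_norm_le; first exact: ltW.
    by move=> t ht; apply: rcontB; [exact: c1|exact: c2].
  by move=> t ht; exact: hd.
move: (itv_int _ _ _) => I; move: (2 * pi) P0 => P P0; rewrite subr0 => hI.
by rewrite gtr0_norm ?invr_gt0 // mulrC ler_pdivrMr.
Qed.

(** Differentiability may fail at the origin and on the circle of radius [rho]: off them the mean is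
    locally constant in the radius, and continuity of the mean bridges the gaps. The exceptional
    circle is meant for difference quotients based at [w], only known to be continuous at [w]
    itself. *)
Lemma mean_value_Re g r R' rho : 0 <= r < R' ->
  (forall z, nc z < R' -> cont_at g z) ->
  (forall z, nc z < R' -> z != 0 -> nc z != rho -> cdiff g z) ->
  cmean (fun z => Re (g z)) r = Re (g 0).
Proof.
move=> hr cg dg; rewrite -[RHS](cmean0 (fun z => Re (g z))).
pose phi s := cmean (fun z => Re (g z)) s; rewrite -!/(phi _).
have cc s : 0 <= s < R' -> circ_cont (fun z => Re (g z)) s.
  by move=> /andP[_ sR]; apply: circ_cont_Re => z hz; apply: cg; rewrite hz.
have cst s1 s2 : 0 < s1 -> s1 <= s2 -> s2 < R' -> (rho < s1) || (s2 < rho) -> phi s1 = phi s2.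
  move=> s10 s12 sR h; apply: cmean_annulus => // z /andP[z1 z2].
  apply: dg; first exact: le_lt_trans sR.
    by rewrite -nc_gt0 (lt_le_trans s10).
  by apply/eqP => zr; move: h; rewrite -zr ltNge z1 /= ltNge z2.
have right s0 s : 0 <= s0 -> s0 < s -> s < R' -> (rho <= s0) || (s < rho) -> phi s = phi s0.
  move=> s00 s0s sR h; apply: eq_from_eps => e e0.
  have hs0 : 0 <= s0 < R' by rewrite s00 (lt_trans s0s).
  have [d d0 hd] := cmean_continuous cc hs0 e0.
  pose s' := Num.min (s0 + d / 2) s.
  have d2 : 0 < d / 2 by rewrite divr_gt0.
  have s'1 : s0 < s' by rewrite lt_min s0s andbT ltrDl.
  have s'2 : s' <= s by rewrite ge_min lexx orbT.
  have s'3 : s' <= s0 + d / 2 by rewrite ge_min lexx.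
  rewrite -(cst s' s) //; first last.
  - by case/orP: h => [h|->]; rewrite ?orbT // (le_lt_trans h).
  - exact: le_lt_trans s'1.
  apply: hd; first by rewrite (le_trans s00 (ltW s'1)) (le_lt_trans s'2).
  by rewrite gtr0_norm ?subr_gt0 //; lra.
have left s s0 : 0 < s -> s < s0 -> s0 < R' -> (rho < s) || (s0 <= rho) -> phi s = phi s0.
  move=> s00 ss0 sR h; apply: eq_from_eps => e e0.
  have hs0 : 0 <= s0 < R' by rewrite sR andbT ltW // (lt_trans s00).
  have [d d0 hd] := cmean_continuous cc hs0 e0.
  pose s' := Num.max (s0 - d / 2) s.
  have d2 : 0 < d / 2 by rewrite divr_gt0.
  have s'1 : s' < s0 by rewrite gt_max ss0 andbT ltrBlDr ltrDl.
  have s'2 : s <= s' by rewrite le_max lexx orbT.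
  have s'3 : s0 - d / 2 <= s' by rewrite le_max lexx.
  rewrite (cst s s') //; first last.
  - by case/orP: h => [->//|h]; rewrite (lt_le_trans s'1) ?orbT.
  - exact: lt_trans sR.
  apply: hd; first by rewrite (le_trans (ltW s00) s'2) (lt_trans s'1).
  by rewrite ltr0_norm ?subr_lt0 //; lra.
have /andP[r0 rR] := hr.
have [->//|rn0] := eqVneq r 0.
have rp : 0 < r by rewrite lt_neqAle eq_sym rn0.
have [h|h] := boolP ((rho <= 0) || (r < rho)); first exact: right.
move: h; rewrite negb_or -ltNge -leNgt => /andP[h1 h2].
have e1 : phi rho = phi 0.
  have hR : rho < R' by exact: le_lt_trans rR.
  have r2 : 0 < rho / 2 by rewrite divr_gt0.
  have r3 : rho / 2 < rho by rewrite ltr_pdivrMr // mulr_natr mulr2n ltrDl.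
  rewrite -(left (rho / 2) rho) ?lexx ?orbT //.
  by apply: right => //; [exact: lt_trans hR|rewrite r3 orbT].
rewrite -e1; have [<-//|rr] := eqVneq rho r.
by apply: right; rewrite ?lexx ?(ltW h1) // lt_neqAle rr.
Qed.

(** Compactness of the closed disc as an induction principle. Cousin's lemma is run on the
    circumscribed square with rectangles cut down to the disc; small ones around a point outside the
    disc leave the empty set. *)
Lemma disc_ind (P : set C -> Prop) r : 0 <= r ->
  (forall A B, A `<=` B -> P B -> P A) ->
  (forall A B, P A -> P B -> P (A `|` B)) ->
  (forall z, nc z <= r -> exists2 d, 0 < d & P [set w | nc (w - z) < d /\ nc w <= r]) ->
  P [set w | nc w <= r].
Proof.
move=> r0 mono union loc.
have P0 : P set0.
  have [|d d0 hd] := loc 0; first by rewrite nc0.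
  by apply: mono hd => x [].
pose Q (a a' b b' : R) := P [set w | [/\ a <= Re w <= a', b <= Im w <= b' & nc w <= r]].
have : Q (- r) r (- r) r.
  apply: (@cousin R Q) => //; try by rewrite ge0_cp.
  - move=> a a' b b' m n _ _ h1 h2 h3 h4.
    apply: mono (union _ _ (union _ _ h1 h2) (union _ _ h3 h4)).
    move=> w [/andP[x1 x2] /andP[y1 y2] wr].
    have [x3|/ltW x3] := lerP (Re w) m; have [y3|/ltW y3] := lerP (Im w) n.
    + by left; left; split => //; apply/andP.
    + by right; left; split => //; apply/andP.
    + by left; right; split => //; apply/andP.
    + by right; right; split => //; apply/andP.
  - move=> x y _ _.
    have near (d : R) w a a' b b' : a <= x <= a' -> b <= y <= b' ->
        a <= Re w <= a' -> b <= Im w <= b' -> a' - a < d / 2 -> b' - b < d / 2 ->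
        nc (w - (x +i* y)) < d.
      move=> /andP[? ?] /andP[? ?] /andP[? ?] /andP[? ?] ? ?.
      apply: le_lt_trans (nc_le_ReIm _) _.
      have h1 : `|Re w - x| < d / 2 by rewrite ltr_norml; lra.
      have h2 : `|Im w - y| < d / 2 by rewrite ltr_norml; lra.
      by rewrite ReD ImD ReN ImN /= [ltRHS]Num.Theory.splitr ltrD.
    have [xr|xr] := lerP (nc (x +i* y)) r.
      have [d d0 hd] := loc _ xr; exists (d / 2); first by rewrite divr_gt0.
      move=> a a' b b' [_ a1 a2 _] [_ b1 b2 _] da db.
      apply: mono hd => w [w1 w2 w3]; split => //.
      by apply: (near d w a a' b b') => //; apply/andP.
    have d0 : 0 < nc (x +i* y) - r by rewrite subr_gt0.
    exists ((nc (x +i* y) - r) / 2); first by rewrite divr_gt0.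
    move=> a a' b b' [_ a1 a2 _] [_ b1 b2 _] da db.
    apply: mono P0 => w [w1 w2 w3].
    have := nc_sub_ge (x +i* y) w; rewrite ncB.
    have : nc (w - (x +i* y)) < nc (x +i* y) - r.
      by apply: (near _ w a a' b b') => //; apply/andP.
    by lra.
apply: mono => w wr; have h : - r <= Re w <= r /\ - r <= Im w <= r.
  by rewrite -!ler_norml !(le_trans _ wr) ?nc_Re_le ?nc_Im_le.
by case: h.
Qed.

Lemma circ_bounded u r : circ_cont u r -> exists M, forall z, nc z = r -> u z <= M.
Proof.
move=> cu; have [r0|r0] := ltrP r 0.
  by exists 0 => z zr; have := nc_ge0 z; rewrite zr leNgt r0.
have [M hM] : exists M, forall z, [set z | nc z <= r] z -> nc z = r -> u z <= M; last first.
  by exists M => z zr; apply: hM => //=; rewrite zr.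
apply: (@disc_ind (fun A => exists M, forall z, A z -> nc z = r -> u z <= M)) => //.
- by move=> A B AB [M hM]; exists M => z /AB; exact: hM.
- move=> A B [M hM] [N hN]; exists (Num.max M N) => z [Az|Bz] zr.
    by rewrite le_max hM.
  by rewrite le_max hN ?orbT.
move=> z zr; have [e|ne] := eqVneq (nc z) r.
  have /rcontP/(_ 1 ltr01)/nbhsCP[d d0 hd] := cu _ e.
  exists d => //; exists (u z + 1) => w [/hd h _] _.
  by move: h; rewrite ltr_norml => /andP[_]; rewrite ltrBlDl => /ltW; rewrite addrC.
exists (r - nc z); first by rewrite subr_gt0 lt_neqAle ne.
exists 0 => w [h _] wr; exfalso.
by have := nc_sub_ge w z; rewrite wr leNgt h.
Qed.

Definition cmeanC g r : C := cmean (fun z => Re (g z)) r +i* cmean (fun z => Im (g z)) r.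

Definition ccirc g r := forall z, nc z = r -> cont_at g z.

Lemma mean_value g r R' rho : 0 <= r < R' ->
  (forall z, nc z < R' -> cont_at g z) ->
  (forall z, nc z < R' -> z != 0 -> nc z != rho -> cdiff g z) ->
  cmeanC g r = g 0.
Proof.
move=> hr cg dg; have ReI (x : C) : Im x = Re ((0 -i* 1 : C) * x).
  by rewrite ReM /= mul0r mulN1r sub0r opprK.
rewrite /cmeanC (mean_value_Re hr cg dg) [RHS]complexE.
have -> : cmean (fun z => Im (g z)) r = Im (g 0).
  rewrite ReI -(@mean_value_Re (fun z => (0 -i* 1 : C) * g z) r R' rho) //.
  - by congr cmean; apply/funext => z; rewrite ReI.
  - by move=> z hz; apply: ccontM; [exact: ccont_cst|exact: cg].
  - by move=> z h1 h2 h3; apply: cdiffM; [exact: cdiff_cst|exact: dg].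
by case: (g 0) => a b /=; congr (_ +i* _); ring.
Qed.

Lemma eq_cmeanC g k r : 0 <= r -> (forall z, nc z = r -> g z = k z) ->
  cmeanC g r = cmeanC k r.
Proof. by move=> r0 h; congr (_ +i* _); apply: eq_cmean => // z /h ->. Qed.

Lemma cmeanCD g k r : 0 <= r -> ccirc g r -> ccirc k r ->
  cmeanC (fun z => g z + k z) r = cmeanC g r + cmeanC k r.
Proof.
move=> r0 hg hk; rewrite /cmeanC -[RHS]/(_ +i* _); congr (_ +i* _).
  rewrite -cmeanD //; try exact: circ_cont_Re.
  by congr cmean; apply/funext => z; rewrite ReD.
rewrite -cmeanD //; try exact: circ_cont_Im.
by congr cmean; apply/funext => z; rewrite ImD.
Qed.

Lemma cmeanCZ c g r : 0 <= r -> ccirc g r ->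
  cmeanC (fun z => c * g z) r = c * cmeanC g r.
Proof.
move=> r0 hg; have hR := circ_cont_Re hg; have hI := circ_cont_Im hg.
have cs a u : circ_cont u r -> circ_cont (fun z => a * u z) r.
  by move=> hu; apply: circ_contM => //; exact: circ_cont_cst.
have -> : c * cmeanC g r = (Re c * Re (cmeanC g r) - Im c * Im (cmeanC g r))
    +i* (Re c * Im (cmeanC g r) + Im c * Re (cmeanC g r)).
  by rewrite -ReM -ImM; case: (c * _).
congr (_ +i* _); rewrite /= -!cmeanZ //.
  rewrite -cmeanB //; try exact: cs.
  by congr cmean; apply/funext => z; rewrite ReM.
rewrite -cmeanD //; try exact: cs.
by congr cmean; apply/funext => z; rewrite ImM.
Qed.

(** The factor [2] comes from bounding real and imaginary parts separately. *)
Lemma nc_cmeanC_le g r c : 0 <= r -> ccirc g r -> (forall z, nc z = r -> nc (g z) <= c) ->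
  nc (cmeanC g r) <= 2 * c.
Proof.
move=> r0 hg h; apply: le_trans (nc_le_ReIm _) _ => /=.
rewrite mulr_natl mulr2n lerD //; apply: cmean_norm_le => //.
- exact: circ_cont_Re.
- by move=> z /h; apply: le_trans; exact: nc_Re_le.
- exact: circ_cont_Im.
- by move=> z /h; apply: le_trans; exact: nc_Im_le.
Qed.

(* On the circle [nc z = r] the conjugate of [w / (z - w)] is a holomorphic
   function of [z] vanishing at [0]; its mean therefore vanishes, also against
   a holomorphic factor. *)
Definition cauchyJ r w z : C := w^* * z / ((r ^+ 2)%:C - w^* * z).

(** On the circle [z * z^* = r ^+ 2], which eliminates the conjugate of [z]. *)
Lemma cauchyJE r w z : nc w < r -> nc z = r -> (w / (z - w))^* = cauchyJ r w z.
Proof.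
move=> wr zr.
have z0 : z != 0 by rewrite -nc_gt0 zr (le_lt_trans (nc_ge0 w)).
have zw : z^* - w^* != 0.
  rewrite -rmorphB conjc_eq0 subr_eq0; apply/eqP => e.
  by move: wr; rewrite -e zr ltxx.
rewrite /cauchyJ -zr -mulJc rmorphM fmorphV rmorphB.
have -> : z * z^* - w^* * z = z * (z^* - w^*) by ring.
by field; apply/andP; split.
Qed.

(** The pole of [cauchyJ r w] has modulus [r ^+ 2 / nc w]. The radius [2 * r ^+ 2 / (r + nc w)] lies
    between [r] and that modulus, and also makes sense for [w = 0]. *)
Lemma cauchyJ_den_neq0 r w z : 0 < r -> nc w < r -> nc z < 2 * r ^+ 2 / (r + nc w) ->
  (r ^+ 2)%:C - w^* * z != 0.
Proof.
move=> r0 wr; rewrite ltr_pdivlMr ?ltr_pwDl ?nc_ge0 // => h.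
rewrite subr_eq0; apply/eqP => e.
have : nc (r ^+ 2)%:C = nc (w^* * z) by rewrite e.
rewrite nc_real ncM ncJ ger0_norm ?sqr_ge0 // => e2.
have := nc_ge0 w; have := nc_ge0 z; move: e2 h wr; move: (nc w) (nc z) => a b; nra.
Qed.

Lemma cauchyJ_cdiff r w z : 0 < r -> nc w < r -> nc z < 2 * r ^+ 2 / (r + nc w) ->
  cdiff (cauchyJ r w) z.
Proof.
move=> r0 wr hz; have d1 : cdiff (fun z => w^* * z) z.
  by apply: cdiffM; [exact: cdiff_cst|exact: cdiff_id].
apply: cdiff_div => //; first exact: cauchyJ_den_neq0.
by apply: cdiffB => //; exact: cdiff_cst.
Qed.

Lemma cauchyJ_radius r w : 0 < r -> nc w < r -> r < 2 * r ^+ 2 / (r + nc w).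
Proof.
move=> r0 wr; rewrite ltr_pdivlMr ?ltr_pwDl ?nc_ge0 //.
by have := nc_ge0 w; move: wr; move: (nc w) => a; nra.
Qed.

Lemma mean_mul_cauchyJ g r R' w : 0 < r < R' -> (forall z, nc z < R' -> cdiff g z) ->
  nc w < r -> cmean (fun z => Re (g z * cauchyJ r w z)) r = 0.
Proof.
move=> /andP[r0 rR] dg wr; set R2 := 2 * r ^+ 2 / (r + nc w).
have d z : nc z < Num.min R' R2 -> cdiff (fun z => g z * cauchyJ r w z) z.
  rewrite lt_min => /andP[h1 h2]; apply: cdiffM; first exact: dg.
  exact: cauchyJ_cdiff.
rewrite (@mean_value_Re _ _ (Num.min R' R2) 0).
- by rewrite /cauchyJ !(mulr0, mul0r) /=.
- by rewrite (ltW r0) lt_min rR cauchyJ_radius.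
- by move=> z /d; exact: cdiff_cont.
- by move=> z /d.
Qed.

Lemma cauchy_kernel_cont r w : nc w < r -> ccirc (fun z => w / (z - w)) r.
Proof.
move=> wr z zr; apply: ccontM; first exact: ccont_cst.
apply: ccontV; last by apply: ccontB; [exact: ccont_id|exact: ccont_cst].
by rewrite subr_eq0; apply/eqP => e; move: wr; rewrite -e zr ltxx.
Qed.

Lemma mean_cauchy_kernel r w c : 0 < r -> nc w < r ->
  cmean (fun z => Re (c * (w / (z - w)))) r = 0.
Proof.
move=> r0 wr; have rR : 0 < r < r + 1 by rewrite r0 ltrDl ltr01.
have := @mean_mul_cauchyJ (fun=> c^*) r (r + 1) w rR (fun z _ => cdiff_cst c^* z) wr.
move=> <-; apply: (eq_cmean (ltW r0)) => z zr.
have -> : c^* * cauchyJ r w z = (c * (w / (z - w)))^* by rewrite -cauchyJE //; exact/esym/(rmorphM (@conjc R)).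
by case: (c * (w / (z - w))).
Qed.

Lemma meanC_cauchy_kernel r w c : 0 < r -> nc w < r ->
  cmeanC (fun z => c * (w / (z - w))) r = 0.
Proof.
move=> r0 wr; rewrite /cmeanC mean_cauchy_kernel //.
suff -> : cmean (fun z => Im (c * (w / (z - w)))) r = 0 by [].
rewrite -(mean_cauchy_kernel ((0 -i* 1 : C) * c) r0 wr); apply: (eq_cmean (ltW r0)) => z _.
by rewrite -mulrA [in RHS]ReM /= mul0r mulN1r sub0r opprK.
Qed.

Lemma diff_quot_cont g p w z : (forall x, g x - g w = p x * (x - w)) -> z != w ->
  cont_at g z -> cont_at p z.
Proof.
move=> h zw cg; apply: (@ccont_near _ _ (fun x => (g x - g w) / (x - w))).
  apply/nbhsCP; exists (nc (z - w)); first by rewrite nc_gt0 subr_eq0.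
  move=> x hx; rewrite h mulfK // subr_eq0; apply/eqP => e.
  by move: hx; rewrite e ncB ltxx.
apply: ccontM; first by apply: ccontB => //; exact: ccont_cst.
apply: ccontV; first by rewrite subr_eq0.
by apply: ccontB; [exact: ccont_id|exact: ccont_cst].
Qed.

Lemma diff_quot_cdiff g p w z : (forall x, g x - g w = p x * (x - w)) -> z != w ->
  cdiff g z -> cdiff p z.
Proof.
move=> h zw cg; apply: (@cdiff_near _ _ (fun x => (g x - g w) / (x - w))).
  apply/nbhsCP; exists (nc (z - w)); first by rewrite nc_gt0 subr_eq0.
  move=> x hx; rewrite h mulfK // subr_eq0; apply/eqP => e.
  by move: hx; rewrite e ncB ltxx.
apply: cdiff_div; first by rewrite subr_eq0.
  by apply: cdiffB => //; exact: cdiff_cst.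
by apply: cdiffB; [exact: cdiff_id|exact: cdiff_cst].
Qed.

(* The Schwarz integral formula: [g w - g 0] is the mean of [g z * (w / (z - w))],
   to which the vanishing mean of [g z * (w / (z - w))^*] is added. *)
Lemma schwarz_formula g r R' w : 0 < r < R' -> (forall z, nc z < R' -> cdiff g z) ->
  nc w < r ->
  Re (g w) - Re (g 0) = cmean (fun z => 2 * Re (g z) * Re (w / (z - w))) r.
Proof.
move=> hr dg wr; have /andP[r0 rR] := hr; have r00 := ltW r0.
have cg z : nc z = r -> cont_at g z by move=> zr; apply: cdiff_cont; apply: dg; rewrite zr.
have [->|w0] := eqVneq w 0.
  rewrite subrr -[LHS](cmean_cst r); apply: eq_cmean => // z _.
  by rewrite mul0r mulr0.
have wR : nc w < R' by exact: lt_trans rR.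
have [p cp hp] := dg _ wR.
have cJ : circ_cont (fun z => Re (g z * cauchyJ r w z)) r.
  apply: circ_cont_Re => z zr; apply: ccontM; first exact: cg.
  by apply: cdiff_cont; apply: cauchyJ_cdiff => //; rewrite zr cauchyJ_radius.
have cK : circ_cont (fun z => Re (g w * (w / (z - w)))) r.
  apply: circ_cont_Re => z zr; apply: ccontM; first exact: ccont_cst.
  exact: cauchy_kernel_cont wr _ zr.
have zw z : nc z = r -> z != w by move=> zr; apply/eqP => e; move: wr; rewrite -e zr ltxx.
have cP : circ_cont (fun z => Re (w * p z)) r.
  apply: circ_cont_Re => z zr; apply: ccontM; first exact: ccont_cst.
  by apply: diff_quot_cont hp (zw _ zr) _; exact: cg.
have mP : cmean (fun z => Re (w * p z)) r = Re (g w) - Re (g 0).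
  (* The circle through [w] is the exceptional one, since at [w] the quotient [p] is only known to
     be continuous. *)
  rewrite (@mean_value_Re (fun z => w * p z) r R' (nc w)).
  - rewrite -ReN -ReD; congr Re; have := hp 0; rewrite sub0r => e.
    by rewrite -opprB e; ring.
  - by rewrite r00.
  - move=> z zR; apply: ccontM; first exact: ccont_cst.
    have [->//|zw'] := eqVneq z w.
    by apply: diff_quot_cont hp zw' _; apply: cdiff_cont; exact: dg.
  - move=> z zR _ zw'; apply: cdiffM; first exact: cdiff_cst.
    apply: diff_quot_cdiff hp _ _; last exact: dg.
    by apply/eqP => e; move: zw'; rewrite e eqxx.
have mK := mean_cauchy_kernel (g w) r0 wr; have mJ := mean_mul_cauchyJ hr dg wr.
(* Let [K = w / (z - w)]. Adding [mK] turns [w * p z] into [g z * K]; adding [mJ], the mean of [g z]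
   times the conjugate of [K], leaves [2 Re (g z) Re K]. *)
rewrite -mP -[LHS]addr0 -mK -cmeanD // -[LHS]addr0 -mJ -cmeanD //; last exact: circ_contD.
apply: eq_cmean => // z zr; rewrite -cauchyJE // -!ReD.
have -> : w * p z + g w * (w / (z - w)) = g z * (w / (z - w)).
  have e : p z = (g z - g w) / (z - w) by rewrite hp mulfK // subr_eq0 zw.
  by rewrite e; field; rewrite subr_eq0 zw.
by rewrite ReD; move: (w / (z - w)) => K; rewrite !ReM; case: K => a b /=; ring.
Qed.

(** The kernel in [schwarz_formula] is at most [nc w / (r - nc w)]. Having a mean of [|Re g|] on the
    right matters: for a logarithm of [h] it is the mean of [|ln |h||], which the characteristic
    controls. *)
Lemma Re_diff_le g r R' w : 0 < r < R' -> (forall z, nc z < R' -> cdiff g z) ->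
  nc w < r ->
  `|Re (g w) - Re (g 0)| <= 2 * nc w / (r - nc w) * cmean (fun z => `|Re (g z)|) r.
Proof.
move=> hr dg wr; have /andP[r0 rR] := hr; have r00 := ltW r0.
have cR : circ_cont (fun z => Re (g z)) r.
  by apply: circ_cont_Re => z zr; apply: cdiff_cont; apply: dg; rewrite zr.
have cK := circ_cont_Re (cauchy_kernel_cont wr).
have cF : circ_cont (fun z => 2 * Re (g z) * Re (w / (z - w))) r.
  by apply: circ_contM => //; apply: circ_contM => //; exact: circ_cont_cst.
rewrite (schwarz_formula hr dg wr) -cmeanZ //; last exact: circ_cont_norm.
apply: le_trans (norm_cmean_le r00 cF) _; apply: le_cmean => //.
- exact: circ_cont_norm.
- by apply: circ_contM; [exact: circ_cont_cst|exact: circ_cont_norm].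
move=> z zr; rewrite !normrM [X in X * _ * _]ger0_norm // mulrAC ler_wpM2r //.
rewrite -mulrA ler_wpM2l //; apply: le_trans (nc_Re_le _) _.
rewrite ncM ncV ler_wpM2l ?nc_ge0 // lef_pV2 ?posrE ?subr_gt0 //.
  by rewrite -zr; exact: nc_sub_ge.
by apply: lt_le_trans (nc_sub_ge _ _); rewrite zr subr_gt0.
Qed.

Section Removable.
Variables (k : C -> C) (R' : R).
Hypothesis ck : forall z, nc z < R' -> cont_at k z.
Hypothesis dk : forall z, nc z < R' -> z != 0 -> cdiff k z.

(** The integrand is [k z * (z / (z - w))], the Cauchy kernel in the angular variable. For [w] other
    than [0] it is the mean value property of [z] times the difference quotient at [w]; at [w = 0],
    where [k] may fail to be differentiable, it is that of [k]. *)
Lemma cauchy_formula r w : 0 < r < R' -> nc w < r ->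
  cmeanC (fun z => k z + k z * (w / (z - w))) r = k w.
Proof.
move=> /andP[r0 rR] wr; have r00 := ltW r0.
have [->|w0] := eqVneq w 0.
  rewrite (@eq_cmeanC _ k) //; last by move=> z _; rewrite mul0r mulr0 addr0.
  apply: (@mean_value k r R' 0) => //; first by rewrite r00.
  by move=> z h1 h2 _; exact: dk.
have wR := lt_trans wr rR; have [p cp hp] := dk wR w0.
have zw z : nc z = r -> z != w by move=> zr; apply/eqP => e; move: wr; rewrite -e zr ltxx.
have cpz z : nc z < R' -> cont_at p z.
  move=> zR; have [->//|zw'] := eqVneq z w.
  by apply: diff_quot_cont hp zw' _; exact: ck.
have mp : cmeanC (fun z => z * p z) r = 0.
  rewrite (@mean_value _ r R' (nc w)) ?mul0r ?r00 //.
    by move=> z zR; apply: ccontM; [exact: ccont_id|exact: cpz].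
  move=> z zR z0 zw'; apply: cdiffM; first exact: cdiff_id.
  apply: diff_quot_cdiff hp _ _; last exact: dk.
  by apply/eqP => e; move: zw'; rewrite e eqxx.
have c1 : ccirc (fun z => z * p z) r.
  by move=> z zr; apply: ccontM; [exact: ccont_id|apply: cpz; rewrite zr].
have c2 : ccirc (fun z => k w * (w / (z - w))) r.
  by move=> z zr; apply: ccontM; [exact: ccont_cst|exact: cauchy_kernel_cont wr _ zr].
have c3 : ccirc (fun=> k w) r by move=> z _; exact: ccont_cst.
rewrite (@eq_cmeanC _ (fun z => (z * p z + k w * (w / (z - w))) + k w)) //; last first.
  move=> z zr; have e : p z = (k z - k w) / (z - w) by rewrite hp mulfK // subr_eq0 zw.
  by rewrite e; field; rewrite subr_eq0 zw.
rewrite cmeanCD //; last by move=> z zr; apply: ccontD; [exact: c1|exact: c2].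
rewrite cmeanCD // mp meanC_cauchy_kernel // !add0r /cmeanC !cmean_cst.
by case: (k w).
Qed.

(* Riemann: the Cauchy integral is differentiable at the centre. *)
Lemma cdiff_removable : 0 < R' -> cdiff k 0.
Proof.
move=> R0; pose r := R' / 2; have r0 : 0 < r by rewrite divr_gt0.
have rR : 0 < r < R' by rewrite r0 /r ltr_pdivrMr // mulr_natr mulr2n ltrDl.
have /andP[_ rR'] := rR; have r00 := ltW r0.
have kr : ccirc k r by move=> z zr; apply: ck; rewrite zr.
have [M hM] := circ_bounded (fun z zr => cont_nc (kr z zr)).
have M0 : 0 <= M.
  apply: le_trans (hM (r%:C) _); first exact: nc_ge0.
  by rewrite nc_real ger0_norm.
have cz : ccirc (fun z => k z * z^-1) r.
  move=> z zr; apply: ccontM; first exact: kr.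
  by apply: ccontV; [rewrite -nc_gt0 zr|exact: ccont_id].
apply/cdiff_eps; exists (cmeanC (fun z => k z * z^-1) r) => e e0.
(* For [nc w < r / 2] the remainder [E] below has mean at most [4 M nc w ^+ 2 / r ^+ 2]: one factor
   [2] comes from [nc_cmeanC_le], the other from [nc (z - w) >= r / 2]. *)
pose d := Num.min (r / 2) (e * r ^+ 2 / (4 * (M + 1))).
have M1 : 0 < M + 1 by rewrite ltr_wpDl.
have d0 : 0 < d.
  by rewrite lt_min !divr_gt0 // mulr_gt0 // ?exprn_gt0.
exists d => // w; rewrite subr0 lt_min => /andP[w1 w2].
have wr : nc w < r by apply: lt_trans w1 _; rewrite ltr_pdivrMr // mulr_natr mulr2n ltrDl.
have zw z : nc z = r -> z - w != 0.
  by move=> zr; rewrite subr_eq0; apply/eqP => e'; move: wr; rewrite -e' zr ltxx.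
have z0 z : nc z = r -> z != 0 by move=> zr; rewrite -nc_gt0 zr.
(* Second-order remainder of the kernel: [z / (z - w) = 1 + w / z + w ^+ 2 / (z * (z - w))]. *)
pose E z := k z * (w ^+ 2 / (z * (z - w))).
have cE : ccirc E r.
  move=> z zr; apply: ccontM; first exact: kr.
  apply: ccontM; first exact: ccont_cst.
  apply: ccontV; first by apply: mulf_neq0; [exact: z0|exact: zw].
  apply: ccontM; first exact: ccont_id.
  by apply: ccontB; [exact: ccont_id|exact: ccont_cst].
have k0 : k 0 = cmeanC k r.
  rewrite (@mean_value k r R' 0) ?r00 // => z h1 h2 _; exact: dk.
have -> : k w = cmeanC k r + w * cmeanC (fun z => k z * z^-1) r + cmeanC E r.
  rewrite -(cauchy_formula rR wr) -cmeanCZ // -!cmeanCD //.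
  - apply: eq_cmeanC => // z zr; rewrite /E.
    by field; apply/andP; split; [exact: zw|exact: z0].
  - move=> z zr; apply: ccontD; first exact: kr.
    by apply: ccontM; [exact: ccont_cst|exact: cz].
  - by move=> z zr; apply: ccontM; [exact: ccont_cst|exact: cz].
rewrite k0; set x := cmeanC k r; set y := cmeanC _ r.
have -> : x + w * y + cmeanC E r - x - y * w = cmeanC E r by ring.
have hE z : nc z = r -> nc (E z) <= M * (nc w ^+ 2 / (r * (r / 2))).
  move=> zr; have -> : nc (E z) = nc (k z) * (nc w ^+ 2 / (r * nc (z - w))).
    by rewrite /E ncM (ncM (w ^+ 2)) ncX ncV ncM zr.
  apply: ler_pM; [exact: nc_ge0| |exact: hM|].
    by apply: divr_ge0; [exact: exprn_ge0 (nc_ge0 _)|exact: mulr_ge0 (ltW r0) (nc_ge0 _)].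
  apply: ler_wpM2l; first exact: exprn_ge0 (nc_ge0 _).
  have h1 : r / 2 <= nc (z - w).
    by apply: le_trans (nc_sub_ge _ _); rewrite zr; lra.
  have r2 : 0 < r / 2 by rewrite divr_gt0.
  rewrite lef_pV2 ?posrE ?mulr_gt0 //; first by rewrite ler_pM2l.
  exact: lt_le_trans h1.
apply: le_trans (nc_cmeanC_le r00 cE hE) _.
have -> : 2 * (M * (nc w ^+ 2 / (r * (r / 2)))) = (4 * M * nc w / r ^+ 2) * nc w.
  by field; rewrite gt_eqF.
rewrite ler_wpM2r ?nc_ge0 // ler_pdivrMr ?exprn_gt0 //.
move: w2; rewrite ltr_pdivlMr ?mulr_gt0 // => /ltW; apply: le_trans.
by have := nc_ge0 w; move: (nc w) M0 => n M0; nra.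
Qed.

End Removable.
End MeanValue.

(** * Zeros and logarithms of holomorphic functions *)

Section ZeroOrder.
Context {R : realType}.
Local Notation C := (R[i]^o).
Local Notation nc := (@Normc.normc R).
Implicit Types (f g k : C -> C) (r : R) (z w a : C).

Lemma geometric_small (x c e : R) : 0 <= x < 1 -> 0 < e -> exists n, c * x ^+ n < e.
Proof.
move=> /andP[x0 x1] e0.
have c1 : 0 < `|c| + 1 by rewrite ltr_wpDl.
have : (fun n => x ^+ n) @ \oo --> (0 : R) by apply: cvg_expr; rewrite ger0_norm.
move=> /cvgrPdist_lt/(_ (e / (`|c| + 1))); rewrite divr_gt0 // => /(_ isT)[N _ hN].
exists N; have := hN N (leqnn N); rewrite /= sub0r normrN ger0_norm ?exprn_ge0 //.
rewrite ltr_pdivlMr // => h; apply: le_lt_trans h; rewrite mulrC ler_wpM2l ?exprn_ge0 //.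
by rewrite (le_trans (ler_norm _)) // lerDl.
Qed.

(** The quotient is Caratheodory's factor at [0]: continuous there, differentiable elsewhere in the
    disc, so Riemann's theorem applies. *)
Lemma divide_zero g R' : 0 < R' -> (forall z, nc z < R' -> cdiff g z) -> g 0 = 0 ->
  exists2 k, forall z, nc z < R' -> cdiff k z & forall z, g z = z * k z.
Proof.
move=> R0 dg g0; have n0 : nc (0 : C) < R' by rewrite nc0.
have [k ck hk] := dg _ n0; exists k; last first.
  by move=> z; have := hk z; rewrite g0 !subr0 mulrC.
have dk z : nc z < R' -> z != 0 -> cdiff k z.
  by move=> zR z0; apply: diff_quot_cdiff hk z0 _; exact: dg.
move=> z zR; have [->|z0] := eqVneq z 0; last exact: dk.
apply: (@cdiff_removable _ k R') => // w wR.
have [->//|w0] := eqVneq w 0.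
by apply: diff_quot_cont hk w0 _; apply: cdiff_cont; exact: dg.
Qed.

(** If every power of [z] divides [g], Cauchy's formula for the quotient by [z ^+ m] bounds [g w] by
    a constant times [(nc w / r) ^+ m], with the constant independent of [m]; hence [g w = 0]. This
    takes the place of a power series expansion. *)
Lemma zero_order g R' : 0 < R' -> (forall z, nc z < R' -> cdiff g z) ->
  (forall z, nc z < R' -> g z = 0) \/
  exists m k, [/\ forall z, nc z < R' -> cdiff k z, k 0 != 0 & forall z, g z = z ^+ m * k z].
Proof.
move=> R0 dg; rewrite -implyNp => n1; apply: contrapT => n2; apply: n1.
have fact m : exists2 k, forall z, nc z < R' -> cdiff k z & forall z, g z = z ^+ m * k z.
  elim: m => [|m [k dk hk]]; first by exists g => // z; rewrite expr0 mul1r.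
  have k0 : k 0 = 0.
    by apply/eqP/negPn/negP => k0; apply: n2; exists m, k.
  have [k' dk' hk'] := divide_zero R0 dk k0; exists k' => // z.
  by rewrite hk hk' exprSr mulrA.
move=> w wR; pose r := (nc w + R') / 2.
have wr : nc w < r by rewrite /r; lra.
have rR : r < R' by rewrite /r; lra.
have r0 : 0 < r by apply: le_lt_trans wr; exact: nc_ge0.
have r00 := ltW r0; have hr : 0 < r < R' by rewrite r0.
have [M hM] : exists M, forall z, nc z = r -> nc (g z) <= M.
  by apply: circ_bounded => z zr; apply: cont_nc; apply: cdiff_cont; apply: dg; rewrite zr.
have wr0 : 0 < r - nc w by rewrite subr_gt0.
apply/eqP; rewrite -nc_eq0 eq_le nc_ge0 andbT.
apply/ler_addgt0Pl => e e0; rewrite addr0.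
have x01 : 0 <= nc w / r < 1 by rewrite divr_ge0 ?nc_ge0 // ltr_pdivrMr // mul1r.
have [m hm] := geometric_small (2 * (M * (r / (r - nc w)))) x01 e0.
have [k dk hk] := fact m; apply: le_trans (ltW hm).
rewrite hk ncM ncX expr_div_n mulrCA ler_wpM2l ?exprn_ge0 ?nc_ge0 //.
rewrite ler_pdivlMr ?exprn_gt0 // mulrC.
have zw z : nc z = r -> z - w != 0.
  by move=> zr; rewrite subr_eq0; apply/eqP => e'; move: wr; rewrite -e' zr ltxx.
have ck z : nc z < R' -> cont_at k z by move=> /dk; exact: cdiff_cont.
have cc : ccirc (fun z => k z + k z * (w / (z - w))) r.
  move=> z zr; apply: ccontD; first by apply: ck; rewrite zr.
  by apply: ccontM; [apply: ck; rewrite zr|exact: cauchy_kernel_cont wr _ zr].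
rewrite -(cauchy_formula ck (fun z zR _ => dk z zR) hr wr).
have rm : 0 < r ^+ m by rewrite exprn_gt0.
rewrite -ler_pdivlMl //.
have -> : (r ^+ m)^-1 * (2 * (M * (r / (r - nc w)))) = 2 * ((r ^+ m)^-1 * M * (r / (r - nc w))).
  by ring.
apply: nc_cmeanC_le => // z zr.
have -> : k z + k z * (w / (z - w)) = k z * (z / (z - w)) by field; exact: zw.
have kz : nc (k z) = (r ^+ m)^-1 * nc (g z).
  by rewrite hk ncM ncX zr mulKf // gt_eqF.
rewrite ncM kz; apply: ler_pM.
- by rewrite mulr_ge0 ?invr_ge0 ?nc_ge0 // ltW.
- exact: nc_ge0.
- by rewrite ler_wpM2l ?hM // invr_ge0 ltW.
rewrite ncM ncV zr ler_wpM2l // lef_pV2 ?posrE ?nc_gt0 ?zw //.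
by rewrite -zr nc_sub_ge.
Qed.

Lemma cdiff_shift f a z : cdiff f (z + a) -> cdiff (fun w => f (w + a)) z.
Proof.
move=> h; apply: (@cdiff_comp _ (fun w => w + a) f) => //.
by apply: cdiffD; [exact: cdiff_id|exact: cdiff_cst].
Qed.

Lemma zero_order_at f a : (\forall w \near a, cdiff f w) ->
  (\forall w \near a, f w = 0) \/
  exists m k, [/\ \forall w \near a, cdiff k w, k a != 0 & forall w, f w = (w - a) ^+ m * k w].
Proof.
move=> /nbhsCP[d d0 hd].
have dg z : nc z < d -> cdiff (fun z => f (z + a)) z.
  by move=> zd; apply: cdiff_shift; apply: hd; rewrite addrK.
have [h|[m [k [dk k0 hk]]]] := zero_order d0 dg; [left|right].
  apply/nbhsCP; exists d => // w wd; have := h _ wd; by rewrite subrK.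
exists m, (fun w => k (w - a)); split.
- apply/nbhsCP; exists d => // w wd; apply: (@cdiff_shift k (- a)); exact: dk.
- by rewrite subrr.
by move=> w; rewrite -hk subrK.
Qed.

End ZeroOrder.

Section HolomorphicLog.
Context {R : realType}.
Local Notation C := (R[i]^o).
Local Notation nc := (@Normc.normc R).
Implicit Types (h g : C -> C) (z w : C).

Definition clog z : C := ln (nc z) +i* atan (Im z / Re z).

Lemma clogK z : 0 < Re z -> cexp (clog z) = z.
Proof.
move=> x0; have z0 : z != 0 by apply/eqP => e; move: x0; rewrite e ltxx.
have n0 : 0 < nc z by rewrite nc_gt0.
rewrite /cexp /circle_pt /clog /= lnK ?posrE //; set t := Im z / Re z.
have c0 : cos (atan t) = (Num.sqrt (1 + t ^+ 2))^-1 := cos_atan t.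
have s1 : 0 < Num.sqrt (1 + t ^+ 2).
  by rewrite sqrtr_gt0 ltr_wpDr // sqr_ge0.
have st : sin (atan t) = t * cos (atan t).
  have tt : sin (atan t) / cos (atan t) = t := atanK t.
  have := congr1 (fun x => x * cos (atan t)) tt; rewrite divfK //.
  by rewrite c0 invr_eq0 gt_eqF.
have nE : nc z = Re z * Num.sqrt (1 + t ^+ 2).
  apply/eqP; rewrite -(@eqrXn2 _ 2) ?mulr_ge0 ?nc_ge0 ?(ltW x0) ?(ltW s1) //.
  rewrite exprMn sqr_sqrtr ?addr_ge0 ?sqr_ge0 // sqr_nc /t; apply/eqP.
  by field; rewrite gt_eqF.
have e1 : nc z * cos (atan t) = Re z by rewrite nE c0 mulfK // gt_eqF.
rewrite st mulrCA e1 /t divfK ?gt_eqF //; by case: (z).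
Qed.

Lemma clog_cont z : 0 < Re z -> cont_at clog z.
Proof.
move=> x0; have n0 : 0 < nc z.
  by rewrite nc_gt0; apply/eqP => e; move: x0; rewrite e ltxx.
apply: ccont_ReIm.
  by apply: rcont_ln => //; apply: cont_nc; exact: ccont_id.
apply: (@cont_comp _ _ _ (fun w : C => Im w / Re w)).
  apply: rcontM; first by apply: cont_Im; exact: ccont_id.
  by apply: rcontV; [rewrite gt_eqF|apply: cont_Re; exact: ccont_id].
by split; exact: continuous_atan.
Qed.

(** Inverse function argument in Caratheodory's form: if [phi] is the factor of [cexp] at [clog z],
    then [1 / phi (clog w)] is that of [clog] at [z]. The identity [clogK] is available on the
    neighbourhood where [Re w > 0]. *)
Lemma clog_cdiff z : 0 < Re z -> cdiff clog z.
Proof.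
move=> x0; have [phi [cphi phi0 hphi]] := cexp_caratheodory (clog z).
have cz := clog_cont x0.
have nz : phi (clog z) != 0 by rewrite phi0 cexp_neq0.
pose chi w := (phi (clog w))^-1.
have cchi : cont_at chi z.
  by apply: ccontV => //; apply: (@cont_comp _ _ _ clog).
pose D := fun w => clog z + chi w * (w - z).
apply: (@cdiff_near _ _ D); last first.
  by exists chi => // w; rewrite /D subrr mulr0 addr0 addrC addKr.
have : cont_at (fun w : C => Re w) z by apply: cont_Re; exact: ccont_id.
move=> /rcontP/(_ _ x0) h; apply: filterS h => w; rewrite ltr_norml => /andP[h _].
have w0 : 0 < Re w by move: h; lra.
have e := hphi (clog w); rewrite !clogK // in e.
have [wz|wz] := eqVneq w z; first by rewrite /D wz subrr mulr0 addr0.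
have p0 : phi (clog w) != 0.
  by apply/eqP => p0; move: e; rewrite p0 mul0r => /eqP; rewrite subr_eq0 (negPf wz).
by rewrite /D /chi e mulKf // addrC subrK.
Qed.

(* [h] is close to constant on steps [z / N], so the logarithms of the ratios
   of consecutive values on the segment from [0] to [z] are all principal. *)
Lemma holomorphic_log h (r R' : R) : 0 <= r < R' ->
  (forall z, nc z < R' -> cdiff h z /\ h z != 0) ->
  exists g, forall z, nc z <= r -> cdiff g z /\ Re (g z) = ln (nc (h z)).
Proof.
move=> /andP[r0 rR] hh.
have ch z : nc z <= r -> cont_at h z.
  by move=> zr; apply: cdiff_cont; exact: (hh _ (le_lt_trans zr rR)).1.
have [d d0 hd] : exists2 d, 0 < d & forall w, [set w | nc w <= r] w ->
    forall w', nc (w' - w) < d -> nc (h w' / h w - 1) < 1.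
  apply: (@disc_ind R (fun A => exists2 d, 0 < d & forall w, A w ->
    forall w', nc (w' - w) < d -> nc (h w' / h w - 1) < 1)) => //.
  - by move=> A B AB [d d0 hd]; exists d => // w /AB; exact: hd.
  - move=> A B [d d0 hd] [d' d'0 hd']; exists (Num.min d d'); first by rewrite lt_min d0.
    by move=> w [Aw|Bw] w'; rewrite lt_min => /andP[h1 h2]; [exact: (hd w)|exact: (hd' w)].
  move=> z zr; have n0 : 0 < nc (h z) by rewrite nc_gt0; exact: (hh _ (le_lt_trans zr rR)).2.
  (* With both values within [nc (h z) / 4] of [h z], they differ by less than [nc (h z) / 2], while
     [nc (h w)] exceeds [3 / 4] of [nc (h z)]; so the ratio stays within distance [1] of [1]. *)
  have n8 : 0 < nc (h z) / 4 by rewrite divr_gt0.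
  have /ccontP/(_ _ n8)[d d0 hd] := ch _ zr.
  exists (d / 2); first by rewrite divr_gt0.
  exists (d / 2); first by rewrite divr_gt0.
  move=> w [wz wr] w' ww'.
  have h1 : nc (h w - h z) < nc (h z) / 4 by apply: hd; lra.
  have h2 : nc (h w' - h z) < nc (h z) / 4.
    by apply: hd; have := nc_triangle w w' z; lra.
  have h3 : nc (h z) * 3 / 4 < nc (h w).
    by have := nc_sub_ge (h z) (h w); rewrite ncB; lra.
  have h4 : nc (h w' - h w) < nc (h z) / 2.
    by have := nc_triangle (h z) (h w') (h w); rewrite (ncB (h z)); lra.
  have w0 : 0 < nc (h w) by lra.
  have -> : h w' / h w - 1 = (h w' - h w) / h w by field; rewrite -nc_gt0.
  by rewrite ncM ncV ltr_pdivrMr //; lra.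
have [N hN] : exists N : nat, r < d * N.+1%:R.
  exists (Num.bound (r / d)); rewrite mulrC -ltr_pdivrMr //.
  apply: le_lt_trans (ler_norm _) _; apply: lt_trans (archi_boundP (normr_ge0 _)) _.
  by rewrite /Num.bound normr_id ltr_nat.
pose s j : C := (j%:R / N.+1%:R)%:C.
have N0 : 0 < N.+1%:R :> R by rewrite ltr0n.
have ns j : (j <= N.+1)%N -> nc (s j) <= 1.
  by move=> jN; rewrite nc_real ger0_norm ?divr_ge0 // ler_pdivrMr // mul1r ler_nat.
have sz j z : (j <= N.+1)%N -> nc z <= r -> nc (s j * z) <= r.
  by move=> jN zr; rewrite ncM -[leRHS]mul1r ler_pM ?nc_ge0 ?ns.
have ss j z : s j.+1 * z - s j * z = (N.+1%:R^-1)%:C * z.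
  rewrite -mulrBl; congr (_ * _); rewrite /s -(rmorphB (real_complex R)); congr (_ %:C).
  by rewrite -mulrBl -natrB ?subSnn ?mul1r.
pose a j z := h (s j.+1 * z) / h (s j * z).
have h0 j z : (j <= N.+1)%N -> nc z <= r -> h (s j * z) != 0.
  by move=> jN zr; apply: (hh _ _).2; apply: le_lt_trans rR; exact: sz.
have a1 j z : (j < N.+1)%N -> nc z <= r -> 0 < Re (a j z).
  move=> jN zr; have : nc (a j z - 1) < 1.
    apply: (hd (s j * z)); first by rewrite /= sz // ltnW.
    rewrite ss ncM nc_real ger0_norm ?invr_ge0 // mulrC ltr_pdivrMr //.
    exact: le_lt_trans hN.
  move=> /(le_lt_trans (nc_Re_le _)); rewrite ReD ReN /= ltr_norml => /andP[].
  by lra.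
exists (fun z => (ln (nc (h 0)))%:C + \sum_(j < N.+1) clog (a j z)) => z zr; split.
  apply: cdiffD; first exact: cdiff_cst.
  apply: cdiff_sum => j _; apply: (@cdiff_comp _ (a j) clog); last exact/clog_cdiff/a1.
  have dj i : (i <= N.+1)%N -> cdiff (fun z => h (s i * z)) z.
    move=> iN; apply: (@cdiff_comp _ (fun z => s i * z) h).
      by apply: cdiffM; [exact: cdiff_cst|exact: cdiff_id].
    by apply: (hh _ _).1; apply: le_lt_trans rR; exact: sz.
  by apply: cdiff_div; [apply: h0 => //; exact: ltnW|exact: dj|apply: dj; exact: ltnW].
rewrite ReD.
have -> : Re (\sum_(j < N.+1) clog (a j z)) = \sum_(j < N.+1) ln (nc (a j z)).
  by elim/big_rec2: _ => // j x y _ <-; rewrite ReD.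
(* The moduli telescope from [h 0] at [s 0 = 0] to [h z] at [s N.+1 = 1]. *)
pose L j := ln (nc (h (s j * z))).
have -> : \sum_(j < N.+1) ln (nc (a j z)) = \sum_(0 <= j < N.+1) (L j.+1 - L j).
  rewrite big_mkord; apply: eq_bigr => j _; rewrite /a ncM ncV.
  by rewrite lnM ?lnV ?posrE ?invr_gt0 ?nc_gt0 ?h0 // ltnW.
rewrite telescope_sumr // /L /=.
have -> : s N.+1 = 1 by rewrite /s divff ?gt_eqF.
have -> : s 0%N = 0 by rewrite /s mul0r.
by rewrite mul1r mul0r addrC subrK.
Qed.

Lemma mean_ln h (r R' : R) : 0 <= r < R' ->
  (forall z, nc z < R' -> cdiff h z /\ h z != 0) ->
  cmean (fun z => ln (nc (h z))) r = ln (nc (h 0)).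
Proof.
(* The logarithm lives on a closed disc inside the one of radius [R'], whereas the mean value
   property wants an open disc beyond [r]; the midpoint serves both. *)
move=> /andP[r0 rR] hh; pose r1 := (r + R') / 2.
have h1 : 0 <= r1 < R' by rewrite /r1; lra.
have [g hg] := holomorphic_log h1 hh.
have rr1 : r < r1 by rewrite /r1; lra.
rewrite -(hg 0 _).2; last by rewrite nc0 (le_trans r0) ?ltW.
rewrite -(@mean_value_Re _ g r r1 0) ?r0 //.
- by apply: (eq_cmean r0) => z zr; rewrite (hg z _).2 // zr ltW.
- by move=> z zr; apply: cdiff_cont; exact: (hg z (ltW zr)).1.
- by move=> z zr _ _; exact: (hg z (ltW zr)).1.
Qed.

Lemma ln_diff_le h (r R' : R) w : 0 < r < R' ->
  (forall z, nc z < R' -> cdiff h z /\ h z != 0) -> nc w < r ->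
  `|ln (nc (h w)) - ln (nc (h 0))| <=
    2 * nc w / (r - nc w) * cmean (fun z => `|ln (nc (h z))|) r.
Proof.
move=> /andP[r0 rR] hh wr; pose r1 := (r + R') / 2.
have h1 : 0 <= r1 < R' by rewrite /r1; lra.
have [g hg] := holomorphic_log h1 hh.
have rr1 : r < r1 by rewrite /r1; lra.
have rr : 0 < r < r1 by rewrite r0.
have := Re_diff_le rr (fun z zr => (hg z (ltW zr)).1) wr.
rewrite (hg w _).2 ?(hg 0 _).2 ?nc0; try lra.
rewrite (@eq_cmean _ (fun z => `|Re (g z)|) (fun z => `|ln (nc (h z))|)) //; first exact: ltW.
by move=> z zr; rewrite (hg z _).2 // zr ltW.
Qed.

End HolomorphicLog.

(** * The divisor of a meromorphic function *)

Section LocalForm.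
Context {R : realType}.
Local Notation C := (R[i]^o).
Local Notation nc := (@Normc.normc R).
Implicit Types (f g h : C -> C) (z w a b : C) (m p : nat).

(** Zeros and poles in one format with natural exponents; only the difference of [m] and [p] is
    determined. The punctured neighbourhood reflects that the value at a pole is arbitrary. *)
Definition local_form f a m p g :=
  [/\ \forall w \near a, cdiff g w, g a != 0 &
      \forall w \near a^', f w = g w * (w - a) ^+ m / (w - a) ^+ p].

Lemma punctured_neq (P : C -> Prop) a (r : R) : 0 < r ->
  (forall w, nc (w - a) < r -> w != a -> P w) -> exists2 w, w != a & P w.
Proof.
move=> r0 h; have r2 : 0 < r / 2 by rewrite divr_gt0.
have e : nc (a + (r / 2)%:C - a) = r / 2.
  by rewrite addrAC subrr add0r nc_real ger0_norm // ltW.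
have wa : a + (r / 2)%:C != a by rewrite -subr_eq0 -nc_gt0 e.
exists (a + (r / 2)%:C) => //; apply: h => //; rewrite e.
by rewrite ltr_pdivrMr // mulr_natr mulr2n ltrDl.
Qed.

(** Otherwise [g] would be [g'] times a positive power of [w - a] near [a], hence zero at [a] by
    continuity. *)
Lemma local_form_le f a m p g m' p' g' : local_form f a m p g ->
  local_form f a m' p' g' -> (m' + p <= m + p')%N.
Proof.
move=> [/nbhs_singleton dg g0 fg] [/nbhs_singleton dg' g'0 fg'].
rewrite leqNgt; apply/negP => lt.
pose k := (m' + p - (m + p'))%N; have k0 : (0 < k)%N by rewrite subn_gt0.
have : g a = g' a * (a - a) ^+ k.
  apply: (@ccont_eq _ g (fun w => g' w * (w - a) ^+ k)); first exact: cdiff_cont.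
    apply: cdiff_cont; apply: cdiffM => //; apply: cdiffX.
    by apply: cdiffB; [exact: cdiff_id|exact: cdiff_cst].
  move/dnbhsCP: fg => [d d0 hd]; move/dnbhsCP: fg' => [d' d'0 hd'].
  apply/dnbhsCP; exists (Num.min d d'); first by rewrite lt_min d0.
  move=> w; rewrite lt_min => /andP[h1 h2] wa.
  have wa0 : w - a != 0 by rewrite subr_eq0.
  have := hd _ h1 wa; rewrite (hd' _ h2 wa) => e.
  have e2 : g' w * (w - a) ^+ (m' + p) = g w * (w - a) ^+ (m + p').
    by move/eqP: e; rewrite eqr_div ?expf_neq0 // => /eqP e; rewrite !exprD !mulrA.
  have mk : (m' + p = k + (m + p'))%N by rewrite subnK // ltnW.
  by move: e2; rewrite mk exprD mulrA => /(mulIf (expf_neq0 (m + p') wa0)) ->.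
by rewrite subrr expr0n -leqn0 leqNgt k0 mulr0 => e; move: g0; rewrite e eqxx.
Qed.

Lemma pole_local_form f a m : pole_of_order f a m ->
  (0 < m)%N /\ exists g, local_form f a 0 m g.
Proof.
move=> [m0 [g [dg g0 fg]]]; split => //; exists g; split; [|exact/eqP|].
- by apply: filterS dg => w; exact: derivable_cdiff.
- by apply: filterS fg => w ->; rewrite expr0 mulr1.
Qed.

(** Asking one exponent to vanish selects one pair among the local forms at [a]. For a meromorphic
    [f] without a local form at [a], the default is returned; then [f] vanishes around [a], which
    [mero_not_zero] excludes. *)
Definition mult f a : nat * nat := xget (0%N, 0%N)
  [set mp | (mp.1 = 0%N \/ mp.2 = 0%N) /\ exists g, local_form f a mp.1 mp.2 g].

Lemma local_form_mult f a m p g : local_form f a m p g -> m = 0%N \/ p = 0%N ->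
  mult f a = (m, p).
Proof.
move=> fg mp; have ex : exists g, local_form f a m p g by exists g.
have := @xgetPex _ (0%N, 0%N) [set mp | (mp.1 = 0%N \/ mp.2 = 0%N) /\
  exists g, local_form f a mp.1 mp.2 g] (ex_intro _ (m, p) (conj mp ex)).
rewrite -/(mult f a); case: (mult f a) => m' p' /= [mp' [g' fg']].
have := local_form_le fg fg'; have := local_form_le fg' fg.
by case: mp mp' => -> [] ->; rewrite ?addn0 ?add0n ?leqn0 ?addn_eq0;
  move=> h1 h2; congr (_, _); lia.
Qed.

(** The source of the isolation of zeros and poles: at nearby points [f] is its own local form, with
    both exponents [0]. *)
Lemma local_form_neq0 f a m p g : local_form f a m p g ->
  \forall w \near a^', cdiff f w /\ f w != 0 /\ local_form f w 0 0 f.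
Proof.
move=> [dg g0 fg]; have cg := cdiff_cont (nbhs_singleton dg).
move/dnbhsCP: fg => [d d0 hd]; move/nbhsCP: dg => [d' d'0 hd'].
have n0 : 0 < nc (g a) by rewrite nc_gt0.
move/ccontP: cg => /(_ _ n0)[d2 d20 hd2].
pose e := Num.min d (Num.min d' d2).
apply/dnbhsCP; exists e; first by rewrite !lt_min d0 d'0 d20.
have step w : nc (w - a) < e -> w != a -> cdiff f w /\ f w != 0.
  rewrite !lt_min => /and3P[h1 h2 h3] wa.
  have wa0 : w - a != 0 by rewrite subr_eq0.
  have gw : g w != 0.
    by apply/eqP => e'; have := hd2 _ h3; rewrite e' sub0r ncN ltxx.
  have dx q : cdiff (fun w => (w - a) ^+ q) w.
    by apply: cdiffX; apply: cdiffB; [exact: cdiff_id|exact: cdiff_cst].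
  split; last by rewrite hd // !mulf_neq0 ?invr_eq0 ?expf_neq0.
  apply: (@cdiff_near _ _ (fun w => g w * (w - a) ^+ m / (w - a) ^+ p)).
    apply/nbhsCP; exists (Num.min (d - nc (w - a)) (nc (w - a))).
      by rewrite lt_min subr_gt0 h1 nc_gt0.
    move=> x; rewrite lt_min => /andP[x1 x2]; apply: hd.
      by have := nc_triangle w x a; lra.
    by apply/eqP => xa; move: x2; rewrite xa ncB ltxx.
  apply: cdiff_div; first exact: expf_neq0.
    by apply: cdiffM => //; exact: hd'.
  exact: dx.
move=> w we wa; have [df f0] := step w we wa; do !split => //.
- apply/nbhsCP; exists (Num.min (e - nc (w - a)) (nc (w - a))).
    by rewrite lt_min subr_gt0 we nc_gt0 subr_eq0.
  move=> x; rewrite lt_min => /andP[x1 x2]; apply: (step x _ _).1.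
    by have := nc_triangle w x a; lra.
  by apply/eqP => xa; move: x2; rewrite xa ncB ltxx.
- by apply/dnbhsCP; exists 1 => // x _ _; rewrite !expr0 divr1 mulr1.
Qed.

(** The last clause holds since [meromorphic] allows no removable singularities. It gives access to
    [f] at [a] itself, about which a local form is silent. *)
Lemma mero_local f a : meromorphic f -> (\forall w \near a^', f w = 0) \/
  exists m p g, [/\ local_form f a m p g, m = 0%N \/ p = 0%N &
    p = 0%N -> \forall w \near a, cdiff f w].
Proof.
move=> mf; case: (mf a) => [hf|[p /pole_local_form[p0 [g hg]]]]; last first.
  right; exists 0%N, p, g; split; [by []|by left|].
  by move=> e; rewrite e in p0.
have df : \forall w \near a, cdiff f w by apply: filterS hf => w; exact: derivable_cdiff.
case: (zero_order_at df) => [h|[m [k [dk k0 hk]]]]; [left|right].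
  exact: nbhs_dnbhs.
exists m, 0%N, k; split; [split=> //|by right|by []].
by apply/dnbhsCP; exists 1 => // w _ _; rewrite expr0 divr1 hk mulrC.
Qed.

(* The set of points near which [f] vanishes identically is open and closed. *)
Lemma mero_not_zero f a : meromorphic f -> ~ (exists c, forall z, f z = c) ->
  ~ (\forall w \near a^', f w = 0).
Proof.
move=> mf nf za; pose A z := \forall w \near z^', f w = 0.
have loc z : exists2 d : R, 0 < d & (forall w, nc (w - z) < d -> A w) \/
    (forall w, nc (w - z) < d -> ~ A w).
  case: (mero_local z mf) => [Az|[m [p [g [fg _ _]]]]].
    move/dnbhsCP: (Az) => [d d0 hd]; exists d => //; left => w wd.
    have [->//|wz] := eqVneq w z; apply/dnbhsCP.
    exists (Num.min (d - nc (w - z)) (nc (w - z))).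
      by rewrite lt_min subr_gt0 wd nc_gt0 subr_eq0.
    move=> x; rewrite lt_min => /andP[x1 x2] _; apply: hd.
      by have := nc_triangle w x z; lra.
    by apply/eqP => xa; move: x2; rewrite xa ncB ltxx.
  have /dnbhsCP[d d0 hd] := local_form_neq0 fg; exists d => //; right => w wd.
  move=> /dnbhsCP[d' d'0 hd'].
  have [wz|wz] := eqVneq w z.
    rewrite wz in hd'.
    have [||x _ []] := @punctured_neq (fun x => f x = 0 /\ f x != 0) z (Num.min d d').
    - by rewrite lt_min d0.
    - move=> x; rewrite lt_min => /andP[x1 x2] xz; split; first exact: hd'.
      exact: (hd x x1 xz).2.1.
    by move=> ->; rewrite eqxx.
  have [||x _ []] := @punctured_neq (fun x => f x = 0 /\ f x != 0) w
      (Num.min d' (Num.min (d - nc (w - z)) (nc (w - z)))).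
  - by rewrite !lt_min d'0 subr_gt0 wd nc_gt0 subr_eq0.
  - move=> x; rewrite !lt_min => /and3P[x1 x2 x3] xw; split; first exact: hd'.
    apply: (hd x _ _).2.1; first by have := nc_triangle w x z; lra.
    by apply/eqP => xa; move: x3; rewrite xa ncB ltxx.
  by move=> ->; rewrite eqxx.
have all z : A z.
  pose M := nc z + nc a.
  have M0 : 0 <= M by rewrite addr_ge0 ?nc_ge0.
  (* The rectangle lies entirely in [A] or entirely outside. The four quarters share the centre, so
     their alternatives agree. *)
  pose Q (a a' b b' : R) := (forall w, a <= Re w <= a' -> b <= Im w <= b' -> A w) \/
     (forall w, a <= Re w <= a' -> b <= Im w <= b' -> ~ A w).
  have inM w : nc w <= M -> - M <= Re w <= M /\ - M <= Im w <= M.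
    by move=> wM; rewrite -!ler_norml !(le_trans _ wM) ?nc_Re_le ?nc_Im_le.
  have [az1 az2] := inM a (ler_wpDl (nc_ge0 z) (lexx _)).
  have [zz1 zz2] := inM z (ler_wpDr (nc_ge0 a) (lexx _)).
  suff : Q (- M) M (- M) M by case=> h; [exact: (h z zz1 zz2)|case: (h a az1 az2 za)].
  apply: (@cousin R Q); try by rewrite ge0_cp.
  - move=> x x' y y' m n [_ xx _] [_ yy _] h1 h2 h3 h4.
    have mx : x <= m /\ m <= x' by rewrite /m; lra.
    have ny : y <= n /\ n <= y' by rewrite /n; lra.
    have sel u u' v v' : Q u u' v v' -> u <= m -> m <= u' -> v <= n -> n <= v' ->
        forall w, u <= Re w <= u' -> v <= Im w <= v' -> (A w <-> A (m +i* n)).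
      move=> q m1 m2 n1 n2 w hu hv.
      have mm : u <= m <= u' by rewrite m1.
      have nn : v <= n <= v' by rewrite n1.
      case: q => q; first by split=> _; exact: q.
      by split => ?; [case: (q w)|case: (q (m +i* n))].
    have {}sel w : x <= Re w <= x' -> y <= Im w <= y' -> (A w <-> A (m +i* n)).
      move=> /andP[w1 w2] /andP[w3 w4].
      have [w5|/ltW w5] := lerP (Re w) m; have [w6|/ltW w6] := lerP (Im w) n.
      + by apply: (sel _ _ _ _ h1) => //; rewrite ?mx.1 ?ny.1 ?w1 ?w3.
      + by apply: (sel _ _ _ _ h3) => //; rewrite ?mx.1 ?ny.2 ?w1 ?w6.
      + by apply: (sel _ _ _ _ h2) => //; rewrite ?mx.2 ?ny.1 ?w5 ?w3.
      + by apply: (sel _ _ _ _ h4) => //; rewrite ?mx.2 ?ny.2 ?w5 ?w6.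
    have [Ac|Ac] := pselect (A (m +i* n)).
      by left => w hx hy; rewrite (sel w).
    by right => w hx hy; rewrite (sel w).
  - move=> x y _ _; have [d d0 hd] := loc (x +i* y).
    exists (d / 2); first by rewrite divr_gt0.
    move=> u u' v v' [_ u1 u2 _] [_ v1 v2 _] du dv.
    have near w : u <= Re w <= u' -> v <= Im w <= v' -> nc (w - (x +i* y)) < d.
      move=> /andP[? ?] /andP[? ?]; apply: le_lt_trans (nc_le_ReIm _) _.
      have h1 : `|Re w - x| < d / 2 by rewrite ltr_norml; lra.
      have h2 : `|Im w - y| < d / 2 by rewrite ltr_norml; lra.
      by rewrite ReD ImD ReN ImN /= [ltRHS]Num.Theory.splitr ltrD.
    by case: hd => h; [left|right] => w hx hy; apply: h; exact: near.
(* Now [f] vanishes around every point. At a point of holomorphy continuity gives [f z = 0], and a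
   pole would make [f] nonzero nearby. *)
apply: nf; exists 0 => z; have /dnbhsCP[d d0 hd] := all z.
case: (mf z) => [/nbhs_singleton/derivable_cdiff/cdiff_cont cf|[p /pole_local_form[_ [g fg]]]].
  by apply: (ccont_eq cf (ccont_cst 0 z)); exact: all.
have /dnbhsCP[d' d'0 hd'] := local_form_neq0 fg.
have [||x _ []] := @punctured_neq (fun x => f x = 0 /\ f x != 0) z (Num.min d d').
- by rewrite lt_min d0.
- move=> x; rewrite lt_min => /andP[x1 x2] xz; split; first exact: hd.
  exact: (hd' x x2 xz).2.1.
by move=> ->; rewrite eqxx.
Qed.

Section Meromorphic.
Variable f : C -> C.
Hypothesis mf : meromorphic f.
Hypothesis nf : ~ (exists c, forall z, f z = c).

Let special a := mult f a != (0%N, 0%N).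

Lemma multP a : exists2 g, local_form f a (mult f a).1 (mult f a).2 g &
  (mult f a).2 = 0%N -> \forall w \near a, cdiff f w.
Proof.
have [/(mero_not_zero mf nf)//|[m [p [g [fg mp df]]]]] := mero_local a mf.
by exists g; rewrite (local_form_mult fg mp).
Qed.

Lemma pole_multE a : pole_mult f a = (mult f a).2.
Proof.
have pm p : pole_of_order f a p -> mult f a = (0%N, p).
  by move=> /pole_local_form[_ [g fg]]; apply: local_form_mult fg _; left.
have [[p hp]|np] := pselect (exists p, pole_of_order f a p).
  have := @xgetPex _ 0%N [set m | pole_of_order f a m] (ex_intro _ p hp).
  by rewrite -/(pole_mult f a) => /pm ->.
have -> : pole_mult f a = 0%N by apply: xgetPN => m hm; apply: np; exists m.
case: (mf a) => [hf|[p hp]]; last by case: np; exists p.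
have df : \forall w \near a, cdiff f w by apply: filterS hf => w; exact: derivable_cdiff.
case: (zero_order_at df) => [h|[m [k [dk k0 hk]]]].
  by case: (mero_not_zero mf nf (nbhs_dnbhs h)).
suff fg : local_form f a m 0 k by rewrite (local_form_mult fg) //; right.
by split => //; apply/dnbhsCP; exists 1 => // w _ _; rewrite expr0 divr1 hk mulrC.
Qed.

Let nonspecialP a : ~~ special a -> cdiff f a /\ f a != 0.
Proof.
rewrite negbK => /eqP e; have [g] := multP a; rewrite e /= => -[dg g0 fg] /(_ erefl) df.
have da := nbhs_singleton df; split => //.
rewrite (ccont_eq (cdiff_cont da) (cdiff_cont (nbhs_singleton dg))) //.
by apply: filterS fg => w ->; rewrite !expr0 divr1 mulr1.
Qed.

Let special_isolated a : \forall w \near a^', ~~ special w.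
Proof.
have [g fg _] := multP a; apply: filterS (local_form_neq0 fg) => w [_ [_ fw]].
by rewrite /special (local_form_mult fw) ?eqxx //; left.
Qed.

Let special_finite (r : R) : exists S : seq C, uniq S /\
  forall a, (a \in S) = special a && (nc a <= r).
Proof.
have [r0|r0] := ltrP r 0.
  by exists [::]; split => // a; rewrite in_nil leNgt (lt_le_trans r0) ?nc_ge0 ?andbF.
have [S hS] : exists S : seq C, forall a, [set w | nc w <= r] a -> special a -> a \in S.
  apply: (@disc_ind R (fun A => exists S : seq C, forall a, A a -> special a -> a \in S)) => //.
  - by move=> A B AB [S hS]; exists S => a /AB; exact: hS.
  - move=> A B [S hS] [S' hS']; exists (S ++ S') => a [Aa|Ba] sa; rewrite mem_cat.
      by rewrite hS.
    by rewrite hS' ?orbT.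
  move=> z _; have /dnbhsCP[d d0 hd] := special_isolated z; exists d => //.
  exists [:: z] => a [ad _] sa; rewrite mem_seq1; apply/negPn/negP => az.
  by have := hd _ ad az; rewrite sa.
exists (undup [seq a <- S | special a && (nc a <= r)]); split; first exact: undup_uniq.
move=> a; rewrite mem_undup mem_filter andb_idr // => /andP[sa ar].
exact: hS.
Qed.

(** The scale [c] is later the radius [r], so that the moduli match [nc (z - a) / r] in [blog]. *)
Let factor (c a z : C) : C :=
  ((z - a) / c) ^+ (mult f a).1 / ((z - a) / c) ^+ (mult f a).2.

Let factor_neq0 c a z : c != 0 -> z != a -> factor c a z != 0.
Proof.
move=> c0 za; have h : (z - a) / c != 0.
  by rewrite mulf_neq0 ?subr_eq0 // invr_eq0.
by rewrite mulf_neq0 ?invr_eq0 // expf_neq0.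
Qed.

Let factor_cdiff c a z : c != 0 -> z != a -> cdiff (factor c a) z.
Proof.
move=> c0 za; have h : (z - a) / c != 0.
  by rewrite mulf_neq0 ?subr_eq0 // invr_eq0.
have d : cdiff (fun z => (z - a) / c) z.
  apply: cdiffM; last exact: cdiff_cst.
  by apply: cdiffB; [exact: cdiff_id|exact: cdiff_cst].
by apply: cdiff_div; [exact: expf_neq0|exact: cdiffX|exact: cdiffX].
Qed.

Let factorization (c : C) (r : R) : c != 0 -> 0 < r ->
  (forall a, special a -> nc a != r) ->
  exists S h r', [/\ r < r', uniq S, forall a, (a \in S) = special a && (nc a < r),
    forall z, nc z < r' -> cdiff h z /\ h z != 0 &
    forall z, nc z < r' -> z \notin S -> f z = h z * \prod_(a <- S) factor c a z].
Proof.
move=> c0 r0 gen; have [S0 [uS0 hS0]] := special_finite (r + 1).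
(* Only finitely many zeros and poles lie in the disc of radius [r + 1], and none on the circle of
   radius [r]; [r'] stops at or before the next modulus. *)
have [r' [rr' r'1 hr']] : exists r', [/\ r < r', r' <= r + 1 &
    forall a, special a -> nc a < r' -> nc a < r].
  have [r' [r1 r2 r3]] : exists r', [/\ r < r', r' <= r + 1 &
      forall a, a \in S0 -> r < nc a -> r' <= nc a].
    elim: S0 {hS0 uS0} => [|a S [r' [h1 h2 h3]]]; first by exists (r + 1); rewrite ltrDl ltr01.
    have [ra|ra] := ltrP r (nc a).
      exists (Num.min r' (nc a)); rewrite lt_min h1 ra ge_min h2; split => // b.
      rewrite in_cons => /orP[/eqP ->|/h3 h] rb; first by rewrite ge_min lexx orbT.
      by rewrite ge_min h.
    exists r'; split => // b; rewrite in_cons => /orP[/eqP ->|/h3 h] //.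
    by rewrite ltNge ra.
  exists r'; split => // a sa ar'; rewrite lt_neqAle gen // leNgt; apply/negP => ra.
  have := r3 a _ ra; rewrite hS0 sa (le_trans (ltW ar') r2) => /(_ isT).
  by rewrite leNgt ar'.
pose S := [seq a <- S0 | nc a < r].
have uS : uniq S by exact: filter_uniq.
have memS a : (a \in S) = special a && (nc a < r).
  rewrite mem_filter hS0; have [ar|] := ltrP (nc a) r; rewrite ?andbF //=.
  by have -> : nc a <= r + 1 by lra.
have inS a z : nc a < r' -> special a -> a \in S.
  by move=> ar sa; rewrite memS sa hr'.
pose P (T : seq C) z := \prod_(a <- T) factor c a z.
have P0 T z : z \notin T -> P T z != 0.
  move=> zT; rewrite /P big_seq; apply: (big_ind (fun x : C => x != 0)) => [|x y|a aT].
  - exact: oner_neq0.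
  - exact: mulf_neq0.
  by apply: factor_neq0 => //; apply/eqP => e; move: zT; rewrite e aT.
have dP T z : z \notin T -> cdiff (P T) z.
  move=> zT; rewrite /P; under [X in cdiff X]eq_fun do rewrite big_seq.
  apply: cdiff_prod => a aT; apply: factor_cdiff => //.
  by apply/eqP => e; move: zT; rewrite e aT.
have [G hG] : exists G, forall a, local_form f a (mult f a).1 (mult f a).2 (G a).
  have ex a : exists g, local_form f a (mult f a).1 (mult f a).2 g.
    by have [g hg _] := multP a; exists g.
  by have [G hG] := choice ex; exists G.
pose kap a := c ^+ (mult f a).1 / c ^+ (mult f a).2.
have kap0 a : kap a != 0 by rewrite mulf_neq0 ?invr_eq0 // expf_neq0.
(* At points of [S] the quotient [f z / P S z] is meaningless, and [h] is read off the local form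
   there; [kap] compensates the scaling of [factor] by [c]. *)
pose h z := if z \in S then G z z * kap z / P (rem z S) z else f z / P S z.
have remS z : z \notin rem z S by rewrite mem_rem_uniq // inE eqxx.
have PS a z : a \in S -> P S z = factor c a z * P (rem a S) z.
  by move=> aS; rewrite /P (perm_big _ (perm_to_rem aS)) big_cons.
have away (T : seq C) z : z \notin T -> \forall w \near z, w \notin T.
  elim: T => [|b T IH]; first by move=> _; apply: filterE.
  rewrite in_cons negb_or => /andP[zb /IH hT].
  have : \forall w \near z, w != b.
    apply/nbhsCP; exists (nc (z - b)); first by rewrite nc_gt0 subr_eq0.
    by move=> w hw; apply/eqP => e; move: hw; rewrite e ncB ltxx.
  by apply: filterS2 hT => w h1 h2; rewrite in_cons negb_or h2.
exists S, h, r'; split => //.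
  move=> z zr; have [zS|zS] := boolP (z \in S).
    have [dG G0 fG] := hG z; split; last first.
      by rewrite /h zS; apply: mulf_neq0; [exact: mulf_neq0|rewrite invr_eq0; exact: P0].
    apply: (@cdiff_near _ _ (fun w => G z w * kap z / P (rem z S) w)).
      move/dnbhsCP: fG => [d d0 hd]; have /nbhsCP[d' d'0 hd'] := away _ _ (remS z).
      apply/nbhsCP; exists (Num.min d d'); first by rewrite lt_min d0.
      move=> w; rewrite lt_min => /andP[h1 h2].
      have [->|wz] := eqVneq w z; first by rewrite /h zS.
      have wS : w \notin S.
        apply/negP => wS; have := hd' _ h2; rewrite mem_rem_uniq // inE wz wS //.
      rewrite /h (negPf wS) (PS z) // hd // /factor /kap !expr_div_n.
      have wz0 : w - z != 0 by rewrite subr_eq0.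
      have Pw := P0 _ _ (hd' _ h2).
      have X1 n : (w - z) ^+ n != 0 by exact: expf_neq0.
      have X2 n : c ^+ n != 0 by exact: expf_neq0.
      move: (X1 (mult f z).1) (X1 (mult f z).2) (X2 (mult f z).1) (X2 (mult f z).2) Pw.
      move: ((w - z) ^+ (mult f z).1) ((w - z) ^+ (mult f z).2) (c ^+ (mult f z).1)
        (c ^+ (mult f z).2) (P (rem z S) w) (G z w) => x1 x2 y1 y2 p g n1 n2 n3 n4 n5.
      by field; do !(apply/andP; split).
    apply: cdiff_div; [exact: P0| |exact: dP].
    by apply: cdiffM; [exact: nbhs_singleton dG|exact: cdiff_cst].
  have ns : ~~ special z by apply/negP => sz; move: zS; rewrite (inS z z).
  have [df f0] := nonspecialP ns; split; last first.
    by rewrite /h (negPf zS); apply: mulf_neq0 => //; rewrite invr_eq0; exact: P0.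
  apply: (@cdiff_near _ _ (fun w => f w / P S w)).
    by apply: filterS (away _ _ zS) => w wS; rewrite /h (negPf wS).
  by apply: cdiff_div; [exact: P0| |exact: dP].
by move=> z zr zS; rewrite /h (negPf zS) divfK // P0.
Qed.

(** The interface to meromorphy for all that follows. A point is a zero or a pole when [zm a + pm a]
    is nonzero. *)
Record divisor_spec (zm pm : C -> nat) : Prop := DivisorSpec {
  div_pole : forall a, pole_mult f a = pm a ;
  div_local : forall a, exists g, local_form f a (zm a) (pm a) g ;
  div_regular : forall a, (zm a + pm a)%N == 0%N -> cdiff f a /\ f a != 0 ;
  div_finite : forall r : R, exists S : seq C, uniq S /\
    forall a, (a \in S) = ((zm a + pm a)%N != 0%N) && (nc a <= r) ;
  (* Dividing out the zeros and poles in a disc leaves a zero-free function. *)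
  div_factor : forall (c : C) (r : R), c != 0 -> 0 < r ->
    (forall a, (zm a + pm a)%N != 0%N -> nc a != r) ->
    exists S h r', [/\ r < r', uniq S,
      forall a, (a \in S) = ((zm a + pm a)%N != 0%N) && (nc a < r),
      forall z, nc z < r' -> cdiff h z /\ h z != 0 &
      forall z, nc z < r' -> z \notin S ->
        f z = h z * \prod_(a <- S) (((z - a) / c) ^+ zm a / ((z - a) / c) ^+ pm a)] }.

Lemma divisor_exists : exists zm pm, divisor_spec zm pm.
Proof.
exists (fun a => (mult f a).1), (fun a => (mult f a).2).
have sE a : (((mult f a).1 + (mult f a).2)%N != 0%N) = special a.
  by rewrite /special addn_eq0; case: (mult f a).
split.
- exact: pole_multE.
- by move=> a; have [g hg _] := multP a; exists g.
- by move=> a ha; apply: nonspecialP; rewrite -sE negbK.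
- move=> r; have [S [uS hS]] := special_finite r; exists S; split => // a.
  by rewrite sE hS.
move=> c r c0 r0 gen; have gen' a : special a -> nc a != r by rewrite -sE; exact: gen.
have [S [h [r' [h1 h2 h3 h4 h5]]]] := factorization c0 r0 gen'.
by exists S, h, r'; split => // a; rewrite sE h3.
Qed.

End Meromorphic.
End LocalForm.

(** * The integrated counting function *)

Section CountingFunction.
Context {R : realType}.
Local Notation mu := (@lebesgue_measure R).
Local Notation C := (R[i]^o).
Local Notation nc := (@Normc.normc R).
Implicit Types (r s t : R) (a b z : C).

Lemma itv_cont_inv (a b : R) : 0 < a -> itv_cont (fun t : R => t^-1) a b.
Proof.
move=> a0 x /andP[ax _]; apply: (@rcontV _ _ (fun t : R => t)); last by split=> A.
by rewrite gt_eqF // (lt_le_trans a0).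
Qed.

Lemma itv_int_inv (a b : R) : 0 < a -> a <= b ->
  itv_int (fun t => t^-1) a b = ln b - ln a.
Proof.
move=> a0; rewrite le_eqVlt => /orP[/eqP ->|ab].
  by rewrite subrr /itv_int set_itv1 Rintegral_set1.
have cl x : a <= x -> {for x, continuous (@ln R)}.
  by move=> ax; apply: continuous_ln; exact: lt_le_trans ax.
rewrite /itv_int /Rintegral (@continuous_FTC2 R _ (@ln R)) //.
- apply: continuous_in_subspaceT => x; rewrite inE /= in_itv /= => hx.
  by have [] := itv_cont_inv a0 hx.
- split.
  + move=> x; rewrite in_itv /= => /andP[ax _].
    have x0 : 0 < x by exact: lt_trans ax.
    by have [] := is_derive1_ln x0.
  + by apply: cvg_at_right_filter; apply: cl.
  + by apply: cvg_at_left_filter; apply: cl; exact: ltW.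
- move=> x; rewrite in_itv /= => /andP[ax _]; rewrite derive1E.
  have x0 : 0 < x by exact: lt_trans ax.
  by have [_ ->] := is_derive1_ln x0.
Qed.

Lemma logp_ge0 (x : R) : 0 <= logp x.
Proof. by rewrite /logp le_max lexx orbT. Qed.

Lemma ln_le_logp (x : R) : ln x <= logp x.
Proof. by rewrite /logp le_max lexx. Qed.

Lemma logp_id (x : R) : 1 <= x -> logp x = ln x.
Proof. by move=> x1; rewrite /logp max_l // ln_ge0. Qed.

Lemma logp_eq0 (x : R) : 0 <= x <= 1 -> logp x = 0.
Proof. by move=> /andP[x0 x1]; rewrite /logp max_r // ln_le0. Qed.

Lemma logp_inv (x : R) : 0 < x -> logp x - logp x^-1 = ln x.
Proof.
move=> x0; rewrite /logp lnV ?posrE //; have [h|h] := lerP (ln x) 0.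
  by rewrite max_l ?oppr_ge0 // sub0r opprK.
by rewrite max_r ?subr0 // oppr_le0 ltW.
Qed.

Lemma abs_ln_logp (x : R) : 0 < x -> `|ln x| = logp x + logp x^-1.
Proof.
move=> x0; rewrite /logp lnV ?posrE //; have [h|h] := lerP (ln x) 0.
  by rewrite ler0_norm // add0r max_l // oppr_ge0.
by rewrite gtr0_norm // max_r ?addr0 // oppr_le0 ltW.
Qed.

Lemma le_logp (x y : R) : 0 <= x -> x <= y -> logp x <= logp y.
Proof.
move=> x0 xy; have [->|xn0] := eqVneq x 0.
  by rewrite {1}/logp ln0 // max_l ?logp_ge0.
have xp : 0 < x by rewrite lt_neqAle eq_sym xn0.
by rewrite /logp ge_max !le_max lexx orbT andbT ler_ln ?xy // posrE (lt_le_trans xp).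
Qed.

(** What a point of modulus [al] contributes to [(n(t) - n(0)) / t]. Its integral over [[0, r]] is
    [logp (r / al)]. *)
Let step (al t : R) : R := if al < t then t^-1 else 0.

Let step_int al r : 0 < al -> 0 < r ->
  mu.-integrable `[0, r] (EFin \o step al) /\
  \int[mu]_(t in `[0, r]) step al t = logp (r / al).
Proof.
move=> a0 r0; have [ra|ar] := lerP r al.
  have z t : `[0, r]%classic t -> step al t = 0.
    rewrite /= in_itv /= /step => /andP[_ tr].
    by rewrite ltNge (le_trans tr ra).
  split.
    apply: (@eq_integrable _ _ _ mu _ _ (cst 0%E)) => //.
      by move=> t; rewrite inE => /z /= ->.
    exact: integrable0.
  rewrite (@eq_Rintegral _ _ _ mu _ (fun=> 0)); last by move=> t; rewrite inE => /z.
  rewrite Rintegral_cst // mul0r logp_eq0 //.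
  by rewrite divr_ge0 ?(ltW a0) ?(ltW r0) //= ler_pdivrMr // mul1r.
have subs : `]al, r] `<=` `[0, r]%classic.
  by move=> t /=; rewrite !in_itv /= => /andP[at_ ->]; rewrite andbT ltW // (lt_trans a0).
have sE : {in `[0, r]%classic, ((fun t : R => t^-1) \_ `]al, r]) =1 step al}.
  move=> t; rewrite inE /= in_itv /= => /andP[t0 tr]; rewrite /patch /step mem_setE.
  by rewrite in_itv /= tr andbT.
have iI : mu.-integrable `]al, r] (EFin \o (fun t : R => t^-1)).
  apply: (@integrableS _ _ _ mu `[al, r]) => //.
    by move=> t /=; rewrite !in_itv /= => /andP[/ltW -> ->].
  by apply: itv_integrable; exact: itv_cont_inv.
have I0 : `[0, r] `&` `]al, r] = `]al, r]%classic by apply: setIidr.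
split.
  apply: (@eq_integrable _ _ _ mu _ _ ((EFin \o (fun t : R => t^-1)) \_ `]al, r])) => //.
    by move=> t /sE; rewrite /patch /=; case: ifP => _ <-.
  apply/(@integrable_restrict _ _ _ mu `]al, r]) => //; by rewrite I0.
transitivity (\int[mu]_(t in `[0, r]) ((fun t : R => t^-1) \_ `]al, r]) t).
  by apply: eq_Rintegral => t /sE.
rewrite -Rintegral_mkcondr I0 (Rintegral_itv_obnd_cbnd iI).
rewrite -/(itv_int _ al r) itv_int_inv ?(ltW ar) // logp_id; last first.
  by rewrite ler_pdivlMr // mul1r ltW.
by rewrite lnM ?lnV ?posrE ?invr_gt0.
Qed.

Let sum_int (S : seq C) (w : C -> nat) r : 0 < r ->
  mu.-integrable `[0, r] (EFin \o (fun t => \sum_(a <- S | a != 0) (w a)%:R * step (nc a) t)) /\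
  \int[mu]_(t in `[0, r]) (\sum_(a <- S | a != 0) (w a)%:R * step (nc a) t) =
   \sum_(a <- S | a != 0) (w a)%:R * logp (r / nc a).
Proof.
move=> r0; elim: S => [|a S [IH1 IH2]].
  split.
    apply: (@eq_integrable _ _ _ mu _ _ (cst 0%E)) => //.
      by move=> t _ /=; rewrite big_nil.
    exact: integrable0.
  rewrite big_nil (@eq_Rintegral _ _ _ mu _ (fun=> 0)).
    by rewrite Rintegral_cst // mul0r.
  by move=> t _; rewrite big_nil.
have [->|a0] := eqVneq a 0.
  rewrite big_cons eqxx -IH2; split.
    apply: (@eq_integrable _ _ _ mu _ _ _ _ _ IH1) => //.
    by move=> t _ /=; rewrite big_cons eqxx.
  by apply: eq_Rintegral => t _; rewrite big_cons eqxx.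
have n0 : 0 < nc a by rewrite nc_gt0.
have [s1 s2] := step_int n0 r0.
have wi : mu.-integrable `[0, r] (EFin \o (fun t => (w a)%:R * step (nc a) t)).
  have := @integrableZl _ _ _ mu `[0, r] (measurable_itv _) (w a)%:R _ s1.
  by apply: eq_integrable => // t _ /=; rewrite EFinM.
have E t : (\sum_(b <- a :: S | b != 0) (w b)%:R * step (nc b) t) =
    (w a)%:R * step (nc a) t + \sum_(b <- S | b != 0) (w b)%:R * step (nc b) t.
  by rewrite big_cons a0.
split.
  have := @integrableD _ _ _ mu `[0, r] (measurable_itv _) _ _ wi IH1.
  by apply: eq_integrable => // t _ /=; rewrite E EFinD.
rewrite big_cons a0 -IH2 -s2 -RintegralZl // -RintegralD //.
by apply: eq_Rintegral => t _; rewrite E.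
Qed.

(** The integrated counting function as a finite sum. Since [logp] vanishes for points of modulus at
    least [r], any list containing the relevant points inside the disc gives the same value, see
    [Nsum_ext]. *)
Definition Nsum (w : C -> nat) (S : seq C) r : R :=
  \sum_(a <- S | a != 0) (w a)%:R * logp (r / nc a) + (w 0)%:R * ln r.

Section PoleCounting.
Variables (f : C -> C) (pm : C -> nat).
Hypothesis pE : forall a, pole_mult f a = pm a.

Lemma nev_nE (S : seq C) r t : uniq S -> (forall a, pm a != 0%N -> nc a < r -> a \in S) ->
  t <= r -> nev_n t f = \sum_(a <- S) (pm a)%:R * (nc a < t)%R%:R.
Proof.
move=> uS hS tr.
rewrite /nev_n -[LHS](@fsbig_widen _ _ _ _ [set` [seq a <- S | nc a < t]]).
- rewrite -fsbig_seq ?filter_uniq // big_filter big_mkcond /=; apply: eq_bigr => a _.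
  by rewrite pE; case: (nc a < t); rewrite ?mulr1 ?mulr0.
- by move=> a /=; rewrite mem_filter => /andP[].
- move=> a [/= at_ /negP]; rewrite mem_filter at_ /= => aS; rewrite pE.
  have [-> //|p0] := eqVneq (pm a) 0%N.
  by rewrite hS ?(lt_le_trans at_) in aS.
Qed.

Lemma nev_NE (S : seq C) r s : uniq S -> (forall a, pm a != 0%N -> nc a < s -> a \in S) ->
  0 < r -> r <= s -> nev_N r f = Nsum pm S r.
Proof.
move=> uS hS r0 rs; rewrite /nev_N /Nsum pE; congr (_ + _).
have [_ <-] := sum_int S pm r0; apply: eq_Rintegral => t; rewrite inE /= in_itv /= => /andP[t0 tr].
have [->|tn0] := eqVneq t 0.
  (* With [0^-1 = 0] both integrands vanish at [t = 0]. *)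
  rewrite invr0 mulr0 big1 // => a _; rewrite /step invr0; case: ifP => _; exact: mulr0.
have tp : 0 < t by rewrite lt_neqAle eq_sym tn0.
rewrite (nev_nE uS hS (le_trans tr rs)).
have -> : \sum_(a <- S) (pm a)%:R * (nc a < t)%R%:R =
    \sum_(a <- S | a != 0) (pm a)%:R * (nc a < t)%R%:R + (pm 0)%:R :> R.
  have [S0|S0] := boolP (0 \in S).
    have tt : (nc (0 : C) < t)%R%:R = 1 :> R by rewrite nc0 tp.
    by rewrite (bigD1_seq 0 S0 uS) tt (mulr1 (pm 0)%:R); exact: addrC.
  have -> : pm 0 = 0%N.
    apply/eqP/negPn/negP => p0; move: S0; rewrite hS //.
    by rewrite nc0 (lt_le_trans r0).
  rewrite addr0 big_seq_cond [RHS]big_seq_cond; apply: eq_bigl => a.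
  by case aS: (a \in S) => //=; apply/esym/eqP => e; rewrite -e aS in S0.
rewrite addrK mulr_suml; apply: eq_bigr => a _; rewrite /step -mulrA.
by case: (nc a < t); rewrite ?mul1r ?mul0r.
Qed.

End PoleCounting.
End CountingFunction.

(** * Blaschke factorization *)

Section LogMeans.
Context {R : realType}.
Local Notation C := (R[i]^o).
Local Notation nc := (@Normc.normc R).
Implicit Types (u : C -> R) (g h : C -> C) (r s : R) (a z : C).

Lemma cont_ln_nc g z : cont_at g z -> g z != 0 -> cont_at (fun z => ln (nc (g z))) z.
Proof. by move=> cg g0; apply: rcont_ln; [rewrite nc_gt0|exact: cont_nc]. Qed.

Lemma cont_lin (c : C) a z : cont_at (fun z => c * z - a) z.
Proof.
apply: ccontB; last exact: ccont_cst.
by apply: ccontM; [exact: ccont_cst|exact: ccont_id].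
Qed.

(* The denominator of the Blaschke factor of [a] for the disc of radius [r],
   normalised to be [1] at the origin. *)
Definition bden r a z : C := ((r ^+ 2)%:C - a^* * z) / (r ^+ 2)%:C.

(* Minus the logarithm of the modulus of the Blaschke factor of [a]. *)
Definition blog r a z : R := ln (nc (bden r a z)) - ln (nc (z - a) / r).

Lemma sqrC_neq0 r : 0 < r -> (r ^+ 2)%:C != 0 :> C.
Proof. by move=> r0; rewrite -nc_gt0 nc_real normr_gt0 expf_neq0 // gt_eqF. Qed.

Lemma bden0 r a : 0 < r -> bden r a 0 = 1.
Proof. by move=> r0; rewrite /bden mulr0 subr0 divff // sqrC_neq0. Qed.

Lemma bden_center r z : 0 < r -> bden r 0 z = 1.
Proof.
move=> r0; have -> : bden r 0 z = (r ^+ 2)%:C / (r ^+ 2)%:C.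
  by rewrite /bden (rmorph0 (@conjc R)) mul0r subr0.
by rewrite divff // sqrC_neq0.
Qed.

Lemma bden_cdiff r a z : cdiff (bden r a) z.
Proof.
apply: cdiffM; last exact: cdiff_cst.
apply: cdiffB; first exact: cdiff_cst.
by apply: cdiffM; [exact: cdiff_cst|exact: cdiff_id].
Qed.

Lemma bden_neq0 r a z : 0 < r -> nc a < r -> nc z < 2 * r ^+ 2 / (r + nc a) ->
  bden r a z != 0.
Proof.
by move=> r0 ar zr; rewrite mulf_neq0 ?invr_eq0 ?sqrC_neq0 // cauchyJ_den_neq0.
Qed.

(** On the circle [r ^+ 2 - a^* * z] equals [z] times the conjugate of [z - a]: the Blaschke factor
    has modulus one. *)
Lemma bden_circle r a z : 0 < r -> nc z = r -> nc (bden r a z) = nc (z - a) / r.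
Proof.
move=> r0 zr; rewrite /bden ncM ncV nc_real ger0_norm ?sqr_ge0 //.
have -> : (r ^+ 2)%:C - a^* * z = z * (z - a)^*.
  by rewrite -zr -mulJc (rmorphB (@conjc R)); ring.
by rewrite ncM ncJ zr; field; rewrite gt_eqF.
Qed.

Lemma nc_bden_bounds r a z : 0 < r -> nc a < r -> nc z <= r / 2 ->
  1 / 2 <= nc (bden r a z) <= 2.
Proof.
move=> r0 ar zr.
have -> : bden r a z = 1 - a^* * z / (r ^+ 2)%:C.
  by rewrite /bden mulrBl divff // sqrC_neq0.
have h : nc (a^* * z / (r ^+ 2)%:C) <= 1 / 2.
  rewrite ncM ncM ncV ncJ nc_real ger0_norm ?sqr_ge0 // ler_pdivrMr ?exprn_gt0 //.
  apply: le_trans (ler_pM (nc_ge0 _) (nc_ge0 _) (ltW ar) zr) _; nra.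
have h1 := nc_sub_ge 1 (a^* * z / (r ^+ 2)%:C).
have h2 := ncB_le 1 (a^* * z / (r ^+ 2)%:C).
by rewrite nc1 in h1 h2; lra.
Qed.

(** From the identity [|r^2 - a^* z|^2 - r^2 |z - a|^2 = (r^2 - |a|^2) (r^2 - |z|^2)]. *)
Lemma blaschke_le1 r a z : 0 < r -> nc a <= r -> nc z <= r ->
  nc (z - a) / r <= nc (bden r a z).
Proof.
move=> r0 ar zr; rewrite /bden ncM ncV nc_real ger0_norm ?sqr_ge0 //.
have -> : nc (z - a) / r = (r * nc (z - a)) / r ^+ 2 by field; rewrite gt_eqF.
rewrite ler_wpM2r ?invr_ge0 ?sqr_ge0 //.
rewrite -(@ler_pXn2r _ 2) ?nnegrE ?mulr_ge0 ?nc_ge0 ?(ltW r0) //.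
have n1 : nc a ^+ 2 <= r ^+ 2 by rewrite ler_pXn2r ?nnegrE ?nc_ge0 ?(ltW r0).
have n2 : nc z ^+ 2 <= r ^+ 2 by rewrite ler_pXn2r ?nnegrE ?nc_ge0 ?(ltW r0).
rewrite exprMn !sqr_nc; move: n1 n2; rewrite !sqr_nc.
case: a {ar} => a1 a2; case: z {zr} => z1 z2 /=.
set A := a1 ^+ 2 + a2 ^+ 2; set Z := z1 ^+ 2 + z2 ^+ 2 => n1 n2.
rewrite -subr_ge0; apply: le_trans (mulr_ge0 (_ : 0 <= r ^+ 2 - A) (_ : 0 <= r ^+ 2 - Z)) _.
- by rewrite subr_ge0.
- by rewrite subr_ge0.
by rewrite /A /Z le_eqVlt; apply/orP; left; apply/eqP; ring.
Qed.

(** For [nc a > r] the function [z - a] has no zero in a disc beyond the circle. For [nc a < r] it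
    has on the circle the modulus of [r] times [bden r a], which is zero-free on a larger disc and
    equals [1] at the origin. *)
Lemma mean_ln_sub a r : 0 < r -> nc a != r ->
  cmean (fun z => ln (nc (z - a))) r = ln (Num.max r (nc a)).
Proof.
move=> r0 ar; have [ra|ra] := ltrP r (nc a).
  rewrite (@mean_ln _ (fun z => z - a) r (nc a)) ?ra ?(ltW r0) ?sub0r ?ncN //.
  move=> z za; split; first by apply: cdiffB; [exact: cdiff_id|exact: cdiff_cst].
  by rewrite subr_eq0; apply/eqP => e; move: za; rewrite e ltxx.
have {}ra : nc a < r by rewrite lt_neqAle ar.
have rR := cauchyJ_radius r0 ra.
have bn z : nc z = r -> bden r a z != 0 by move=> zr; apply: bden_neq0; rewrite ?zr.
rewrite (@eq_cmean _ _ (fun z => ln (nc (bden r a z)) + ln r)) ?(ltW r0) //.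
  have cc : circ_cont (fun z => ln (nc (bden r a z))) r.
    by move=> z zr; apply: cont_ln_nc (bn z zr); apply: cdiff_cont; exact: bden_cdiff.
  rewrite cmeanD ?(ltW r0) //; last exact: circ_cont_cst.
  rewrite cmean_cst (@mean_ln _ _ r (2 * r ^+ 2 / (r + nc a))) ?(ltW r0) //.
    by rewrite bden0 // nc1 ln1 add0r.
  by move=> z zR; split; [exact: bden_cdiff|exact: bden_neq0].
move=> z zr; have za : 0 < nc (z - a).
  by rewrite nc_gt0 subr_eq0; apply/eqP => e; move: ra; rewrite -e zr ltxx.
by rewrite (bden_circle _ r0 zr) -lnM ?posrE ?divr_gt0 // divfK // gt_eqF.
Qed.

Lemma mean_ln_lin (q : C) a r : 0 < r -> q != 0 -> nc a != nc q * r ->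
  cmean (fun z => ln (nc (q * z - a))) r = ln (Num.max (nc q * r) (nc a)).
Proof.
move=> r0 q0 ar; have nq : 0 < nc q by rewrite nc_gt0.
have aq : nc (a / q) != r.
  by rewrite ncM ncV; apply: contra ar => /eqP <-; rewrite mulrC divfK // gt_eqF.
have cc : circ_cont (fun z => ln (nc (z - a / q))) r.
  move=> z zr; apply: cont_ln_nc; first by apply: ccontB; [exact: ccont_id|exact: ccont_cst].
  by rewrite subr_eq0; apply/eqP => e; move: aq; rewrite -e zr eqxx.
rewrite (@eq_cmean _ _ (fun z => ln (nc q) + ln (nc (z - a / q)))) ?(ltW r0) //.
  rewrite cmeanD ?(ltW r0) //; last exact: circ_cont_cst.
  rewrite cmean_cst mean_ln_sub // -lnM ?posrE ?lt_max ?r0 //.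
  by rewrite maxr_pMr ?(ltW nq) // ncM ncV mulrCA divff ?mulr1 // gt_eqF.
move=> z zr; have -> : q * z - a = q * (z - a / q) by field.
rewrite ncM lnM ?posrE ?nc_gt0 // subr_eq0.
by apply/eqP => e; move: aq; rewrite -e zr eqxx.
Qed.

(** Pointwise [|u| <= 2 c - u]. An upper bound and the exact mean thus control the mean of [|u|],
    however deep a logarithmic singularity makes [u] fall. *)
Lemma cmean_abs_le u r c : 0 <= r -> circ_cont u r -> 0 <= c ->
  (forall z, nc z = r -> u z <= c) -> cmean (fun z => `|u z|) r <= 2 * c - cmean u r.
Proof.
move=> r0 cu c0 h.
rewrite -[X in X - _](cmean_cst r) -cmeanB //; last exact: circ_cont_cst.
apply: le_cmean => //; first exact: circ_cont_norm.
  by apply: circ_contB => //; exact: circ_cont_cst.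
by move=> z /h uc; have [u0|u0] := lerP 0 (u z); [rewrite ger0_norm|rewrite ltr0_norm]; lra.
Qed.

End LogMeans.

Section Nevanlinna.
Context {R : realType}.
Local Notation C := (R[i]^o).
Local Notation nc := (@Normc.normc R).
Implicit Types (g h : C -> C) (r s : R) (a z : C) (S : seq C).

Section Nsum.
Variable w : C -> nat.

Lemma Nsum_ext S S' r : 0 < r -> uniq S -> uniq S' ->
  (forall a, w a != 0%N -> nc a < r -> a \in S) ->
  (forall a, w a != 0%N -> nc a < r -> a \in S') -> Nsum w S r = Nsum w S' r.
Proof.
move=> r0 uS uS' hS hS'; congr (_ + _).
have red T : \sum_(a <- T | a != 0) (w a)%:R * logp (r / nc a) =
    \sum_(a <- [seq a <- T | (w a != 0%N) && (nc a < r)] | a != 0) (w a)%:R * logp (r / nc a).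
  rewrite big_filter_cond [LHS]big_mkcond [RHS]big_mkcond /=; apply: eq_bigr => a _.
  have [->|a0] := eqVneq a 0; first by rewrite andbF.
  rewrite andbT; have [->|w0] //= := eqVneq (w a) 0%N; first by rewrite mul0r.
  have [//|ra] := ltrP (nc a) r; rewrite logp_eq0 ?mulr0 //.
  have n0 : 0 < nc a by rewrite nc_gt0.
  by rewrite divr_ge0 ?(ltW r0) ?(ltW n0) //= ler_pdivrMr // mul1r.
rewrite red [RHS]red; apply: perm_big; apply: uniq_perm; try exact: filter_uniq.
move=> a; rewrite !mem_filter.
by case w0: (w a != 0%N) => //=; case ar: (nc a < r) => //=; rewrite hS // hS'.
Qed.

Lemma Nsum_ge0 S r : 1 <= r -> 0 <= Nsum w S r.
Proof.
move=> r1; rewrite addr_ge0 ?mulr_ge0 ?ln_ge0 //.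
by apply: sumr_ge0 => a _; rewrite mulr_ge0 // logp_ge0.
Qed.

Lemma Nsum_le S r s : 1 <= r -> r <= s -> Nsum w S r <= Nsum w S s.
Proof.
move=> r1 rs; have r0 : 0 < r by exact: lt_le_trans r1.
apply: lerD; last by rewrite ler_wpM2l // ler_ln ?posrE // (lt_le_trans r0).
apply: ler_sum => a a0; rewrite ler_wpM2l // le_logp ?divr_ge0 ?nc_ge0 ?(ltW r0) //.
by rewrite ler_wpM2r ?invr_ge0 ?nc_ge0.
Qed.

Lemma sum_le_Nsum S r (G : C -> R) : uniq S -> 1 <= r ->
  (forall a, a \in S -> a != 0 -> G a <= logp (r / nc a)) -> G 0 <= ln r ->
  \sum_(a <- S) (w a)%:R * G a <= Nsum w S r.
Proof.
move=> uS r1 hG h0; rewrite (bigID (fun a => a != 0)) /=; apply: lerD.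
  rewrite big_seq_cond [leRHS]big_seq_cond; apply: ler_sum => a /andP[aS a0].
  by rewrite ler_wpM2l // hG.
rewrite (eq_bigl (fun a => a == 0)); last by move=> a; rewrite negbK.
have [S0|S0] := boolP (0 \in S).
  by rewrite -big_filter filter_pred1_uniq // big_seq1 ler_wpM2l.
rewrite big_seq_cond big1; first by rewrite mulr_ge0 // ln_ge0.
by move=> a /andP[aS /eqP a0]; rewrite -a0 aS in S0.
Qed.

(** Each point of modulus below [r] contributes at least [ln (s / r)] to the count at [s]; for the
    origin, which contributes [ln s], this uses [r >= 1]. *)
Lemma count_le_Nsum S S' r s : uniq S -> uniq S' -> {subset S <= S'} ->
  (forall a, a \in S -> nc a < r) -> 1 <= r -> r <= s ->
  (\sum_(a <- S) (w a)%:R) * ln (s / r) <= Nsum w S' s.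
Proof.
move=> uS uS' SS hS r1 rs; have r0 : 0 < r by exact: lt_le_trans r1.
have s0 : 0 < s by exact: lt_le_trans rs.
have sr1 : 1 <= s / r by rewrite ler_pdivlMr // mul1r.
have l0 : 0 <= ln (s / r) by rewrite ln_ge0.
pose G a : R := if a \in S then ln (s / r) else 0.
have sr : ln (s / r) <= ln s.
  by rewrite ler_ln ?posrE ?divr_gt0 // ler_pdivrMr // ler_peMr // ltW.
have -> : (\sum_(a <- S) (w a)%:R) * ln (s / r) = \sum_(a <- S') (w a)%:R * G a.
  rewrite mulr_suml [RHS](eq_bigr (fun a => if a \in S then (w a)%:R * ln (s / r) else 0)).
    rewrite -[RHS]big_mkcond -[RHS]big_filter; apply: perm_big; apply: uniq_perm => //.
      exact: filter_uniq.
    by move=> a; rewrite mem_filter andb_idr // => /SS.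
  by move=> a _; rewrite /G; case: ifP; rewrite ?mulr0.
apply: sum_le_Nsum => //; first exact: le_trans rs.
  move=> a _ a0; rewrite /G; case: ifP => aS; last exact: logp_ge0.
  apply: le_trans (ln_le_logp _); rewrite ler_ln ?posrE ?divr_gt0 ?nc_gt0 //.
  by rewrite ler_wpM2l ?(ltW s0) // lef_pV2 ?posrE ?nc_gt0 // ltW // hS.
by rewrite /G; case: ifP => // _; exact: le_trans sr.
Qed.

End Nsum.

Variables (f : C -> C) (zm pm : C -> nat).
Hypothesis D : divisor_spec f zm pm.

Let w a := (zm a + pm a)%N.
Let d a : R := (zm a)%:R - (pm a)%:R.

(** Every [blog r a] vanishes on the circle of radius [r], so [h] and [f] have the same modulus
    there. This is the advantage over the plain factors of [div_factor]. *)
Definition blaschke_data r S h r' := [/\ r < r', uniq S,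
    forall a, (a \in S) = ((zm a + pm a)%N != 0%N) && (nc a < r),
    forall z, nc z < r' -> cdiff h z /\ h z != 0 &
    forall z, nc z < r' -> z \notin S -> [/\ cdiff f z, f z != 0 &
      ln (nc (f z)) = ln (nc (h z)) - \sum_(a <- S) ((zm a)%:R - (pm a)%:R) * blog r a z]].

Definition generic r := forall a, (zm a + pm a)%N != 0%N -> nc a != r.

Lemma ln_ncM (x y : C) : x != 0 -> y != 0 -> ln (nc (x * y)) = ln (nc x) + ln (nc y).
Proof. by move=> x0 y0; rewrite ncM lnM // posrE nc_gt0. Qed.

Lemma ln_prod_nc (I : eqType) (T : seq I) (F : I -> C) : (forall i, i \in T -> F i != 0) ->
  ln (nc (\prod_(i <- T) F i)) = \sum_(i <- T) ln (nc (F i)).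
Proof.
elim: T => [|i T IH] h; first by rewrite !big_nil nc1 ln1.
rewrite !big_cons ncM lnM ?posrE ?nc_gt0; first last.
- rewrite big_seq; apply: (big_ind (fun x : C => x != 0)) => [|x y|j jT].
  + exact: oner_neq0.
  + exact: mulf_neq0.
  + by apply: h; rewrite in_cons jT orbT.
- by apply: h; rewrite mem_head.
by rewrite IH // => j jT; apply: h; rewrite in_cons jT orbT.
Qed.

Lemma ln_expf_div (x : C) m p : x != 0 ->
  ln (nc (x ^+ m / x ^+ p)) = (m%:R - p%:R) * ln (nc x).
Proof.
move=> x0; have n0 : 0 < nc x by rewrite nc_gt0.
rewrite ncM ncV !ncX lnM ?lnV ?posrE ?invr_gt0 ?exprn_gt0 // !lnXn //.
by rewrite mulrBl !mulr_natl.
Qed.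

Lemma blaschke_factorization r : 0 < r -> generic r ->
  exists S h r', blaschke_data r S h r'.
Proof.
move=> r0 gr; have rC : r%:C != 0 :> C by rewrite -nc_gt0 nc_real normr_gt0 gt_eqF.
have [S [h [r1 [rr1 uS hS hh fh]]]] := div_factor D rC r0 gr.
have Sr a : a \in S -> nc a < r by rewrite hS => /andP[].
have [r2 [rr2 hr2]] : exists r2, r < r2 /\ forall a, a \in S -> r2 <= 2 * r ^+ 2 / (r + nc a).
  elim: (S) Sr => [|a T IH] hT; first by exists (r + 1); rewrite ltrDl.
  have [|r2 [h1 h2]] := IH; first by move=> b bT; apply: hT; rewrite in_cons bT orbT.
  exists (Num.min r2 (2 * r ^+ 2 / (r + nc a))); split.
    by rewrite lt_min h1 cauchyJ_radius // hT // mem_head.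
  move=> b; rewrite in_cons => /orP[/eqP ->|/h2 hb]; first by rewrite ge_min lexx orbT.
  by rewrite ge_min hb.
(* The denominators of the Blaschke factors are absorbed into [h]; they have no zeros in the disc of
   radius [r2]. *)
pose P z := \prod_(a <- S) (bden r a z ^+ zm a / bden r a z ^+ pm a).
have b0 a z : a \in S -> nc z < r2 -> bden r a z != 0.
  by move=> aS zr; apply: bden_neq0 => //; [exact: Sr|exact: lt_le_trans (hr2 _ aS)].
have bb a z : a \in S -> nc z < r2 -> bden r a z ^+ zm a / bden r a z ^+ pm a != 0.
  by move=> aS /(b0 _ _ aS) n0; rewrite mulf_neq0 ?invr_eq0 // expf_neq0.
have P0 z : nc z < r2 -> P z != 0.
  move=> zr; rewrite /P big_seq; apply: (big_ind (fun x : C => x != 0)) => [|x y|a aS].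
  - exact: oner_neq0.
  - exact: mulf_neq0.
  - exact: bb.
exists S, (fun z => h z * P z), (Num.min r1 r2); split => //.
- by rewrite lt_min rr1.
- move=> z; rewrite lt_min => /andP[z1 z2]; have [dh h0] := hh z z1.
  split; last by rewrite mulf_neq0 // P0.
  apply: cdiffM => //; rewrite /P; under [X in cdiff X]eq_fun do rewrite big_seq.
  apply: cdiff_prod => a aS; apply: cdiff_div.
  - by rewrite expf_neq0 // b0.
  - by apply: cdiffX; exact: bden_cdiff.
  - by apply: cdiffX; exact: bden_cdiff.
move=> z; rewrite lt_min => /andP[z1 z2] zS.
have za a : a \in S -> z != a by move=> aS; apply/eqP => e; move: zS; rewrite e aS.
have zac a : a \in S -> (z - a) / r%:C != 0.
  by move=> /za h1; rewrite mulf_neq0 ?subr_eq0 // invr_eq0.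
have [dh h0] := hh z z1.
have n0 a : a \in S -> ((z - a) / r%:C) ^+ zm a / ((z - a) / r%:C) ^+ pm a != 0.
  by move=> /zac h1; rewrite mulf_neq0 ?invr_eq0 // expf_neq0.
have Q0 : \prod_(a <- S) (((z - a) / r%:C) ^+ zm a / ((z - a) / r%:C) ^+ pm a) != 0.
  rewrite big_seq; apply: (big_ind (fun x : C => x != 0)) => [|x y|a aS].
  - exact: oner_neq0.
  - exact: mulf_neq0.
  - exact: n0.
have f0 : f z != 0 by rewrite fh // mulf_neq0.
split => //.
  have e : forall a, a \in S -> \forall x \near z, x != a.
    move=> a /za ne; apply/nbhsCP; exists (nc (z - a)); first by rewrite nc_gt0 subr_eq0.
    by move=> x hx; apply/eqP => e; move: hx; rewrite e ncB ltxx.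
  have {e}: \forall x \near z, x \notin S.
    elim: (S) e => [|a T IH] e; first by apply: filterE.
    have h1 := e a (mem_head _ _).
    have h2 : \forall x \near z, x \notin T.
      by apply: IH => b bT; apply: e; rewrite in_cons bT orbT.
    by apply: filterS2 h1 h2 => x x1 x2; rewrite in_cons negb_or x1.
  move=> e; apply: (@cdiff_near _ _ (fun x => h x *
     \prod_(a <- S) (((x - a) / r%:C) ^+ zm a / ((x - a) / r%:C) ^+ pm a))).
    have e2 : \forall x \near z, nc x < r1.
      apply/nbhsCP; exists (r1 - nc z); first by rewrite subr_gt0.
      by move=> x hx; have := nc_sub_ge x z; lra.
    by apply: filterS2 e e2 => x x1 x2; exact: fh.
  apply: cdiffM => //; under [X in cdiff X]eq_fun do rewrite big_seq.
  apply: cdiff_prod => a aS.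
  have dl : cdiff (fun x => (x - a) / r%:C) z.
    apply: cdiffM; last exact: cdiff_cst.
    by apply: cdiffB; [exact: cdiff_id|exact: cdiff_cst].
  by apply: cdiff_div; [rewrite expf_neq0 // zac|exact: cdiffX|exact: cdiffX].
have Pz0 := P0 z z2.
have -> := etrans (congr1 (fun x => ln (nc x)) (fh z z1 zS)) (ln_ncM h0 Q0).
rewrite [X in _ = X - _](ln_ncM h0 Pz0) -addrA; congr (_ + _).
apply: etrans (ln_prod_nc n0) _.
rewrite [X in _ = X - _](ln_prod_nc (fun a aS => bb a z aS z2)).
rewrite -sumrB; rewrite big_seq [RHS]big_seq; apply: eq_bigr => a aS.
rewrite !ln_expf_div ?zac ?b0 // /blog ncM ncV nc_real gtr0_norm // /d.
by ring.
Qed.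

End Nevanlinna.

(** * Jensen's formula *)

Section Estimates.
Context {R : realType}.
Local Notation C := (R[i]^o).
Local Notation nc := (@Normc.normc R).
Implicit Types (h : C -> C) (r s : R) (a z : C) (S : seq C).

Lemma cont_logp (u : C -> R) z : 0 < u z -> cont_at u z -> cont_at (fun z => logp (u z)) z.
Proof. by move=> u0 cu; apply: rcont_max0; exact: rcont_ln. Qed.

Lemma blog_ge0 r a z : 0 < r -> nc a < r -> nc z < r -> z != a -> 0 <= blog r a z.
Proof.
move=> r0 ar zr za.
have n0 : 0 < nc (z - a) / r by rewrite divr_gt0 // nc_gt0 subr_eq0.
have le := blaschke_le1 r0 (ltW ar) (ltW zr).
by rewrite subr_ge0 ler_ln // posrE (lt_le_trans n0).
Qed.

Lemma blog_cont r a z : 0 < r -> nc a < r -> nc z < r -> z != a -> cont_at (blog r a) z.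
Proof.
move=> r0 ar zr za.
have za0 : z - a != 0 by rewrite subr_eq0.
apply: rcontB.
  apply: cont_ln_nc; first by apply: cdiff_cont; exact: bden_cdiff.
  by apply: bden_neq0 => //; apply: lt_trans zr _; exact: cauchyJ_radius.
apply: rcont_ln; first by rewrite divr_gt0 // nc_gt0.
apply: rcontM; last exact: rcont_cst.
by apply: cont_nc; apply: ccontB; [exact: ccont_id|exact: ccont_cst].
Qed.

Lemma mean_ln_bden r a s : 0 < r -> nc a < r -> 0 <= s < r ->
  cmean (fun z => ln (nc (bden r a z))) s = 0.
Proof.
move=> r0 ar /andP[s0 sr]; rewrite (@mean_ln _ _ s r) ?s0 ?bden0 ?nc1 ?ln1 //.
move=> z zr; split; first exact: bden_cdiff.
by apply: bden_neq0 => //; apply: lt_trans zr _; exact: cauchyJ_radius.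
Qed.

(** The denominator has mean logarithm [0], being [1] at the origin. For [s >= 1] the result is at
    most what [a] contributes to the counting function at [r]. *)
Lemma mean_blog r a s : 0 < s -> s < r -> nc a < r -> nc a != s ->
  cmean (blog r a) s = ln (r / Num.max s (nc a)).
Proof.
move=> s0 sr ar as_; have r0 := lt_trans s0 sr.
have za z : nc z = s -> z - a != 0.
  by move=> zs; rewrite subr_eq0; apply/eqP => e; move: as_; rewrite -e zs eqxx.
have c1 : circ_cont (fun z => ln (nc (bden r a z))) s.
  move=> z zs; apply: cont_ln_nc; first by apply: cdiff_cont; exact: bden_cdiff.
  by apply: bden_neq0 => //; rewrite zs (lt_trans sr) // cauchyJ_radius.
have c2 : circ_cont (fun z => ln (nc (z - a))) s.
  move=> z zs; apply: cont_ln_nc; last exact: za.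
  by apply: ccontB; [exact: ccont_id|exact: ccont_cst].
have c3 : circ_cont (fun z => ln (nc (z - a)) - ln r) s.
  by apply: circ_contB => //; exact: circ_cont_cst.
have M0 : 0 < Num.max s (nc a) by rewrite lt_max s0.
rewrite (@eq_cmean _ _ (fun z => ln (nc (bden r a z)) - (ln (nc (z - a)) - ln r))) ?(ltW s0) //.
  rewrite cmeanB ?(ltW s0) // mean_ln_bden ?(ltW s0) // sub0r.
  rewrite cmeanB ?(ltW s0) //; last exact: circ_cont_cst.
  rewrite cmean_cst mean_ln_sub // opprB lnM ?lnV ?posrE ?invr_gt0 //.
by move=> z zs; rewrite /blog lnM ?lnV ?posrE ?invr_gt0 ?nc_gt0 ?za.
Qed.

(** Dividing by [Num.max s (nc a)] makes the mean of the logarithm exactly [0], while the logarithm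
    is at most [ln 2]. The bound of [cmean_abs_le] is therefore uniform in [a]. *)
Lemma mean_abs_ln_sub a s : 0 < s -> nc a != s ->
  cmean (fun z => `|ln (nc (z - a) / Num.max s (nc a))|) s <= 2 * ln 2.
Proof.
move=> s0 as_; set M := Num.max s (nc a).
have M0 : 0 < M by rewrite lt_max s0.
have za z : nc z = s -> 0 < nc (z - a).
  by move=> zs; rewrite nc_gt0 subr_eq0; apply/eqP => e; move: as_; rewrite -e zs eqxx.
have c2 : circ_cont (fun z => ln (nc (z - a))) s.
  move=> z zs; apply: cont_ln_nc; last by rewrite -nc_gt0 za.
  by apply: ccontB; [exact: ccont_id|exact: ccont_cst].
have c3 : circ_cont (fun z => ln (nc (z - a)) - ln M) s.
  by apply: circ_contB => //; exact: circ_cont_cst.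
have e : cmean (fun z => ln (nc (z - a)) - ln M) s = 0.
  by rewrite cmeanB ?(ltW s0) ?cmean_cst ?mean_ln_sub ?subrr //; exact: circ_cont_cst.
rewrite (@eq_cmean _ _ (fun z => `|ln (nc (z - a)) - ln M|)) ?(ltW s0) //; last first.
  by move=> z zs; rewrite lnM ?lnV ?posrE ?invr_gt0 ?za.
rewrite -[leRHS]subr0 -e; apply: cmean_abs_le => //; first exact: ltW.
  by rewrite ln_ge0 // ler1n.
move=> z zs; rewrite lerBlDr -lnM ?posrE // ler_ln ?posrE ?za ?mulr_gt0 //.
apply: le_trans (ncB_le _ _) _; rewrite zs mulr_natl mulr2n lerD // /M le_max lexx ?orbT //.
Qed.

(** The same normaliser as without [q], so that the two cancel when subtracted. The mean of the
    logarithm is now at least [ln (nc q)], which accounts for the extra term. *)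
Lemma mean_abs_ln_lin (q : C) a s : 0 < s -> q != 0 -> nc q < 1 -> nc a != nc q * s ->
  cmean (fun z => `|ln (nc (q * z - a) / Num.max s (nc a))|) s <= 2 * ln 2 - ln (nc q).
Proof.
move=> s0 q0 q1 as_; set M := Num.max s (nc a).
have nq : 0 < nc q by rewrite nc_gt0.
have M0 : 0 < M by rewrite lt_max s0.
have za z : nc z = s -> 0 < nc (q * z - a).
  move=> zs; rewrite nc_gt0 subr_eq0; apply/eqP => e.
  by move: as_; rewrite -e ncM zs eqxx.
have c2 : circ_cont (fun z => ln (nc (q * z - a))) s.
  by move=> z zs; apply: cont_ln_nc; [exact: cont_lin|rewrite -nc_gt0 za].
have c3 : circ_cont (fun z => ln (nc (q * z - a)) - ln M) s.
  by apply: circ_contB => //; exact: circ_cont_cst.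
have e : ln (nc q) <= cmean (fun z => ln (nc (q * z - a)) - ln M) s.
  rewrite cmeanB ?(ltW s0) ?cmean_cst ?mean_ln_lin //; last exact: circ_cont_cst.
  rewrite lerBrDr -lnM ?posrE // ler_ln ?posrE ?mulr_gt0 ?lt_max ?mulr_gt0 ?s0 //.
  rewrite /M maxr_pMr ?(ltW nq) // ge_max !le_max lexx /=; apply/orP; right.
  by rewrite ler_piMl ?nc_ge0 // ltW.
rewrite (@eq_cmean _ _ (fun z => `|ln (nc (q * z - a)) - ln M|)) ?(ltW s0) //; last first.
  by move=> z zs; rewrite lnM ?lnV ?posrE ?invr_gt0 ?za.
apply: (@le_trans _ _ (2 * ln 2 - cmean (fun z => ln (nc (q * z - a)) - ln M) s)).
  apply: cmean_abs_le => //; first exact: ltW.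
    by rewrite ln_ge0 // ler1n.
  move=> z zs; rewrite lerBlDr -lnM ?posrE // ler_ln ?posrE ?za ?mulr_gt0 //.
  apply: le_trans (ncB_le _ _) _; rewrite ncM zs mulr_natl mulr2n lerD // /M le_max ?lexx ?orbT //.
  by rewrite ler_piMl ?(ltW s0) ?(ltW q1).
by rewrite lerD2l lerN2.
Qed.

Variables (f : C -> C) (zm pm : C -> nat).
Hypothesis D : divisor_spec f zm pm.

Let w a := (zm a + pm a)%N.
Let d a : R := (zm a)%:R - (pm a)%:R.

Definition spec_list r : seq C := sval (cid (div_finite D r)).

Lemma spec_list_uniq r : uniq (spec_list r).
Proof. by have [] := svalP (cid (div_finite D r)). Qed.

Lemma mem_spec_list r a : (a \in spec_list r) = ((zm a + pm a)%N != 0%N) && (nc a <= r).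
Proof. by have [_] := svalP (cid (div_finite D r)); exact. Qed.

Let w_zm a : zm a != 0%N -> w a != 0%N.
Proof. by rewrite /w addn_eq0 negb_and => ->. Qed.

Let w_pm a : pm a != 0%N -> w a != 0%N.
Proof. by rewrite /w addn_eq0 negb_and => ->; rewrite orbT. Qed.

Definition NF (u : C -> nat) r : R := Nsum u (spec_list r) r.

Let Nsum_NF (u : C -> nat) S r : (forall a, u a != 0%N -> w a != 0%N) -> 0 < r -> uniq S ->
  (forall a, w a != 0%N -> nc a < r -> a \in S) -> Nsum u S r = NF u r.
Proof.
move=> hu r0 uS hS; apply: Nsum_ext => //; first exact: spec_list_uniq.
  by move=> a /hu; exact: hS.
by move=> a /hu wa ar; rewrite mem_spec_list wa ltW.
Qed.

Let T r := nev_T r f.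
Let m1 r := cmean (fun z => logp (nc (f z))) r.
Let m0 r := cmean (fun z => logp (nc (f z))^-1) r.

Lemma nev_TE r : 0 < r -> nev_T r f = cmean (fun z => logp (nc (f z))) r + NF pm r.
Proof.
move=> r0; rewrite /nev_T (@nev_NE _ f pm (div_pole D) (spec_list r) r r) //.
  exact: spec_list_uniq.
by move=> a /w_pm wa ar; rewrite mem_spec_list wa ltW.
Qed.

Lemma regular_at z : (zm z + pm z)%N == 0%N -> [/\ cont_at f z, f z != 0 & 0 < nc (f z)].
Proof.
by move=> /(div_regular D)[df f0]; rewrite nc_gt0; split => //; exact: cdiff_cont.
Qed.

Lemma generic_circle r z : generic zm pm r -> nc z = r -> (zm z + pm z)%N == 0%N.
Proof.
by move=> gr zr; apply/negPn/negP => wz; have := gr _ wz; rewrite zr eqxx.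
Qed.

Lemma circ_logp r : generic zm pm r -> circ_cont (fun z => logp (nc (f z))) r.
Proof.
move=> gr z zr; have [cf f0 nf] := regular_at (generic_circle gr zr).
by apply: cont_logp => //; exact: cont_nc.
Qed.

Lemma circ_logpV r : generic zm pm r -> circ_cont (fun z => logp (nc (f z))^-1) r.
Proof.
move=> gr z zr; have [cf f0 nf] := regular_at (generic_circle gr zr).
by apply: cont_logp; rewrite ?invr_gt0 //; apply: rcontV; [rewrite gt_eqF|exact: cont_nc].
Qed.

Lemma blaschke_circle r S h r' : 0 < r -> blaschke_data f zm pm r S h r' ->
  forall z, nc z = r -> ln (nc (f z)) = ln (nc (h z)).
Proof.
move=> r0 [rr' _ hS _ hf] z zr.
have zS : z \notin S by rewrite hS zr ltxx andbF.
have [|_ _ ->] := hf z _ zS; first by rewrite zr.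
rewrite big1 ?subr0 // => a _.
by rewrite /blog bden_circle // subrr mulr0.
Qed.

(** Near [0], [ln |f|] is computed from the local form and from the Blaschke factorization. The
    multiples of [ln |z|] cancel, what remains is continuous, and comparison at [0] gives
    [L = ln (nc (g 0))], the same for all [r]. *)
Lemma jensen_constant : exists L : R, forall r S h r', 0 < r -> blaschke_data f zm pm r S h r' ->
  ln (nc (h 0)) = L + NF zm r - NF pm r.
Proof.
have [g [dg g0 fg]] := div_local D 0; have cg := cdiff_cont (nbhs_singleton dg).
exists (ln (nc (g 0))) => r S h r' r0 [rr' uS hS hh hf].
have memS a : w a != 0%N -> nc a < r -> a \in S by move=> wa ar; rewrite hS wa.
rewrite -(@Nsum_NF zm S) // -(@Nsum_NF pm S) //.
have r'0 : nc 0 < r' by rewrite nc0 (lt_trans r0).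
have Sr a : a \in S -> nc a < r by rewrite hS => /andP[].
(* The origin is kept apart: among the [blog r a] only that of [a = 0] is singular at [0], where it
   is [ln r - ln (nc z)]. *)
pose B z := \sum_(a <- S | a != 0) d a * blog r a z.
have sumB z : z != 0 -> nc z < r ->
    \sum_(a <- S) d a * blog r a z = B z + d 0 * (ln r - ln (nc z)).
  move=> z0 zr; have e0 : blog r 0 z = ln r - ln (nc z).
    rewrite /blog bden_center // nc1 ln1 sub0r subr0.
    by rewrite lnM ?lnV ?posrE ?invr_gt0 ?nc_gt0 // opprB.
  have [S0|S0] := boolP (0 \in S).
    by rewrite (bigD1_seq 0 S0 uS) e0; exact: addrC.
  have -> : d 0 = 0.
    have : w 0 == 0%N.
      by apply/negPn/negP => w0; move: S0; rewrite memS // nc0.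
    by rewrite /w addn_eq0 /d => /andP[/eqP -> /eqP ->]; rewrite subrr.
  rewrite mul0r addr0 /B big_seq_cond [RHS]big_seq_cond; apply: eq_bigl => a.
  by case aS: (a \in S) => //=; apply/esym/eqP => e; rewrite -e aS in S0.
have cB : cont_at B 0.
  rewrite /B; elim: (S) Sr => [|a S' IH] Sr.
    suff -> : (fun z => \sum_(b <- [::] | b != 0) d b * blog r b z) = (fun=> 0).
      exact: rcont_cst.
    by apply/funext => z; rewrite big_nil.
  have cS' : cont_at (fun z => \sum_(b <- S' | b != 0) d b * blog r b z) 0.
    by apply: IH => b bS; apply: Sr; rewrite in_cons bS orbT.
  have [a0|a0] := eqVneq a 0.
    suff -> : (fun z => \sum_(b <- a :: S' | b != 0) d b * blog r b z) =
      (fun z => \sum_(b <- S' | b != 0) d b * blog r b z) by [].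
    by apply/funext => z; rewrite big_cons a0 eqxx.
  suff -> : (fun z => \sum_(b <- a :: S' | b != 0) d b * blog r b z) =
      (fun z => d a * blog r a z + \sum_(b <- S' | b != 0) d b * blog r b z).
    apply: rcontD => //.
    apply: rcontM; first exact: rcont_cst.
    by apply: blog_cont; rewrite ?nc0 ?Sr ?mem_head // eq_sym.
  by apply/funext => z; rewrite big_cons a0.
have E : ln (nc (g 0)) = ln (nc (h 0)) - B 0 - d 0 * ln r.
  pose u z := ln (nc (g z)); pose v z := ln (nc (h z)) - B z - d 0 * ln r.
  have cu : cont_at u 0 by exact: cont_ln_nc.
  have [dh0 h0] := hh 0 r'0.
  have cv : cont_at v 0.
    apply: rcontB; last exact: rcont_cst.
    by apply: rcontB => //; apply: cont_ln_nc h0; exact: cdiff_cont.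
  (* [ccont_eq] compares complex functions, so the two real ones are embedded. *)
  have cC (k : C -> R) : cont_at k 0 -> cont_at (fun z => (k z +i* 0 : C)) 0.
    by move=> ck; apply: ccont_ReIm => //; exact: rcont_cst.
  suff : (u 0 +i* 0 : C) = v 0 +i* 0 by case.
  apply: (ccont_eq (cC _ cu) (cC _ cv)).
  have nS : \forall z \near (0:C)^', z \notin S.
    apply/dnbhsCP; elim: (S) => [|a S' [e e0 he]]; first by exists 1.
    have [->|a0] := eqVneq a 0.
      by exists e => // z ze z0; rewrite in_cons negb_or z0 he.
    exists (Num.min e (nc a)); first by rewrite lt_min e0 nc_gt0.
    move=> z; rewrite lt_min => /andP[z1 z2] z0; rewrite in_cons negb_or he // andbT.
    by apply/eqP => ea; move: z2; rewrite ea subr0 ltxx.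
  have nr : \forall z \near (0:C)^', nc z < r.
    by apply/dnbhsCP; exists r => // z; rewrite subr0.
  have ng : \forall z \near (0:C)^', g z != 0.
    have n0 : 0 < nc (g 0) by rewrite nc_gt0.
    move/ccontP: cg => /(_ _ n0)[e e0 he]; apply/dnbhsCP; exists e => // z /he hz _.
    by apply/eqP => gz; move: hz; rewrite gz sub0r ncN ltxx.
  have nz : \forall z \near (0:C)^', z != 0.
    by apply/dnbhsCP; exists 1.
  near=> z.
  have z0 : z != 0 by near: z.
  have zr : nc z < r by near: z.
  have zS : z \notin S by near: z.
  have gz : g z != 0 by near: z.
  have fz : f z = g z * (z - 0) ^+ zm 0 / (z - 0) ^+ pm 0 by near: z.
  have [|_ _ e1] := hf z _ zS; first exact: lt_trans rr'.
  congr (_ +i* _); rewrite /u /v.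
  have : ln (nc (f z)) = ln (nc (g z)) + d 0 * ln (nc z).
    rewrite fz subr0 -mulrA ncM lnM ?posrE ?nc_gt0 ?ln_expf_div //.
    by rewrite mulf_neq0 ?invr_eq0 // expf_neq0.
  rewrite e1 sumB //; move: (ln _) (ln _) (ln _) (B z) (d 0) => x y t b e; lra.
rewrite E /Nsum.
have -> : B 0 = \sum_(a <- S | a != 0) (zm a)%:R * logp (r / nc a) -
    \sum_(a <- S | a != 0) (pm a)%:R * logp (r / nc a).
  rewrite -sumrB /B big_seq_cond [RHS]big_seq_cond; apply: eq_bigr => a /andP[aS a0].
  have n0 : 0 < nc a by rewrite nc_gt0.
  rewrite -mulrBl; congr (_ * _); rewrite /blog bden0 // nc1 ln1 !sub0r ncN.
  rewrite logp_id; last by rewrite ler_pdivlMr // mul1r ltW // Sr.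
  by rewrite !lnM ?lnV ?posrE ?invr_gt0 //; ring.
rewrite /d; ring.
Unshelve. all: by end_near. Qed.

End Estimates.

(** * The first main theorem and q-shifts *)

Section FirstMainTheorem.
Context {R : realType}.
Local Notation C := (R[i]^o).
Local Notation nc := (@Normc.normc R).
Implicit Types (h : C -> C) (r s : R) (a z q : C) (S : seq C).
Variables (f : C -> C) (zm pm : C -> nat).
Hypothesis D : divisor_spec f zm pm.

Let w a := (zm a + pm a)%N.
Let d a : R := (zm a)%:R - (pm a)%:R.
Let T r := nev_T r f.
Let m1 r := cmean (fun z => logp (nc (f z))) r.
Let m0 r := cmean (fun z => logp (nc (f z))^-1) r.
(** The right-hand side is the characteristic of [1 / f] up to a constant. The difference of the two
    proximity terms is the mean of [ln |f|], hence of [ln |h|], which is [ln |h 0|]; Jensen's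
    formula evaluates it. *)
Lemma first_main_theorem : exists L : R, forall r, 0 < r -> generic zm pm r ->
  nev_T r f = m0 r + NF D zm r + L.
Proof.
have [L hL] := jensen_constant D; exists L => r r0 gr; have r00 := ltW r0.
have [S [h [r' bd]]] := blaschke_factorization D r0 gr.
have c1 := circ_logp D gr; have c0 := circ_logpV D gr.
have e : m1 r - m0 r = cmean (fun z => ln (nc (f z))) r.
  rewrite -cmeanB //; apply: (eq_cmean r00) => z zr.
  by have [_ _ n0] := regular_at D (generic_circle gr zr); rewrite logp_inv.
have [rr' _ _ hh _] := bd.
have := hL r S h r' r0 bd; rewrite -(@mean_ln _ h r r') ?r00 //.
rewrite -(eq_cmean r00 (blaschke_circle r0 bd)) -e (nev_TE D r0) -/(m1 r); lra.
Qed.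

Variable L : R.
Hypothesis FMT : forall r, 0 < r -> generic zm pm r -> T r = m0 r + NF D zm r + L.

Let NF_ge0 (u : C -> nat) r : 1 <= r -> 0 <= NF D u r.
Proof. exact: Nsum_ge0. Qed.

Let m1_ge0 r : 0 <= r -> 0 <= m1 r.
Proof. by move=> r0; apply: cmean_ge0 => // z _; exact: logp_ge0. Qed.

Let m0_ge0 r : 0 <= r -> 0 <= m0 r.
Proof. by move=> r0; apply: cmean_ge0 => // z _; exact: logp_ge0. Qed.

Lemma nev_T_ge0 r : 1 <= r -> 0 <= nev_T r f.
Proof.
move=> r1; have r0 : 0 < r by exact: lt_le_trans r1.
rewrite (nev_TE D r0) addr_ge0 ?NF_ge0 //; exact: m1_ge0 (ltW r0).
Qed.

Lemma NF_le_T r : 1 <= r -> generic zm pm r -> NF D zm r + NF D pm r <= 2 * T r + `|L|.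
Proof.
move=> r1 gr; have r0 : 0 < r by exact: lt_le_trans r1.
have := FMT r0 gr; have := nev_TE D r0; rewrite -/(T r) -/(m1 r).
have := m1_ge0 (ltW r0); have := m0_ge0 (ltW r0); have := ler_norm (- L); rewrite normrN.
lra.
Qed.

(** The left side is [m(r, f) + m(r, 1/f)], and each term is bounded by [T r] up to the constant
    [L]. *)
Lemma mean_abs_ln_le r : 1 <= r -> generic zm pm r ->
  cmean (fun z => `|ln (nc (f z))|) r <= 2 * T r + `|L|.
Proof.
move=> r1 gr; have r0 : 0 < r by exact: lt_le_trans r1.
have -> : cmean (fun z => `|ln (nc (f z))|) r = m1 r + m0 r.
  rewrite -cmeanD ?(ltW r0) //; [|exact: (circ_logp D gr)|exact: (circ_logpV D gr)].
  apply: (eq_cmean (ltW r0)) => z zr.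
  by have [_ _ n0] := regular_at D (generic_circle gr zr); rewrite abs_ln_logp.
have := FMT r0 gr; have := nev_TE D r0; rewrite -/(T r) -/(m1 r).
have := NF_ge0 zm r1; have := NF_ge0 pm r1; have := ler_norm (- L); rewrite normrN.
lra.
Qed.

(** This is where the term [1 / ln (r' / r)] of the final estimate comes from. *)
Lemma count_le r s : 1 <= r -> r <= s -> generic zm pm r -> generic zm pm s ->
  (\sum_(a <- spec_list D r) (zm a + pm a)%:R) * ln (s / r) <= 2 * T s + `|L|.
Proof.
move=> r1 rs gr gs; apply: le_trans (NF_le_T (le_trans r1 rs) gs).
have -> : \sum_(a <- spec_list D r) (zm a + pm a)%:R =
    \sum_(a <- spec_list D r) (zm a)%:R + \sum_(a <- spec_list D r) (pm a)%:R :> R.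
  by rewrite -big_split; apply: eq_bigr => a _; rewrite natrD.
have sub : {subset spec_list D r <= spec_list D s}.
  by move=> a; rewrite !mem_spec_list => /andP[-> ar]; rewrite (le_trans ar).
have lt a : a \in spec_list D r -> nc a < r.
  by rewrite mem_spec_list lt_neqAle => /andP[wa ->]; rewrite gr.
by rewrite mulrDl; apply: lerD; apply: count_le_Nsum => //; exact: spec_list_uniq.
Qed.

Let blaschke_mean_h r S h r' : 0 < r -> blaschke_data f zm pm r S h r' ->
  cmean (fun z => `|ln (nc (h z))|) r = cmean (fun z => `|ln (nc (f z))|) r.
Proof.
move=> r0 bd; apply: (eq_cmean (ltW r0)) => z zr.
by rewrite (blaschke_circle r0 bd).
Qed.

Let h_diff r S h r' s z : 0 < r -> blaschke_data f zm pm r S h r' ->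
  0 < s -> s < r -> nc z <= s ->
  `|ln (nc (h z)) - ln (nc (h 0))| <= 2 * s / (r - s) * cmean (fun z => `|ln (nc (f z))|) r.
Proof.
move=> r0 bd s0 sr zs; have [rr' _ _ hh _] := bd.
have rr : 0 < r < r' by rewrite r0.
have zr : nc z < r by exact: le_lt_trans sr.
apply: le_trans (ln_diff_le rr hh zr) _; rewrite (blaschke_mean_h r0 bd).
apply: ler_wpM2r; first by apply: cmean_ge0 => //; exact: ltW.
have h1 : 0 < r - s by rewrite subr_gt0.
have h2 : 0 < r - nc z by rewrite subr_gt0.
apply: ler_pM.
- by rewrite mulr_ge0 ?nc_ge0.
- by rewrite invr_ge0 ltW.
- by rewrite ler_pM2l.
- by rewrite lef_pV2 ?posrE // lerD2l lerN2.
Qed.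

Let mean_le_h0 r S h r' : 0 < r -> blaschke_data f zm pm r S h r' ->
  `|ln (nc (h 0))| <= cmean (fun z => `|ln (nc (f z))|) r.
Proof.
move=> r0 bd; have [rr' _ _ hh _] := bd; rewrite -(blaschke_mean_h r0 bd).
rewrite -(@mean_ln _ h r r') ?(ltW r0) //; apply: norm_cmean_le; first exact: ltW.
move=> z zr; have zr' : nc z < r' by rewrite zr.
by apply: cont_ln_nc (hh z zr').2; apply: cdiff_cont; exact: (hh z zr').1.
Qed.

(* Characteristics at well-separated radii are comparable; this replaces the
   monotonicity of [T]. *)
Lemma nev_T_quasi_monotone s r : 1 <= s -> 2 * s <= r -> generic zm pm s -> generic zm pm r ->
  T s <= 8 * T r + 3 * `|L|.
Proof.
move=> s1 sr gs gr; have s0 : 0 < s by exact: lt_le_trans s1.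
have s00 := ltW s0; have sr' : s < r by lra.
have r0 : 0 < r by exact: lt_trans sr'.
have r1 : 1 <= r by lra.
have [S [h [r' bd]]] := blaschke_factorization D r0 gr.
have [rr' uS hS hh hf] := bd.
set H := cmean (fun z => `|ln (nc (f z))|) r.
have H0 : 0 <= H by apply: cmean_ge0 => //; exact: ltW.
have Sr a : a \in S -> nc a < r by rewrite hS => /andP[].
have Ss a : a \in S -> nc a != s by rewrite hS => /andP[wa _]; exact: gs.
have zS z : nc z = s -> z \notin S.
  by move=> zs; apply/negP => /Ss; rewrite zs eqxx.
have za a z : nc z = s -> a \in S -> z != a.
  by move=> zs /Ss; apply: contraNneq => <-; rewrite zs.
(* [|ln |h 0||] costs [H], and the variation of [ln |h|] from the centre costs at most [2 H] because
   [r >= 2 s]. The Blaschke terms of the zeros have the favourable sign and are dropped. *)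
have bl z : nc z = s -> logp (nc (f z)) <= 3 * H + \sum_(a <- S) (pm a)%:R * blog r a z.
  move=> zs; have zr' : nc z < r' by rewrite zs (lt_trans sr').
  have [_ _ e] := hf z zr' (zS z zs).
  have b0 a : a \in S -> 0 <= blog r a z.
    by move=> aS; apply: blog_ge0 => //; [exact: Sr|rewrite zs|exact: za].
  have p0 : 0 <= \sum_(a <- S) (pm a)%:R * blog r a z.
    by rewrite big_seq; apply: sumr_ge0 => a aS; rewrite mulr_ge0 // b0.
  have q0 : 0 <= \sum_(a <- S) (zm a)%:R * blog r a z.
    by rewrite big_seq; apply: sumr_ge0 => a aS; rewrite mulr_ge0 // b0.
  have sp : \sum_(a <- S) ((zm a)%:R - (pm a)%:R) * blog r a z =
      \sum_(a <- S) (zm a)%:R * blog r a z - \sum_(a <- S) (pm a)%:R * blog r a z.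
    by rewrite -sumrB; apply: eq_bigr => a _; rewrite mulrBl.
  rewrite /logp ge_max; apply/andP; split; last by rewrite addr_ge0 // mulr_ge0.
  rewrite e sp opprB addrA -addrA; apply: lerD; last by rewrite lerBlDr lerDl.
  have zs' : nc z <= s by rewrite zs.
  have h1 := h_diff r0 bd s0 sr' zs'; have h2 := mean_le_h0 r0 bd.
  have h3 : 2 * s / (r - s) * H <= 2 * H.
    by rewrite ler_wpM2r // ler_pdivrMr ?subr_gt0 //; lra.
  move: h1 h2; rewrite -/H !ler_norml; lra.
have cb a : a \in S -> circ_cont (fun z => (pm a)%:R * blog r a z) s.
  move=> aS; apply: circ_contM; first exact: circ_cont_cst.
  by move=> z zs; apply: blog_cont => //; [exact: Sr|rewrite zs|exact: za].
have mean_le : m1 s <= 3 * H + NF D pm r.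
  apply: (@le_trans _ _ (cmean (fun z => 3 * H + \sum_(a <- S) (pm a)%:R * blog r a z) s)).
    apply: le_cmean => //; first exact: (circ_logp D gs).
    by apply: circ_contD; [exact: circ_cont_cst|exact: circ_cont_sum].
  rewrite cmeanD //; [|exact: circ_cont_cst|exact: circ_cont_sum].
  rewrite cmean_cst lerD2l cmean_sum //.
  have -> : NF D pm r = Nsum pm S r.
    apply: Nsum_ext => //; first exact: spec_list_uniq.
      move=> a pa ar; rewrite mem_spec_list (ltW ar) andbT addn_eq0 negb_and pa orbT //.
    by move=> a pa ar; rewrite hS ar andbT addn_eq0 negb_and pa orbT.
  apply: (@le_trans _ _ (\sum_(a <- S) (pm a)%:R * ln (r / Num.max s (nc a)))).
    rewrite big_seq [leRHS]big_seq; apply: ler_sum => a aS.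
    rewrite cmeanZ ?mean_blog ?Sr ?Ss //.
    by move=> z zs; apply: blog_cont => //; [exact: Sr|rewrite zs|exact: za].
  have M0 a : 0 < Num.max s (nc a) by rewrite lt_max s0.
  apply: sum_le_Nsum => //.
    move=> a aS a0; apply: le_trans (ln_le_logp _).
    rewrite ler_ln ?posrE ?divr_gt0 ?nc_gt0 //.
    by rewrite ler_wpM2l ?(ltW r0) // lef_pV2 ?posrE ?nc_gt0 // le_max lexx orbT.
  rewrite ler_ln ?posrE ?divr_gt0 // ler_pdivrMr // ler_peMr ?(ltW r0) //.
  by rewrite le_max s1.
have Hle : H <= 2 * T r + `|L| := mean_abs_ln_le r1 gr.
have Ns : NF D pm s <= NF D pm r.
  have -> : NF D pm s = Nsum pm (spec_list D r) s.
    apply: Nsum_ext => //; try exact: spec_list_uniq.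
      move=> a pa as_; rewrite mem_spec_list (ltW as_) andbT addn_eq0 negb_and pa orbT //.
    move=> a pa as_; rewrite mem_spec_list addn_eq0 negb_and pa orbT /=.
    by rewrite ltW // (lt_trans as_).
  by apply: Nsum_le => //; exact: ltW.
have Nr : NF D pm r <= T r.
  by rewrite /T (nev_TE D r0) lerDr; exact: m1_ge0 (ltW r0).
have Ts : T s = m1 s + NF D pm s by rewrite /T (nev_TE D s0).
(* [3 H] gives [6 T r + 3 |L|]; the counting function at [r] enters twice, adding [2 T r]. *)
rewrite Ts; lra.
Qed.

Let f_scale_cont q s z : generic zm pm s -> (forall a, w a != 0%N -> nc a != nc q * s) ->
  nc z = s -> [/\ cont_at (fun z => f (q * z)) z, f (q * z) != 0, cont_at f z & f z != 0].
Proof.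
move=> gs gq zs; have [cf f0 _] := regular_at D (generic_circle gs zs).
have wq : (zm (q * z)%R + pm (q * z)%R)%N == 0%N.
  by apply/negPn/negP => wz; have := gq _ wz; rewrite ncM zs eqxx.
have [cq q0 _] := regular_at D wq; split => //.
apply: (@cont_comp _ _ _ (fun z => q * z)) cq.
by apply: ccontM; [exact: ccont_cst|exact: ccont_id].
Qed.

Lemma circ_logp_quot q s : generic zm pm s -> (forall a, w a != 0%N -> nc a != nc q * s) ->
  circ_cont (fun z => logp (nc (f (q * z) / f z))) s.
Proof.
move=> gs gq z zs; have [cq q0 cf f0] := f_scale_cont gs gq zs.
apply: cont_logp; first by rewrite nc_gt0 mulf_neq0 ?invr_eq0.
by apply: cont_nc; apply: ccontM => //; exact: ccontV.
Qed.

(* The [q]-difference analogue of the lemma on the logarithmic derivative. *)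
Lemma proximity_quot_le q s r : q != 0 -> nc q < 1 -> 1 <= s -> 2 * s <= r ->
  generic zm pm s -> (forall a, w a != 0%N -> nc a != nc q * s) -> generic zm pm r ->
  cmean (fun z => logp (nc (f (q * z) / f z))) s <=
    4 * s / (r - s) * (2 * T r + `|L|) +
    (6 * ln 2 - ln (nc q)) * \sum_(a <- spec_list D r) (zm a + pm a)%:R.
Proof.
move=> q0 q1 s1 sr gs gq gr; have s0 : 0 < s by exact: lt_le_trans s1.
have s00 := ltW s0; have sr' : s < r by lra.
have r0 : 0 < r by exact: lt_trans sr'.
have r1 : 1 <= r by lra.
have [S [h [r' bd]]] := blaschke_factorization D r0 gr.
have [rr' uS hS hh hf] := bd.
set H := cmean (fun z => `|ln (nc (f z))|) r.
have H0 : 0 <= H by apply: cmean_ge0 => //; exact: ltW.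
have Hle : H <= 2 * T r + `|L| := mean_abs_ln_le r1 gr.
have Sr a : a \in S -> nc a < r by rewrite hS => /andP[].
have Ss a : a \in S -> nc a != s by rewrite hS => /andP[wa _]; exact: gs.
have Sq a : a \in S -> nc a != nc q * s by rewrite hS => /andP[wa _]; exact: gq.
have za a z : nc z = s -> a \in S -> z != a.
  by move=> zs /Ss; apply: contraNneq => <-; rewrite zs.
have qza a z : nc z = s -> a \in S -> q * z != a.
  by move=> zs /Sq; apply: contraNneq => <-; rewrite ncM zs.
have M0 a : 0 < Num.max s (nc a) by rewrite lt_max s0.
pose V1 a z := `|ln (nc (z - a) / Num.max s (nc a))|.
pose V2 a z := `|ln (nc (q * z - a) / Num.max s (nc a))|.
(* Bounds the change of [blog r a] from [z] to [q * z]. The two denominators lie in [[1/2, 2]] and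
   give [2 ln 2]; the numerators share a normaliser and give [V1] and [V2], of means at most
   [2 ln 2] and [2 ln 2 - ln (nc q)]. *)
pose V a z := 2 * ln 2 + (V1 a z + V2 a z).
have cV1 a : a \in S -> circ_cont (V1 a) s.
  move=> aS; apply: circ_cont_norm => z zs.
  have zn : z - a != 0 by rewrite subr_eq0 za.
  apply: rcont_ln; first by rewrite divr_gt0 // nc_gt0.
  apply: rcontM; last exact: rcont_cst.
  by apply: cont_nc; apply: ccontB; [exact: ccont_id|exact: ccont_cst].
have cV2 a : a \in S -> circ_cont (V2 a) s.
  move=> aS; apply: circ_cont_norm => z zs.
  have zn : q * z - a != 0 by rewrite subr_eq0 qza.
  apply: rcont_ln; first by rewrite divr_gt0 // nc_gt0.
  by apply: rcontM; [apply: cont_nc; exact: cont_lin|exact: rcont_cst].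
have cV12 a : a \in S -> circ_cont (fun z => V1 a z + V2 a z) s.
  by move=> aS; apply: circ_contD; [exact: cV1|exact: cV2].
have cV a : a \in S -> circ_cont (V a) s.
  by move=> aS; apply: circ_contD; [exact: circ_cont_cst|exact: cV12].
have cwV a : a \in S -> circ_cont (fun z => (w a)%:R * V a z) s.
  by move=> aS; apply: circ_contM; [exact: circ_cont_cst|exact: cV].
have mV a : a \in S -> cmean (V a) s <= 6 * ln 2 - ln (nc q).
  move=> aS; rewrite /V cmeanD ?cmean_cst //; [|exact: circ_cont_cst|exact: cV12].
  rewrite cmeanD //; [|exact: cV1|exact: cV2].
  have := mean_abs_ln_sub s0 (Ss a aS); have := mean_abs_ln_lin s0 q0 q1 (Sq a aS).
  rewrite -/(cmean (V1 a) s) -/(cmean (V2 a) s); lra.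
have small z : nc z = s -> nc (q * z) <= s.
  by move=> zs; rewrite ncM zs ler_piMl // ltW.
have bdiff a z : nc z = s -> a \in S -> `|blog r a (q * z) - blog r a z| <= V a z.
  move=> zs aS.
  have lnb x : nc x <= s -> `|ln (nc (bden r a x))| <= ln 2.
    move=> xs; have xr : nc x <= r / 2 by lra.
    have /andP[b1 b2] := nc_bden_bounds r0 (Sr a aS) xr.
    have b0 : 0 < nc (bden r a x) by lra.
    rewrite ler_norml; apply/andP; split; last by rewrite ler_ln ?posrE.
    by rewrite -lnV ?posrE // ler_ln ?posrE ?invr_gt0 //; lra.
  have lb1 : `|ln (nc (bden r a (q * z)))| <= ln 2 by apply: lnb; exact: small.
  have lb2 : `|ln (nc (bden r a z))| <= ln 2 by apply: lnb; rewrite zs.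
  have n1 : 0 < nc (z - a) by rewrite nc_gt0 subr_eq0 za.
  have n2 : 0 < nc (q * z - a) by rewrite nc_gt0 subr_eq0 qza.
  have e1 := ler_norm (ln (nc (z - a) / Num.max s (nc a))).
  have e1' := ler_norm (- ln (nc (z - a) / Num.max s (nc a))).
  have e2 := ler_norm (ln (nc (q * z - a) / Num.max s (nc a))).
  have e2' := ler_norm (- ln (nc (q * z - a) / Num.max s (nc a))).
  rewrite !normrN in e1' e2'.
  move: lb1 lb2 e1 e1' e2 e2'; rewrite /V /V1 /V2 /blog !ler_norml.
  move: (`|_|) (`|_|) => N1 N2.
  rewrite !lnM ?lnV ?posrE ?invr_gt0 //.
  move: (ln _) (ln _) (ln _) (ln _) (ln _) (ln _) (ln _) => x1 x2 x3 x4 x5 x6 x7; lra.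
have pt z : nc z = s -> logp (nc (f (q * z) / f z)) <=
    4 * s / (r - s) * H + \sum_(a <- S) (w a)%:R * V a z.
  move=> zs; have [_ fq _ f0] := f_scale_cont gs gq zs.
  have zS : z \notin S by apply/negP => /Ss; rewrite zs eqxx.
  have qS : q * z \notin S by apply/negP => /Sq; rewrite ncM zs eqxx.
  have zr' : nc z < r' by rewrite zs (lt_trans sr').
  have qr' : nc (q * z) < r' by rewrite (le_lt_trans (small z zs)) // (lt_trans sr').
  have [_ _ e1] := hf z zr' zS; have [_ _ e2] := hf _ qr' qS.
  have n1 : 0 < nc (f z) by rewrite nc_gt0.
  have n2 : 0 < nc (f (q * z)) by rewrite nc_gt0.
  apply: (@le_trans _ _ `|ln (nc (f (q * z) / f z))|).
    by rewrite /logp ge_max normr_ge0 ler_norm.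
  rewrite ncM ncV lnM ?lnV ?posrE ?invr_gt0 // e1 e2.
  have -> : ln (nc (h (q * z))) - \sum_(a <- S) ((zm a)%:R - (pm a)%:R) * blog r a (q * z) -
      (ln (nc (h z)) - \sum_(a <- S) ((zm a)%:R - (pm a)%:R) * blog r a z) =
      (ln (nc (h (q * z))) - ln (nc (h 0))) - (ln (nc (h z)) - ln (nc (h 0))) -
      \sum_(a <- S) ((zm a)%:R - (pm a)%:R) * (blog r a (q * z) - blog r a z).
    under [in RHS]eq_bigr do rewrite mulrBr.
    rewrite sumrB; ring.
  apply: le_trans (ler_normB _ _) _; apply: lerD.
    apply: le_trans (ler_normB _ _) _.
    have zs' : nc z <= s by rewrite zs.
    have := h_diff r0 bd s0 sr' (small z zs); have := h_diff r0 bd s0 sr' zs'.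
    rewrite -/H; have -> : 4 * s / (r - s) * H = 2 * s / (r - s) * H + 2 * s / (r - s) * H.
      by ring.
    lra.
  apply: le_trans (ler_norm_sum _ _ _) _; rewrite big_seq [leRHS]big_seq.
  apply: ler_sum => a aS; rewrite normrM; apply: ler_pM => //; last exact: bdiff.
  by rewrite /w natrD; apply: le_trans (ler_normB _ _) _; rewrite !normr_nat.
apply: (@le_trans _ _ (cmean (fun z => 4 * s / (r - s) * H + \sum_(a <- S) (w a)%:R * V a z) s)).
  apply: le_cmean => //; first exact: circ_logp_quot.
  by apply: circ_contD; [exact: circ_cont_cst|exact: circ_cont_sum].
rewrite cmeanD //; [|exact: circ_cont_cst|exact: circ_cont_sum].
rewrite cmean_cst; apply: lerD.
  rewrite ler_wpM2l // divr_ge0 ?mulr_ge0 // subr_ge0; exact: ltW.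
rewrite cmean_sum // mulr_sumr.
have -> : \sum_(a <- spec_list D r) (6 * ln 2 - ln (nc q)) * (zm a + pm a)%:R =
    \sum_(a <- S) (6 * ln 2 - ln (nc q)) * (w a)%:R.
  apply: perm_big; apply: uniq_perm => //; first exact: spec_list_uniq.
  move=> a; rewrite mem_spec_list hS; case wa: (_ != 0%N) => //=.
  by rewrite le_eqVlt (negPf (gr _ wa)).
rewrite big_seq [leRHS]big_seq; apply: ler_sum => a aS.
rewrite (cmeanZ _ s00 (cV a aS)) mulrC; apply: ler_wpM2r => //; exact: mV.
Qed.

End FirstMainTheorem.

(** * Unboundedness of the characteristic; the Jackson operator *)

Section Unbounded.
Context {R : realType}.
Local Notation C := (R[i]^o).
Local Notation nc := (@Normc.normc R).
Implicit Types (r s : R) (a z q : C).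

Lemma avoid_seq (T : seq R) (x y : R) : x < y -> exists2 s, x < s < y & s \notin T.
Proof.
move=> xy; suff [x' [y' [h1 h2 h3 h4]]] : exists x' y', [/\ x <= x', x' < y', y' <= y &
    forall s, x' < s < y' -> s \notin T].
  exists ((x' + y') / 2); first by apply/andP; split; lra.
  by apply: h4; apply/andP; split; lra.
elim: T => [|t T [x' [y' [h1 h2 h3 h4]]]]; first by exists x, y.
have [tm|tm] := lerP t ((x' + y') / 2).
  exists ((x' + y') / 2), y'; split; [lra|lra|lra|].
  move=> s /andP[s1 s2]; rewrite in_cons negb_or gt_eqF ?(le_lt_trans tm) //= h4 //.
  by apply/andP; split; lra.
exists x', ((x' + y') / 2); split; [lra|lra|lra|].
move=> s /andP[s1 s2]; rewrite in_cons negb_or lt_eqF ?(lt_trans s2) //= h4 //.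
by apply/andP; split; lra.
Qed.

(** The limit in Liouville's theorem: the bounds of the Schwarz formula decay like [1 / r]. *)
Lemma le0_of_decay (x c B r0 : R) : 0 <= c -> 0 <= B ->
  (forall r, r0 < r -> c < r -> x <= 2 * c / (r - c) * B) -> x <= 0.
Proof.
move=> c0 B0 h; apply/ler_addgt0Pl => e e0; rewrite addr0.
pose r := Num.max r0 c + 1 + 2 * c * B / e.
have p0 : 0 <= 2 * c * B / e by rewrite divr_ge0 ?mulr_ge0 // ltW.
have m1 : r0 <= Num.max r0 c by rewrite le_max lexx.
have m2 : c <= Num.max r0 c by rewrite le_max lexx orbT.
have rc : 0 < r - c by rewrite /r; lra.
apply: le_trans (h r _ _) _; [rewrite /r; lra|rewrite /r; lra|].
rewrite mulrAC ler_pdivrMr // -ler_pdivrMl // mulrC; rewrite /r; lra.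
Qed.

Variables (f : C -> C) (zm pm : C -> nat).
Hypothesis D : divisor_spec f zm pm.
Hypothesis nf : ~ (exists c, forall z, f z = c).
Variable L : R.
Hypothesis FMT : forall r, 0 < r -> generic zm pm r -> nev_T r f =
  cmean (fun z => logp (nc (f z))^-1) r + NF D zm r + L.

Lemma exists_generic x y : x < y -> exists2 s, x < s < y & generic zm pm s.
Proof.
move=> xy; have [s hs sT] := avoid_seq [seq nc a | a <- spec_list D y] xy.
exists s => // a wa; apply/eqP => e; move/negP: sT; apply; rewrite -e.
by apply: map_f; rewrite mem_spec_list wa e ltW //; case/andP: hs.
Qed.

(* Otherwise [f] has no zeros and poles, and then Liouville's argument applies
   to [ln |f|] and to [f]. *)
Lemma nev_T_unbounded (K : R) : exists s, [/\ 1 <= s, generic zm pm s & K <= nev_T s f].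
Proof.
apply: contrapT => /forallNP hK.
have TK s : 1 <= s -> generic zm pm s -> nev_T s f < K.
  by move=> s1 gs; rewrite ltNge; apply/negP => h; apply: (hK s).
have [s0 s01 gs0] : exists2 s, 1 <= s & generic zm pm s.
  have [s /andP[s1 _] gs] : exists2 s, 1 < s < 2 & generic zm pm s.
    by apply: exists_generic; lra.
  by exists s => //; exact: ltW.
have K0 : 0 <= K by apply: le_trans (nev_T_ge0 D s01) (ltW (TK _ s01 gs0)).
have B0 : 0 <= 2 * K + `|L| by rewrite addr_ge0 // mulr_ge0.
have reg a : (zm a + pm a)%N == 0%N.
  apply/negPn/negP => wa.
  pose x := Num.max 1 (nc a).
  have [r /andP[r1 r2] gr] : exists2 r, x < r < x + 1 & generic zm pm r.
    by apply: exists_generic; lra.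
  have x1 : 1 <= x by rewrite le_max lexx.
  have xa : nc a <= x by rewrite le_max lexx orbT.
  have r0 : 0 < r by lra.
  have aS : a \in spec_list D r by rewrite mem_spec_list wa /=; lra.
  (* Beyond [y] one has [ln (s / r) >= 2 K + |L| + 1], so a single zero or pole already violates
     [count_le] with [T s < K]. *)
  pose y := r * expR (2 * K + `|L| + 1).
  have ry : r <= y by rewrite ler_peMr ?(ltW r0) // -[X in X <= _]expR0 ler_expR; lra.
  have [s /andP[s1 s2] gs] : exists2 s, y < s < y + 1 & generic zm pm s.
    by apply: exists_generic; lra.
  have rs : r <= s by lra.
  have r11 : 1 <= r by lra.
  have := count_le FMT r11 rs gr gs.
  have s11 : 1 <= s by lra.
  have n1 : 1 <= \sum_(b <- spec_list D r) (zm b + pm b)%:R :> R.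
    rewrite (bigD1_seq a aS (spec_list_uniq D r)) /=.
    have h1 : 1 <= (zm a + pm a)%:R :> R by rewrite ler1n lt0n.
    by apply: le_trans h1 _; rewrite lerDl sumr_ge0.
  have ls : 2 * K + `|L| + 1 <= ln (s / r).
    rewrite -[leLHS]expRK ler_ln ?posrE ?expR_gt0 ?divr_gt0 //; last by lra.
    by rewrite ler_pdivlMr // mulrC ltW.
  have l0 : 0 <= ln (s / r) by lra.
  have := TK s s11 gs; have := ler_wpM2r l0 n1; rewrite mul1r; lra.
have gen r : generic zm pm r by move=> a; rewrite reg.
have fz z : cdiff f z /\ f z != 0 by exact: (div_regular D (reg z)).
have absf w : nc (f w) = nc (f 0).
  have n1 : 0 < nc (f w) by rewrite nc_gt0; exact: (fz w).2.
  have n2 : 0 < nc (f 0) by rewrite nc_gt0; exact: (fz 0).2.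
  apply: (@ln_inj R); rewrite ?posrE //; apply/eqP.
  rewrite -subr_eq0 -normr_eq0 eq_le normr_ge0 andbT.
  apply: (@le0_of_decay _ (nc w) (2 * K + `|L|) 1) => [||r r1 rw]; rewrite ?nc_ge0 //.
  have rr : 0 < r < r + 1 by apply/andP; split; lra.
  apply: le_trans (ln_diff_le rr (fun z _ => fz z) rw) _.
  apply: ler_wpM2l; first by rewrite divr_ge0 ?mulr_ge0 ?nc_ge0 // subr_ge0 ltW.
  apply: le_trans (mean_abs_ln_le FMT (ltW r1) (gen r)) _.
  by have := TK r (ltW r1) (gen r); lra.
have const (g : C -> C) : (forall z, cdiff g z) -> (forall z, nc (g z) = nc (g 0)) ->
    forall z, Re (g z) = Re (g 0).
  move=> dg ng w; apply/eqP; rewrite -subr_eq0 -normr_eq0 eq_le normr_ge0 andbT.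
  apply: (@le0_of_decay _ (nc w) (nc (g 0)) 1) => [||r r1 rw]; rewrite ?nc_ge0 //.
  have rr : 0 < r < r + 1 by apply/andP; split; lra.
  apply: le_trans (Re_diff_le rr (fun z _ => dg z) rw) _.
  apply: ler_wpM2l; first by rewrite divr_ge0 ?mulr_ge0 ?nc_ge0 // subr_ge0 ltW.
  have r0 : 0 <= r by lra.
  have cR : circ_cont (fun z => Re (g z)) r.
    by apply: circ_cont_Re => z _; exact: cdiff_cont.
  rewrite -[leRHS](cmean_cst r); apply: le_cmean => //.
  - exact: circ_cont_norm.
  - exact: circ_cont_cst.
  - by move=> z _; rewrite -(ng z) nc_Re_le.
apply: nf; exists (f 0) => z.
have dfz x : cdiff f x by exact: (fz x).1.
have h1 := const f dfz absf z.
have h2 : Im (f z) = Im (f 0).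
  have dg x : cdiff (fun x => (0 -i* 1 : C) * f x) x.
    by apply: cdiffM => //; exact: cdiff_cst.
  have ng x : nc ((0 -i* 1 : C) * f x) = nc ((0 -i* 1 : C) * f 0) by rewrite !ncM absf.
  by have := const _ dg ng z; rewrite !ReM /= !mul0r !mulN1r !sub0r !opprK.
by move: h1 h2; case: (f z) => a b; case: (f 0) => c e /= -> ->.
Qed.

(** One generic radius with [T >= 8 K + 3 |L|] suffices: [nev_T_quasi_monotone] carries [K] to every
    generic radius at least twice as large. *)
Lemma nev_T_infty (K : R) : exists2 r0, 1 <= r0 & forall r, r0 <= r -> generic zm pm r ->
  K <= nev_T r f.
Proof.
have [s [s1 gs hs]] := nev_T_unbounded (8 * K + 3 * `|L|).
exists (2 * s); first by lra.
move=> r sr gr; have := nev_T_quasi_monotone FMT s1 sr gs gr; lra.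
Qed.

End Unbounded.

Section Jackson.
Context {R : realType}.
Local Notation C := (R[i]^o).
Local Notation nc := (@Normc.normc R).
Implicit Types (r s : R) (a z q : C) (f g : C -> C).

(** In the induction, evaluating the bound at [q * z] costs [(nc q)^-1 ^+ k] and the division by
    [(q - 1) * z] costs [1 / nc (q - 1)] and one more power of [1 / nc z]. *)
Lemma jackson_bound q k : q != 0 -> nc q < 1 -> exists2 c : R, 0 <= c &
  forall f z, z != 0 -> nc (iter k (jackson q) f z) <=
    c * (nc z)^-1 ^+ k * \sum_(j < k.+1) nc (f (q ^+ j * z)).
Proof.
move=> q0 q1; have nq : 0 < nc q by rewrite nc_gt0.
have q10 : 0 < nc (q - 1).
  by rewrite nc_gt0 subr_eq0; apply/eqP => e; move: q1; rewrite e nc1 ltxx.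
elim: k => [|k [c c0 IH]].
  by exists 1 => // f z z0; rewrite big_ord1 !expr0 !mul1r.
exists (c * ((nc q)^-1 ^+ k + 1) / nc (q - 1)).
  by rewrite divr_ge0 ?mulr_ge0 ?addr_ge0 ?exprn_ge0 ?invr_ge0 ?nc_ge0.
move=> f z z0; have nz : 0 < nc z by rewrite nc_gt0.
rewrite iterS /jackson; set F := iter k _ f.
have qz0 : q * z != 0 by rewrite mulf_neq0.
have h1 := IH f _ qz0; have h2 := IH f _ z0; rewrite -/F in h1 h2.
set S1 := \sum_(j < k.+2) nc (f (q ^+ j * z)).
have s1 : \sum_(j < k.+1) nc (f (q ^+ j * (q * z))) <= S1.
  rewrite /S1 [leRHS]big_ord_recl -[leLHS]add0r; apply: lerD; first exact: nc_ge0.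
  apply: ler_sum => j _; rewrite mulrA -exprSr le_eqVlt; apply/orP; left; apply/eqP.
  by [].
have s2 : \sum_(j < k.+1) nc (f (q ^+ j * z)) <= S1.
  by rewrite /S1 [leRHS]big_ord_recr lerDl nc_ge0.
have -> : q * z - z = (q - 1) * z by ring.
rewrite (ncM (F (q * z) - F z)) ncV (ncM (q - 1)) ler_pdivrMr ?mulr_gt0 //.
apply: le_trans (ncB_le _ _) _.
have S10 : 0 <= S1 by apply: sumr_ge0 => j _; exact: nc_ge0.
have X0 : 0 <= (nc z)^-1 ^+ k by rewrite exprn_ge0 // invr_ge0 nc_ge0.
have Y0 : 0 <= (nc q)^-1 ^+ k by rewrite exprn_ge0 // invr_ge0 nc_ge0.
have -> : c * ((nc q)^-1 ^+ k + 1) / nc (q - 1) * (nc z)^-1 ^+ k.+1 * S1 * (nc (q - 1) * nc z) =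
    c * ((nc q)^-1 ^+ k * (nc z)^-1 ^+ k) * S1 + c * (nc z)^-1 ^+ k * S1.
  by rewrite exprS; field; rewrite !gt_eqF.
apply: lerD.
  apply: le_trans h1 _; rewrite ncM invfM exprMn.
  by rewrite ler_wpM2l // mulr_ge0 // mulr_ge0.
by apply: le_trans h2 _; rewrite ler_wpM2l // mulr_ge0.
Qed.

Lemma jackson_cont q k f z : q != 0 -> q != 1 -> z != 0 ->
  (forall j, (j <= k)%N -> cont_at f (q ^+ j * z)) -> cont_at (iter k (jackson q) f) z.
Proof.
move=> q0 q1; elim: k z => [|k IH] z z0 h.
  by have := h 0%N isT; rewrite expr0 mul1r.
have c1 : cont_at (fun w => q * w) z.
  by apply: ccontM; [exact: ccont_cst|exact: ccont_id].
rewrite iterS /jackson; apply: ccontM.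
  apply: ccontB.
    apply: (@cont_comp _ _ _ (fun w => q * w)) => //; apply: IH; first exact: mulf_neq0.
    by move=> j jk; rewrite mulrA -exprSr; exact: h.
  by apply: IH => // j jk; apply: h; exact: leqW.
apply: ccontV; last by apply: ccontB => //; exact: ccont_id.
have -> : q * z - z = (q - 1) * z by ring.
by rewrite mulf_neq0 // subr_eq0.
Qed.

(** Covers zeros of [u]: there [logp] is [0] on a whole neighbourhood, by the convention [ln 0 = 0].
    It is needed because iterated differences may vanish on a generic circle. *)
Lemma cont_logp_ge0 (u : C -> R) z : (forall y, 0 <= u y) -> cont_at u z ->
  cont_at (fun y => logp (u y)) z.
Proof.
move=> u0 cu; have [uz|uz] := eqVneq (u z) 0; last first.
  by apply: cont_logp => //; rewrite lt_neqAle eq_sym uz u0.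
have n1 : \forall y \near z, u y < 1.
  move/rcontP: cu => /(_ 1 ltr01); apply: filterS => y.
  by rewrite uz subr0 ltr_norml => /andP[].
apply/rcontP => e e0; apply: filterS n1 => y uy.
rewrite !logp_eq0 ?subrr ?normr0 // ?uz ?lexx ?ler01 //.
by rewrite u0 ltW.
Qed.

Lemma le_expR_logp (x : R) : 0 <= x -> x <= expR (logp x).
Proof.
rewrite le_eqVlt => /orP[/eqP <-|x0]; first exact: expR_ge0.
by rewrite -[leLHS]lnK ?posrE // ler_expR ln_le_logp.
Qed.

(** Each [x j] is at most the exponential of the sum of all the [logp (x i)]. *)
Lemma logp_sum_le (n : nat) (c : R) (x : 'I_n -> R) : 0 <= c -> (forall j, 0 <= x j) ->
  logp (c * \sum_j x j) <= logp (c * n%:R) + \sum_j logp (x j).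
Proof.
move=> c0 x0; set E := \sum_j logp (x j).
have E0 : 0 <= E by apply: sumr_ge0 => j _; exact: logp_ge0.
have xE j : x j <= expR E.
  apply: le_trans (le_expR_logp (x0 j)) _; rewrite ler_expR /E (bigD1 j) //= lerDl.
  by apply: sumr_ge0 => i _; exact: logp_ge0.
have sE : c * \sum_j x j <= c * n%:R * expR E.
  rewrite -mulrA ler_wpM2l //; apply: le_trans (ler_sum _ (fun j _ => xE j)) _.
  by rewrite sumr_const card_ord mulr_natl.
apply: le_trans (le_logp _ sE) _; first by rewrite mulr_ge0 // sumr_ge0.
have [->|cn] := eqVneq (c * n%:R) 0.
  by rewrite mul0r {1}/logp ln0 // maxxx addr_ge0 ?logp_ge0.
have cn0 : 0 < c * n%:R by rewrite lt_neqAle eq_sym cn mulr_ge0.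
rewrite {1}/logp lnM ?posrE ?expR_gt0 // expRK ge_max lerD2r ln_le_logp.
by rewrite addr_ge0 ?logp_ge0.
Qed.

Variables (f : C -> C) (zm pm : C -> nat).
Hypothesis D : divisor_spec f zm pm.
Variable L : R.
Hypothesis FMT : forall r, 0 < r -> generic zm pm r -> nev_T r f =
  cmean (fun z => logp (nc (f z))^-1) r + NF D zm r + L.

(** Makes every [f (q ^+ j * z)] with [j <= k] continuous and nonzero on the circle of radius
    [s]. *)
Definition kgeneric q k s := forall j a, (j <= k)%N -> (zm a + pm a)%N != 0%N ->
  nc a != nc q ^+ j * s.

Lemma kgeneric0 q k s : kgeneric q k s -> generic zm pm s.
Proof. by move=> h a wa; have := h 0%N a isT wa; rewrite expr0 mul1r. Qed.

Lemma jackson_proximity_le q k : q != 0 -> nc q < 1 -> exists2 A : R, 0 <= A &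
  forall s r r', 1 <= s -> 2 * s <= r -> 2 * r <= r' ->
    kgeneric q k s -> generic zm pm r -> generic zm pm r' ->
    nev_m s (fun z => iter k (jackson q) f z / f z) <=
      A * (s / (r - s) + (ln (r' / r))^-1) * (nev_T r' f + 1) + A.
Proof.
move=> q0 q1; have [c c0 hc] := jackson_bound k q0 q1.
have nq : 0 < nc q by rewrite nc_gt0.
pose W (j : nat) : R := 6 * ln 2 - ln (nc (q ^+ j)).
have W0 j : 0 <= W j.
  rewrite /W ncX lnXn // subr_ge0; apply: (@le_trans _ _ 0).
    by rewrite mulrn_wle0 // ln_le0 // ltW.
  by rewrite mulr_ge0 // ln_ge0 // ler1n.
have LL := normr_ge0 L.
(* The summands are the constant of [logp_sum_le]; for each [j], the factor [4] of
   [proximity_quot_le] with [2 T r + |L| <= 16 T r' + 7 |L|] from [nev_T_quasi_monotone]; and the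
   weights of the zeros and poles, with [2 T r' + |L| <= (2 + |L|) (T r' + 1)]. *)
pose A := logp (c * k.+1%:R) + k.+1%:R * (4 * (16 + 7 * `|L|)) +
  (\sum_(j < k.+1) W j) * (2 + `|L|).
have SW0 : 0 <= \sum_(j < k.+1) W j by apply: sumr_ge0 => j _; exact: W0.
have a1 : 0 <= logp (c * k.+1%:R) := logp_ge0 _.
have a2 : 0 <= k.+1%:R * (4 * (16 + 7 * `|L|)) :> R.
  by rewrite mulr_ge0 // mulr_ge0 // addr_ge0 // mulr_ge0.
have a3 : 0 <= (\sum_(j < k.+1) W j) * (2 + `|L|) by rewrite mulr_ge0 // addr_ge0.
exists A; first by rewrite /A; lra.
move=> s r r' s1 sr rr ks gr gr'; have s0 : 0 < s by lra.
have gs := kgeneric0 ks.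
have q10 : q != 1 by apply/eqP => e; move: q1; rewrite e nc1 ltxx.
have r1 : 1 <= r by lra.
have fj j : (j <= k)%N -> forall a, (zm a + pm a)%N != 0%N -> nc a != nc (q ^+ j) * s.
  by move=> jk a wa; rewrite ncX; exact: ks.
have cz z : nc z = s -> [/\ z != 0, cont_at f z, f z != 0 &
    forall j, (j <= k)%N -> cont_at f (q ^+ j * z)].
  move=> zs; have [cf f0 _] := regular_at D (generic_circle gs zs).
  split => //; first by rewrite -nc_gt0 zs.
  move=> j jk; have wq : (zm (q ^+ j * z)%R + pm (q ^+ j * z)%R)%N == 0%N.
    by apply/negPn/negP => wz; have := fj j jk _ wz; rewrite ncM zs eqxx.
  by have [] := regular_at D wq.
pose x j z := nc (f (q ^+ j * z) / f z).
pose V (j : 'I_k.+1) z := logp (x j z).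
have cV (j : 'I_k.+1) : circ_cont (V j) s.
  by apply: (circ_logp_quot D gs); apply: fj; rewrite -ltnS.
have bound z : nc z = s ->
    logp (nc (iter k (jackson q) f z / f z)) <= logp (c * k.+1%:R) + \sum_(j < k.+1) V j z.
  move=> zs; have [z0 _ f0 _] := cz z zs.
  apply: le_trans (logp_sum_le c0 (fun j : 'I_k.+1 => nc_ge0 (f (q ^+ j * z) / f z))).
  apply: le_logp; first exact: nc_ge0.
  have nf0 : 0 < nc (f z) by rewrite nc_gt0.
  rewrite ncM ncV ler_pdivrMr // -mulrA mulr_suml.
  apply: le_trans (hc f z z0) _.
  have -> : \sum_(j < k.+1) nc (f (q ^+ j * z) / f z) * nc (f z) =
      \sum_(j < k.+1) nc (f (q ^+ j * z)).
    by apply: eq_bigr => j _; rewrite ncM ncV divfK // gt_eqF.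
  apply: ler_wpM2r; first by apply: sumr_ge0 => j _; exact: nc_ge0.
  (* Since [s >= 1], the factor [(nc z)^-1 ^+ k] is at most [1]. *)
  rewrite -[leRHS]mulr1 ler_wpM2l // zs exprn_ile1 ?invr_ge0 ?(ltW s0) //.
  by rewrite invf_le1.
have ineq : nev_m s (fun z => iter k (jackson q) f z / f z) <=
    logp (c * k.+1%:R) + \sum_(j < k.+1) cmean (V j) s.
  rewrite -[nev_m _ _]/(cmean (fun z => logp (nc (iter k (jackson q) f z / f z))) s).
  rewrite -(cmean_sum (ltW s0) (fun j _ => cV j)) -[X in X + _](cmean_cst s).
  rewrite -cmeanD ?(ltW s0) //; [|exact: circ_cont_cst|by apply: circ_cont_sum => j _].
  apply: le_cmean => //; [exact: ltW| |]; last first.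
    by apply: circ_contD; [exact: circ_cont_cst|by apply: circ_cont_sum => j _].
  move=> z zs; have [z0 cf f0 cj] := cz z zs.
  apply: cont_logp_ge0 => [y|]; first exact: nc_ge0.
  apply: cont_nc; apply: ccontM; last exact: ccontV.
  by apply: jackson_cont => //.
have Tr := nev_T_quasi_monotone FMT r1 rr gr gr'.
set nn : R := \sum_(a <- spec_list D r) (zm a + pm a)%:R.
have nn0 : 0 <= nn by apply: sumr_ge0 => a _.
have lr : 0 < ln (r' / r) by rewrite ln_gt0 // ltr_pdivlMr; lra.
have r'1 : 1 <= r' by lra.
have T0 := nev_T_ge0 D r'1.
set Y := (ln (r' / r))^-1; have Y0 : 0 < Y by rewrite invr_gt0.
set X := s / (r - s); have X0 : 0 <= X by rewrite divr_ge0 ?(ltW s0) // subr_ge0; lra.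
set T := nev_T r' f in Tr T0 *.
have nnle : nn <= (2 + `|L|) * (T + 1) * Y.
  have rr'1 : r <= r' by lra.
  have h := count_le FMT r1 rr'1 gr gr'; rewrite -/nn -/T in h.
  rewrite -ler_pdivrMr // invrK; apply: le_trans h _; nra.
have Vle (j : 'I_k.+1) : cmean (V j) s <= 4 * (16 + 7 * `|L|) * X * (T + 1) + W j * nn.
  have h4 : 0 <= 4 * X by rewrite mulr_ge0.
  have hX : 0 <= 4 * (16 + 7 * `|L|) * X * (T + 1).
    by apply: mulr_ge0; [apply: mulr_ge0 => //; lra|lra].
  (* For [j = 0] the quotient is [1]; [proximity_quot_le] asks for a shift of modulus less than
     [1]. *)
  have [j0|j0] := eqVneq (j : nat) 0%N.
    rewrite (@eq_cmean _ _ (fun=> 0)) ?(ltW s0) //.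
      by rewrite cmean_cst addr_ge0 // mulr_ge0.
    move=> z zs; have [z0 _ f0 _] := cz z zs.
    by rewrite /V /x j0 expr0 mul1r divff // nc1 /logp ln1 maxxx.
  have qj0 : q ^+ j != 0 by rewrite expf_neq0.
  have qj1 : nc (q ^+ j) < 1 by rewrite ncX exprn_ilt1 ?nc_ge0.
  have jk : (j <= k)%N by rewrite -ltnS.
  apply: le_trans (proximity_quot_le FMT qj0 qj1 s1 sr gs (fj j jk) gr) _.
  rewrite -/(W j) -/nn lerD2r.
  have -> : 4 * s / (r - s) = 4 * X by rewrite /X mulrA.
  rewrite (_ : 4 * (16 + 7 * `|L|) * X * (T + 1) = (4 * X) * ((16 + 7 * `|L|) * (T + 1))); last by ring.
  apply: ler_wpM2l => //; have := nev_T_ge0 D r1; nra.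
apply: le_trans ineq _.
have sV : \sum_(j < k.+1) cmean (V j) s <= k.+1%:R * (4 * (16 + 7 * `|L|)) * X * (T + 1) +
    (\sum_(j < k.+1) W j) * nn.
  apply: le_trans (ler_sum _ (fun j _ => Vle j)) _.
  rewrite big_split /= sumr_const card_ord -mulr_suml -mulr_natl.
  rewrite lerD2r le_eqVlt; apply/orP; left; apply/eqP; ring.
have w1 := ler_wpM2l SW0 nnle.
have e1 : 0 <= X * (T + 1) by rewrite mulr_ge0 // addr_ge0.
have e2 : 0 <= Y * (T + 1) by rewrite mulr_ge0 ?(ltW Y0) // addr_ge0.
have u1 := mulr_ge0 a1 e1; have u1' := mulr_ge0 a1 e2.
have u2 := mulr_ge0 a2 e2; have u3 := mulr_ge0 a3 e1.
rewrite /A; move: sV w1 u1 u1' u2 u3 a1 a2 a3.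
move: (logp _) (k.+1%:R * _) (\sum_(j < k.+1) W j) => p1 p2 p3.
move: (\sum_j _) => SS; lra.
Qed.

End Jackson.

(** * Natural and logarithmic density *)

Section NaturalDensity.
Context {R : realType}.

Definition cnt (B : pred nat) (N : nat) : nat := \sum_(n < N) B n.

Lemma cntS B N : cnt B N.+1 = (cnt B N + B N)%N.
Proof. by rewrite /cnt big_ord_recr. Qed.

Lemma cnt_le B N : (cnt B N <= N)%N.
Proof.
by elim: N => [|N IH]; rewrite ?cntS /cnt ?big_ord0 // -addn1 leq_add //; case: (B N).
Qed.

Lemma sub_cnt (B B' : pred nat) N : (forall n, (n < N)%N -> B n -> B' n) ->
  (cnt B N <= cnt B' N)%N.
Proof.
move=> h; apply: leq_sum => n _; have := h n (ltn_ord n).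
by case: (B n); case: (B' n) => // /(_ isT).
Qed.

Definition density_zero (B : pred nat) := forall e : R, 0 < e ->
  exists N0, forall N, (N0 <= N)%N -> (cnt B N)%:R <= e * N%:R.

(* The increments telescope, so a sublinear sequence whose increments are
   bounded below cannot increase much too often. *)
Lemma telescoping_density (a : nat -> R) (J n0 : nat) (c M e : R) :
  (forall n, (n0 <= n)%N -> a n - c <= a (n + J)%N) -> 0 <= c -> 0 < M ->
  (forall d, 0 < d -> exists N0, forall n, (N0 <= n)%N -> a n <= d * n%:R) ->
  c < e * M -> 0 < e ->
  exists N0, forall N, (N0 <= N)%N ->
    (cnt (fun n => M < a (n + J)%N - a n) N)%:R <= e * N%:R.
Proof.
move=> ha c0 M0 sub ceM e0; pose B : pred nat := fun n => M < a (n + J)%N - a n.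
rewrite -/B.
(* The sum over a window of length [J] increases by [a (N + J) - a N] when the window moves by one,
   so these increments telescope. *)
pose A N := \sum_(i < J) a (N + i)%N.
have AS N : A N.+1 = A N + (a (N + J)%N - a N).
  rewrite /A; case: (J) => [|k]; first by rewrite !big_ord0 addn0 subrr addr0.
  rewrite big_ord_recr [in RHS]big_ord_recl /= addn0 addSnnS.
  have -> : \sum_(i < k) a (N + bump 0 i)%N = \sum_(i < k) a (N.+1 + i)%N.
    by apply: eq_bigr => i _; rewrite addSnnS.
  by ring.
have key N : (n0 <= N)%N -> (cnt B N)%:R * M <= n0%:R * M + (A N - A n0) + N%:R * c.
  elim: N => [|N IH].
    rewrite leqn0 => /eqP ->; rewrite /cnt big_ord0 !mul0r subrr; lra.
  rewrite leq_eqVlt => /orP[/eqP <-|].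
    rewrite subrr addr0; have h : (cnt B n0)%:R <= n0%:R :> R by rewrite ler_nat cnt_le.
    by have := ler_wpM2r (ltW M0) h; have := mulr_ge0 (ler0n R n0) c0; lra.
  rewrite ltnS => nN; have := IH nN; rewrite cntS natrD mulrDl AS -[N.+1]addn1 natrD mulrDl mul1r.
  have := ha N nN; rewrite /B; case: ltrP => h h'; rewrite ?mul1r ?mul0r; lra.
(* The slack [g * N] has to absorb the window sum and the constants: [d] makes the linear part of
   [A N] at most [g / 4 * N], and [N1] makes the constants [K] at most [g / 2 * N]. *)
pose g := e * M - c; have g0 : 0 < g by rewrite /g; lra.
pose d := g / 4 / (J%:R + 1).
have J1 : 0 < J%:R + 1 :> R by rewrite ltr_wpDl.
have d0 : 0 < d by rewrite !divr_gt0.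
have [N0 hN0] := sub d d0.
pose K := n0%:R * M - A n0 + d * J%:R * J%:R.
pose N1 := Num.bound (K / (g / 2)).
exists (maxn n0 (maxn N0 N1)) => N; rewrite !geq_max => /and3P[h1 h2 h3].
have AN : A N <= d * J%:R * N%:R + d * J%:R * J%:R.
  apply: (@le_trans _ _ (\sum_(i < J) d * (N%:R + J%:R))).
    apply: ler_sum => i _; apply: le_trans (hN0 _ (leq_trans h2 (leq_addr _ _))) _.
    by rewrite ler_wpM2l ?(ltW d0) // natrD lerD2l ler_nat ltnW.
  rewrite sumr_const card_ord -mulr_natl; lra.
have dJ : d * J%:R <= g / 4.
  rewrite /d mulrAC ler_pdivrMr // ler_wpM2l ?divr_ge0 ?(ltW g0) //; lra.
have KN : K <= g / 2 * N%:R.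
  rewrite mulrC -ler_pdivrMr ?divr_gt0 //; apply: le_trans (ler_norm _) _.
  apply: le_trans (ltW (archi_boundP (normr_ge0 _))) _.
  by rewrite /N1 /Num.bound normr_id in h3 *; rewrite ler_nat.
rewrite -(ler_pM2r M0); apply: le_trans (key N h1) _.
have gN : 0 <= g * N%:R by rewrite mulr_ge0 ?(ltW g0).
have := ler_wpM2r (ler0n R N) dJ; move: AN KN gN; rewrite /K /g.
move: (d) (N%:R) (n0%:R) (J%:R) (A N) (A n0) => y x n j p q; lra.
Qed.

(* [B n] is the failure of [P i n] for the largest [i <= n] whose failures have
   already become sparse at [n] for good. *)
Lemma density_zero_diag (P : nat -> nat -> Prop) :
  (forall i j n, (i <= j)%N -> P j n -> P i n) ->
  (forall i, density_zero (fun n => ~~ `[< P i n >])) ->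
  exists2 B, density_zero B & forall i, exists n0, forall n, (n0 <= n)%N -> ~~ B n -> P i n.
Proof.
move=> mono dens; pose Bad i := fun n => ~~ `[< P i n >].
(* From [N] on, failures of [P i] have proportion at most [1 / (i + 1)]. For [i = 0] this always
   holds, so the maximum below is over a nonempty set; the cap [i <= N] makes that set finite. *)
pose valid i N := forall N', (N <= N')%N -> (cnt (Bad i) N')%:R <= i.+1%:R^-1 * N'%:R :> R.
have v0 N : valid 0%N N by move=> N' _; rewrite invr1 mul1r ler_nat cnt_le.
pose g N := (\max_(i < N.+1 | `[< valid i N >]) (i : nat))%N.
have gv N : valid (g N) N.
  have h0 : (0 < #|[pred i : 'I_N.+1 | `[< valid i N >]]|)%N.
    by apply/card_gt0P; exists ord0; exact/asboolP/v0.
  have [i hi e] := eq_bigmax_cond (fun i : 'I_N.+1 => i : nat) h0.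
  by rewrite /g (e : (\max_(i < N.+1 | `[< valid i N >]) (i : nat))%N = _); move: hi => /asboolP.
have gle i N : (i <= N)%N -> valid i N -> (i <= g N)%N.
  move=> iN vi; rewrite -ltnS in iN.
  apply: (@leq_bigmax_cond _ (fun i : 'I_N.+1 => `[< valid i N >]) (fun i => i : nat) (Ordinal iN)).
  exact/asboolP.
have gmono n N : (n <= N)%N -> (g n <= g N)%N.
  move=> nN; apply: gle; last by move=> N' NN'; apply: gv; exact: leq_trans nN NN'.
  apply: leq_trans nN; rewrite /g; apply/bigmax_leqP => i _.
  by rewrite -ltnS.
have ginf i : exists N0, forall N, (N0 <= N)%N -> (i <= g N)%N.
  have e0 : 0 < i.+1%:R^-1 :> R by rewrite invr_gt0.
  have [N0 hN0] := dens i _ e0; exists (maxn i N0) => N; rewrite geq_max => /andP[h1 h2].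
  by apply: gle => // N' NN'; apply: hN0; exact: leq_trans h2 NN'.
exists (fun n => Bad (g n) n).
  move=> e e0; pose i := Num.bound e^-1; have [N0 hN0] := ginf i; exists N0 => N NN.
  (* For [n < N] one has [g n <= g N], and failures increase with the index, so the single index
     [g N] bounds the count up to [N]. *)
  have h : (cnt (fun n => Bad (g n) n) N <= cnt (Bad (g N)) N)%N.
    apply: sub_cnt => n nN; apply: contra => /asboolP h; apply/asboolP.
    exact: mono (gmono _ _ (ltnW nN)) h.
  apply: (@le_trans _ _ (cnt (Bad (g N)) N)%:R); first by rewrite ler_nat.
  apply: le_trans (gv N N (leqnn N)) _; rewrite ler_wpM2r //.
  rewrite -[leRHS]invrK lef_pV2 ?posrE ?invr_gt0 //.
  apply: le_trans (ltW (archi_boundP _)) _; first by rewrite invr_ge0 ltW.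
  by rewrite ler_nat (leq_trans (hN0 N NN)).
move=> i; have [N0 hN0] := ginf i; exists N0 => n /hN0 h; rewrite negbK => /asboolP.
exact: mono.
Qed.

End NaturalDensity.

Section LogDensity.
Context {R : realType}.
Local Notation mu := (@lebesgue_measure R).
Variables (B : pred nat) (l : nat -> seq R).
Hypothesis B0 : @density_zero R B.

Let Z : set R := \bigcup_m [set` l m].

Definition dyadic_set : set R :=
  [set r | [/\ 1 < r, ~ Z r & exists n, ~~ B n /\ 2 ^+ n <= r < 2 ^+ n.+1]].

(** Adding the point [1] turns the condition [1 < r] into the removal of one more countable piece,
    as the dyadic blocks start at [1]. *)
Let Z1 : set R := \bigcup_m [set` 1 :: l m].

Let Z1P r : Z1 r <-> Z r \/ r = 1.
Proof.
split=> [[m _ /=]|[[m _ /= rl]|->]].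
- by rewrite inE => /orP[/eqP ->|rl]; [right|left; exists m].
- by exists m => //=; rewrite inE rl orbT.
- by exists 0%N => //=; rewrite inE eqxx.
Qed.

Let countableZ1 : countable Z1.
Proof.
by apply: bigcup_countable => // m _; apply: finite_set_countable; exact: finite_seq.
Qed.

Let measurable_seq (s : seq R) : measurable ([set` s] : set R).
Proof.
elim: s => [|x s IH]; first by rewrite set_nil.
have -> : [set` x :: s] = [set x] `|` [set` s].
  apply/seteqP; split => y /=; rewrite inE.
    by move=> /orP[/eqP|]; [left|right].
  by move=> [->|->]; rewrite ?eqxx ?orbT.
exact: measurableU.
Qed.

Let measurableZ1 : measurable Z1.
Proof. by apply: bigcupT_measurable => m; exact: measurable_seq. Qed.

Let dy n : set R := `[2 ^+ n, 2 ^+ n.+1[.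

Let two_ge1 n : 1 <= 2 ^+ n :> R.
Proof. by rewrite exprn_ege1 // ler1n. Qed.

Let dyadicE : dyadic_set = (\bigcup_n (if B n then set0 else dy n)) `\` Z1.
Proof.
apply/seteqP; split => r /=.
  move=> [r1 rZ [n [Bn hn]]]; split; last by move=> /Z1P[] // e; rewrite e ltxx in r1.
  by exists n => //; rewrite (negPf Bn) /dy /= in_itv /= hn.
move=> [[n _]]; case: ifPn => // Bn; rewrite /dy /= in_itv /= => /andP[h1 h2] rZ1.
have r1 : 1 <= r by exact: le_trans h1.
split.
- by rewrite lt_neqAle r1 andbT; apply/eqP => e; apply: rZ1; apply/Z1P; right.
- by move=> rZ; apply: rZ1; apply/Z1P; left.
- by exists n; rewrite h1.
Qed.

Let measurable_dyadic : measurable dyadic_set.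
Proof.
rewrite dyadicE; apply: measurableD => //; apply: bigcupT_measurable => n.
by case: (B n) => //; exact: measurable_itv.
Qed.

Let inv_int (A : set R) b : measurable A -> A `<=` `[1, b]%classic ->
  mu.-integrable A (EFin \o (fun t : R => t^-1)).
Proof.
move=> mA Ab; apply: (@integrableS _ _ _ mu `[1, b]) => //.
by apply: itv_integrable; exact: itv_cont_inv.
Qed.

Let inv_le (A A' : set R) b : measurable A -> measurable A' -> A `<=` A' ->
  A' `<=` `[1, b]%classic ->
  \int[mu]_(t in A) t^-1 <= \int[mu]_(t in A') t^-1.
Proof.
move=> mA mA' AA' Ab; have i1 := inv_int mA (subset_trans AA' Ab); have i2 := inv_int mA' Ab.
apply: fine_le; try exact: integrable_fin_num.
apply: ge0_subset_integral => //; first by case/integrableP: i2.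
by move=> t /Ab /=; rewrite in_itv /= lee_fin invr_ge0 => /andP[t1 _]; lra.
Qed.

(** The discarded radii are countable, hence null, so a good block keeps its full logarithmic
    length. *)
Let dyadic_int N : ~~ B N -> \int[mu]_(t in dyadic_set `&` dy N) t^-1 = ln 2.
Proof.
move=> BN; have -> : dyadic_set `&` dy N = dy N `\` Z1.
  rewrite dyadicE; apply/seteqP; split => r; first by move=> [[_ h] h'].
  by move=> [h h']; split => //; split => //; exists N => //; rewrite (negPf BN).
have dsub : dy N `<=` `[1, 2 ^+ N.+1]%classic.
  move=> t; rewrite /dy /= !in_itv /= => /andP[h1 h2].
  by rewrite (le_trans (two_ge1 N)) // ltW.
have mdy : measurable (dy N) by exact: measurable_itv.
have idy := inv_int mdy dsub.
have -> : \int[mu]_(t in dy N `\` Z1) t^-1 = \int[mu]_(t in dy N) t^-1.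
  rewrite /Rintegral -(@negligible_integral _ _ _ mu (dy N) Z1) //.
  exact: countable_lebesgue_measure0.
rewrite /dy Rintegral_itv_bndo_bndc // -/(itv_int _ _ _) itv_int_inv ?exprn_gt0 //.
  by rewrite -lnV ?posrE ?exprn_gt0 // -lnM ?posrE ?invr_gt0 ?exprn_gt0 // exprS mulfK // expf_neq0.
by rewrite ler_eXn2l ?ltr1n.
Qed.

Let lower N : ln 2 * (N%:R - (cnt B N)%:R) <=
  \int[mu]_(t in dyadic_set `&` `[1, 2 ^+ N[) t^-1.
Proof.
elim: N => [|N IH].
  rewrite /cnt big_ord0 subrr mulr0; apply: Rintegral_ge0 => t [[t1 _ _] _].
  by rewrite invr_ge0; lra.
have sub M : dyadic_set `&` `[1, 2 ^+ M[ `<=` `[1, 2 ^+ M]%classic.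
  by move=> t [_] /=; rewrite !in_itv /= => /andP[-> /ltW ->].
have mI M : measurable (dyadic_set `&` `[1, 2 ^+ M[%classic).
  by apply: measurableI => //; exact: measurable_itv.
have mD : measurable (dyadic_set `&` dy N) by apply: measurableI => //; exact: measurable_itv.
have le2 : 2 ^+ N <= 2 ^+ N.+1 :> R by rewrite ler_eXn2l ?ltr1n.
have U : dyadic_set `&` `[1, 2 ^+ N.+1[ =
    (dyadic_set `&` `[1, 2 ^+ N[) `|` (dyadic_set `&` dy N).
  apply/seteqP; split => t.
    move=> [Et] /=; rewrite in_itv /= => /andP[t1 t2].
    have [h|h] := ltrP t (2 ^+ N); [left|right]; split => //; rewrite /dy /= in_itv /=.
      by rewrite t1.
    by rewrite h.
  move=> [[Et]|[Et]]; rewrite /dy /= !in_itv /= => /andP[h1 h2]; split => //.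
    by rewrite h1 (lt_le_trans h2).
  by rewrite h2 (le_trans (two_ge1 N)).
rewrite U Rintegral_setU //; first last.
- rewrite disj_set2E; apply/eqP/seteqP; split => // t [[_ /=]].
  rewrite in_itv /= => /andP[_ t2] [_]; rewrite /dy /= in_itv /= => /andP[t3 _].
  by rewrite ltNge t3 in t2.
- by rewrite -U; exact: inv_int (mI _) (sub _).
- exact: mI.
rewrite cntS natrD -[N.+1]addn1 natrD.
have [BN|BN] := boolP (B N).
  have : 0 <= \int[mu]_(t in dyadic_set `&` dy N) t^-1.
    by apply: Rintegral_ge0 => t [[t1 _ _] _]; rewrite invr_ge0; lra.
  move: IH; rewrite /=; lra.
rewrite dyadic_int //; move: IH; rewrite /=; lra.
Qed.

Lemma dyadic_log_density : log_density_one dyadic_set.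
Proof.
split; first exact: measurable_dyadic.
  by move=> r [r1 _ _] /=; rewrite in_itv /= r1.
apply/cvgrPdist_le => e e0.
have e2 : 0 < e / 2 by rewrite divr_gt0.
have [N0 hN0] := B0 e2.
(* From [N0] on the bad blocks cost at most a proportion [e / 2]; [N >= 2 / e] makes the last,
   incomplete block cost no more than [e / 2] as well. *)
pose N1 := maxn N0 (Num.bound (2 / e)).
near=> r.
have r1 : 1 < r by near: r; exact: nbhs_pinfty_gt.
have rN : 2 ^+ N1.+1 < r by near: r; apply: nbhs_pinfty_gt; rewrite num_real.
have lr : 0 < ln r by rewrite ln_gt0.
have [N [NN1 h1 h2]] : exists N, [/\ (N1 <= N)%N, 2 ^+ N <= r & r < 2 ^+ N.+1].
  have ex : exists N, r < 2 ^+ N.+1.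
    have [n hn] := @geo_small R r 1 ltr01; exists n.
    move: hn; rewrite ltr_pdivrMr ?exprn_gt0 // mul1r => /lt_le_trans; apply.
    by rewrite ler_eXn2l ?ltr1n.
  have := ex_minnP ex => -[N hN minN]; exists N; split => //.
    rewrite leqNgt; apply/negP => h; move: hN; rewrite ltNge => /negP; apply.
    by apply: le_trans (ltW rN); rewrite ler_eXn2l ?ltr1n // ltnS ltnW.
  case: N hN minN => [|N] hN minN; first by rewrite expr0 ltW.
  by rewrite leNgt; apply/negP => /minN; rewrite ltnn.
have subr : dyadic_set `&` `[1, r] `<=` `[1, r]%classic by move=> t [].
have mr : measurable (dyadic_set `&` `[1, r]%classic).
  by apply: measurableI => //; exact: measurable_itv.
have up : \int[mu]_(t in dyadic_set `&` `[1, r]) t^-1 <= ln r.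
  have -> : ln r = \int[mu]_(t in `[1, r]) t^-1.
    by rewrite -/(itv_int _ _ _) itv_int_inv ?(ltW r1) // ln1 subr0.
  by apply: (@inv_le _ _ r) => //; exact: measurable_itv.
have lo : ln 2 * (N%:R - (cnt B N)%:R) <= \int[mu]_(t in dyadic_set `&` `[1, r]) t^-1.
  apply: le_trans (lower N) _; apply: (@inv_le _ _ r) => //.
    by apply: measurableI => //; exact: measurable_itv.
  move=> t [Et] /=; rewrite !in_itv /= => /andP[t1 t2]; split => //.
  by rewrite /= t1 (le_trans (ltW t2)).
have N0N : (N0 <= N)%N by apply: leq_trans NN1; rewrite leq_maxl.
have cN := hN0 N N0N.
have l2 : 0 < ln 2 :> R by rewrite ln_gt0 // ltr1n.
have lnr : ln r <= ln 2 * (N%:R + 1).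
  apply: (@le_trans _ _ (ln (2 ^+ N.+1))).
    by rewrite ler_ln ?posrE ?exprn_gt0 ?(ltW h2) //; lra.
  by rewrite lnXn // -[leLHS]mulr_natr -[N.+1]addn1 natrD.
have eN : 1 <= e / 2 * N%:R.
  have b : 2 / e <= N%:R.
    apply: le_trans (ltW (archi_boundP _)) _; first by rewrite divr_ge0 ?ltW.
    by rewrite ler_nat (leq_trans _ NN1) // leq_maxr.
  have := ler_wpM2l (ltW e2) b; rewrite mulrA divfK ?gt_eqF //.
  by rewrite divff ?gt_eqF.
set I := Rintegral _ _ _ in up lo *.
have lx : 0 <= (ln r)^-1 * I <= 1.
  have I0 : 0 <= I by apply: Rintegral_ge0 => t [[t1 _ _] _]; rewrite invr_ge0; lra.
  by rewrite mulr_ge0 ?invr_ge0 ?(ltW lr) //= mulrC ler_pdivrMr // mul1r.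
case/andP: lx => lx0 lx1; rewrite ger0_norm ?subr_ge0 //.
rewrite lerBlDr addrC -lerBlDr mulrC ler_pdivlMr //.
apply: le_trans _ lo; apply: (@le_trans _ _ (ln r - e * ln r)); first by lra.
have [e1|e1] := lerP 1 e.
  apply: (@le_trans _ _ 0); first by nra.
  by rewrite mulr_ge0 ?(ltW l2) // subr_ge0 ler_nat cnt_le.
have : (1 - e) * ln r <= (1 - e) * (ln 2 * (N%:R + 1)) by rewrite ler_wpM2l //; lra.
move: cN eN l2; move: (ln 2) (N%:R) ((cnt B N)%:R) => x n c; nra.
Unshelve. all: by end_near. Qed.

End LogDensity.

(** * Exceptional radii *)

Section Growth.
Context {R : realType}.

(** The covering set [B'] may depend on [e], as the jump threshold does in its application; finitely
    many initial indices cost another [e / 2]. *)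
Lemma density_zero_eventually (B : pred nat) :
  (forall e : R, 0 < e -> exists (B' : pred nat) n0 N0, (forall n, (n0 <= n)%N -> B n -> B' n) /\
    forall N, (N0 <= N)%N -> (cnt B' N)%:R <= e * N%:R) -> density_zero (R := R) B.
Proof.
move=> h e e0; have e2 : 0 < e / 2 by rewrite divr_gt0.
have [B' [n0 [N0 [sB hB]]]] := h _ e2.
exists (maxn N0 (Num.bound (n0%:R / (e / 2)))) => N; rewrite geq_max => /andP[h1 h2].
have c : (cnt B N <= n0 + cnt B' N)%N.
  elim: N {h1 h2} => [|N IH]; first by rewrite /cnt big_ord0.
  have [Nn|nN] := ltnP N n0; first exact: leq_trans (cnt_le _ _) (leq_trans Nn (leq_addr _ _)).
  rewrite !cntS addnA leq_add //; have := sB N nN.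
  by case: (B N); case: (B' N) => // /(_ isT).
have hN := hB N h1.
have n0N : n0%:R <= e / 2 * N%:R.
  rewrite mulrC -ler_pdivrMr //; apply: le_trans (ltW (archi_boundP _)) _.
    by rewrite divr_ge0 // ltW.
  by rewrite ler_nat.
apply: (@le_trans _ _ (n0 + cnt B' N)%:R); first by rewrite ler_nat.
rewrite natrD; lra.
Qed.

Lemma growth_order0 (f : R[i]^o -> R[i]^o) : growth_order f = 0%E ->
  forall e, 0 < e -> exists2 r0, 1 < r0 & forall r, r0 <= r -> ln (nev_T r f) <= e * ln r.
Proof.
move=> h e e0; have : (growth_order f < e%:E)%E by rewrite h lte_fin.
move=> /ereal_inf_lt[_ [V V0 <-]] sV.
move: V0 => [M [_ hM]].
exists (Num.max (M + 1) 2); first by rewrite lt_max; apply/orP; right; rewrite ltr1n.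
move=> r; rewrite ge_max => /andP[r1 r2].
have lr : 0 < ln r by apply: ln_gt0; clear sV; lra.
have : ((ln (nev_T r f) / ln r)%:E <= e%:E)%E.
  apply: le_trans (ltW sV); apply: ereal_sup_ubound.
  by exists r => //; apply: hM; clear sV; lra.
by rewrite lee_fin ler_pdivrMr.
Qed.

(** Here [x] is [2 ^+ n]. The factor [16] absorbs the uncertainty of [s], [r] and [r'] within their
    ranges, leaving [r >= (j + 2) s] and [r' / r >= 2 ^+ j.+1]. *)
Lemma dyadic_gap (x : R) (j J : nat) (s r r' : R) : 0 < x -> 2 ^+ J = 16 * 2 ^+ j.+1 :> R ->
  0 < s -> s < 2 * x -> x * 2 ^+ J / 4 < r -> r < x * 2 ^+ J / 2 ->
  x * 2 ^+ J * 2 ^+ J / 4 < r' ->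
  [/\ 2 * s <= r, 2 * r <= r', 0 <= s / (r - s) + (ln (r' / r))^-1 &
      s / (r - s) + (ln (r' / r))^-1 <= (1 + (ln 2)^-1) / j.+1%:R].
Proof.
move=> x0 ->; have pj : j.+1%:R <= 2 ^+ j.+1 :> R by rewrite -natrX ler_nat ltnW // ltn_expl.
have j1 : 1 <= j.+1%:R :> R by rewrite ler1n.
have p0 : 0 < 2 ^+ j.+1 :> R by rewrite exprn_gt0.
have l2 : 0 < ln 2 :> R by rewrite ln_gt0 // ltr1n.
have yl : ln (2 ^+ j.+1) = ln 2 * j.+1%:R :> R by rewrite lnXn // -[LHS]mulr_natr.
move: (2 ^+ j.+1) (j.+1%:R) pj j1 p0 yl => y z zy z1 y0 yl s0 sx rlo rhi r'lo.
have xy : x * z <= x * y by rewrite ler_pM2l.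
have xz : x <= x * z by rewrite ler_peMr // ltW.
have sz : s * (1 + z) <= 2 * x * (1 + z) by rewrite ler_pM2r ?(ltW sx) //; lra.
have h : s * (1 + z) <= r by lra.
have sz1 : s <= s * z by rewrite ler_peMr // ltW.
have xyy : x * y <= x * y * y by rewrite ler_peMr ?mulr_ge0 ?(ltW x0) ?(ltW y0) //; lra.
have s2r : 2 * s <= r by lra.
have r0 : 0 < r by lra.
have yr : y * r < y * (x * (16 * y) / 2) by rewrite ltr_pM2l.
have ygap : y * r <= r' by lra.
have r2r' : 2 * r <= r' by lra.
have z0 : 0 < z by lra.
have lg : 0 < ln (r' / r) by apply: ln_gt0; rewrite ltr_pdivlMr //; lra.
have rs : 0 < r - s by lra.
split => //; first by rewrite addr_ge0 ?invr_ge0 ?divr_ge0 // ltW.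
rewrite mulrDl mul1r; apply: lerD.
  by rewrite ler_pdivrMr // mulrC ler_pdivlMr //; lra.
rewrite -invfM lef_pV2 ?posrE ?mulr_gt0 //.
by rewrite -yl ler_ln ?posrE ?divr_gt0 ?ler_pdivlMr //; lra.
Qed.

(** Here [T'], [t], [T] are characteristics at [r'], at the sampled radius below [s], and at [s].
    Both terms of the bound for [m] are at most [eps / 32 * t], so
    [m <= eps / 16 * t <= eps * T]. *)
Lemma quotient_arith (A X t T' E m T eps : R) : 0 <= A -> 0 <= X -> 0 < eps -> 1 <= t ->
  0 <= T' -> 0 <= E -> T' <= E * t -> t <= 16 * T -> A * X * (E + 1) <= eps / 32 ->
  32 * A / eps <= t -> m <= A * X * (T' + 1) + A -> m / T <= eps.
Proof.
move=> A0 X0 e0 t1 T'0 E0 ht hT hX hA hm; have T0 : 0 < T by lra.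
rewrite ler_pdivrMr //; apply: le_trans hm _.
have h1 : A * X * (T' + 1) <= A * X * ((E + 1) * t).
  by rewrite ler_wpM2l ?mulr_ge0 // mulrDl mul1r lerD.
have h2 : A * X * ((E + 1) * t) <= eps / 32 * t by rewrite mulrA ler_wpM2r //; lra.
have h3 : A <= eps / 32 * t by move: hA; rewrite ler_pdivrMr //; lra.
have h4 : eps / 16 * t <= eps / 16 * (16 * T) by rewrite ler_wpM2l // divr_ge0 // ltW.
lra.
Qed.

End Growth.

Section SmallQuotient.
Context {R : realType}.
Local Notation C := (R[i]^o).
Local Notation nc := (@Normc.normc R).
Variables (f : C -> C) (zm pm : C -> nat) (D : divisor_spec f zm pm).
Hypothesis nf : ~ exists c, forall z, f z = c.
Hypothesis f0 : growth_order f = 0%E.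
Variables (q : C) (k : nat).
Hypotheses (q0 : q != 0) (q1 : nc q < 1).

Let quot (s : R) : R := nev_m s (fun z => iter k (jackson q) f z / f z) / nev_T s f.

(** With [rho n] below [2 ^+ n / 2], every [s >= 2 ^+ n] is at least [2 * rho n], as the comparison
    of characteristics requires. *)
Lemma generic_sequence : exists rho : nat -> R,
  forall n, 2 ^+ n / 4 < rho n < 2 ^+ n / 2 /\ generic zm pm (rho n).
Proof.
have h n : exists r : R, 2 ^+ n / 4 < r < 2 ^+ n / 2 /\ generic zm pm r.
  have xy : 2 ^+ n / 4 < 2 ^+ n / 2 :> R by have := exprn_gt0 n (ltr0n R 2); lra.
  by have [r hr gr] := exists_generic D xy; exists r.
by exists (fun n => projT1 (cid (h n))) => n; exact: projT2 (cid (h n)).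
Qed.

Lemma jackson_quotient_density (eps : R) : 0 < eps -> density_zero (R := R)
  (fun n => ~~ `[< forall s, 2 ^+ n <= s < 2 ^+ n.+1 -> kgeneric zm pm q k s -> quot s <= eps >]).
Proof.
move=> eps0; have [L FMT] := first_main_theorem D.
have [A A0 hA] := jackson_proximity_le FMT k q0 q1.
have [rho hrho] := generic_sequence.
have lo n : 2 ^+ n / 4 < rho n by have [/andP[]] := hrho n.
have hi n : rho n < 2 ^+ n / 2 by have [/andP[]] := hrho n.
have gen n : generic zm pm (rho n) by have [] := hrho n.
have p0 n : 0 < 2 ^+ n :> R by rewrite exprn_gt0.
have p2 n m : 2 ^+ (n + m) = 2 ^+ n * 2 ^+ m :> R by rewrite exprD.
have pge (K : R) : exists n0, forall n, (n0 <= n)%N -> K <= rho n.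
  have [n hn] := @geo_small R (4 * `|K|) 1 ltr01; exists n => m nm.
  apply: le_trans (ltW (lo m)); rewrite ler_pdivlMr //.
  have h : 2 ^+ n <= 2 ^+ m :> R by rewrite ler_eXn2l ?ltr1n.
  move: hn; rewrite ltr_pdivrMr ?exprn_gt0 // mul1r.
  by have := ler_norm K; lra.
pose t n := nev_T (rho n) f.
have tge (K : R) : exists n0, forall n, (n0 <= n)%N -> K <= t n.
  have [r0 _ hr0] := nev_T_infty nf FMT K; have [n0 hn0] := pge r0.
  by exists n0 => n /hn0 h; apply: hr0.
(* Once [t n >= 6 |L|], the additive [3 |L|] of [nev_T_quasi_monotone] is at most half the
   characteristic at [rho n], which gives the factor [16] at [s], and [11] suffices between sampled
   radii. The last term is the lower bound on [t] in [quotient_arith]. *)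
pose K := 1 + 6 * `|L| + 32 * A / eps.
have [n1 hn1] := tge K; pose n0 := maxn n1 2.
have L0 := normr_ge0 L.
have Ae : 0 <= 32 * A / eps by rewrite divr_ge0 ?mulr_ge0 // ltW.
have tK n : (n0 <= n)%N -> K <= t n by move=> h; apply: hn1; exact: leq_trans (leq_maxl _ _) h.
have t1 n : (n0 <= n)%N -> 1 <= t n by move=> /tK; rewrite /K; lra.
have rho1 n : (n0 <= n)%N -> 1 <= rho n.
  rewrite geq_max => /andP[_ h]; apply: le_trans (ltW (lo n)); rewrite ler_pdivlMr // mul1r.
  have : 2 ^+ 2 <= 2 ^+ n :> R by rewrite ler_eXn2l ?ltr1n.
  by rewrite expr2; lra.
have tqm n J : (n0 <= n)%N -> (2 <= J)%N -> t n <= 11 * t (n + J)%N.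
  move=> hn hJ; have hnJ : (n0 <= n + J)%N by exact: leq_trans hn (leq_addr _ _).
  have h2 : 2 * rho n <= rho (n + J)%N.
    have := lo (n + J)%N; have := hi n; have := p0 n; rewrite p2.
    have : 2 ^+ 2 <= 2 ^+ J :> R by rewrite ler_eXn2l ?ltr1n.
    rewrite expr2; move: (2 ^+ n) (2 ^+ J) => x y; nra.
  have := nev_T_quasi_monotone FMT (rho1 n hn) h2 (gen n) (gen _).
  rewrite -/(t n) -/(t (n + J)%N); have := tK _ hnJ; rewrite /K; lra.
apply: density_zero_eventually => e e0.
pose c : R := ln 11; have c0 : 0 <= c by rewrite ln_ge0 // ler1n.
(* Any [M] with [c < e * M] serves [telescoping_density]. As [c = ln 11] does not involve the gap,
   [M] is fixed before [J]. *)
pose M := c / e + 1; have M0 : 0 < M by rewrite /M; have := divr_ge0 c0 (ltW e0); lra.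
have ceM : c < e * M.
  have -> : e * M = c + e by rewrite /M mulrDr mulr1 mulrCA divff ?gt_eqF // mulr1.
  by rewrite ltrDl.
pose c2 : R := 1 + (ln 2)^-1.
have l2 : 0 < ln 2 :> R by rewrite ln_gt0 // ltr1n.
have c20 : 0 < c2 by rewrite addr_gt0 ?invr_gt0.
(* At a non-exceptional [n] the characteristic grows by at most [expR M] over [J + J] steps. The gap
   index [j] is now taken large in terms of [M], so that [A] times the bracket times [expR M + 1]
   falls below [eps / 32]. *)
pose W := A * c2 * (expR M + 1).
have eM0 := expR_gt0 M.
have W0 : 0 <= W by apply: mulr_ge0; [exact: mulr_ge0 A0 (ltW c20)|lra].
have [j jW] : exists j : nat, W / j.+1%:R <= eps / 32.
  exists (Num.bound (32 * W / eps)).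
  rewrite ler_pdivrMr //; have : 32 * W / eps < (Num.bound (32 * W / eps)).+1%:R.
    apply: lt_le_trans (archi_boundP _) _; first by apply: divr_ge0; [lra|exact: ltW].
    by rewrite ler_nat.
  by rewrite ltr_pdivrMr //; lra.
have [J [J2 J4]] : exists J, (2 <= J + J)%N /\ 2 ^+ J = 16 * 2 ^+ j.+1 :> R.
  by exists (j.+1 + 4)%N; split; [rewrite addn4 !addSn|rewrite p2 mulrC -[2 ^+ 4]natrX].
have aJ n : (n0 <= n)%N -> ln (t n) - c <= ln (t (n + (J + J))%N).
  move=> hn; have h := tqm n (J + J)%N hn J2.
  have u1 := t1 n hn; have u2 := t1 _ (leq_trans hn (leq_addr (J + J) n)).
  rewrite lerBlDl /c -lnM ?posrE //; [|lra..].
  by rewrite ler_ln ?posrE //; lra.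
have sub d : 0 < d -> exists N0, forall n, (N0 <= n)%N -> ln (t n) <= d * n%:R.
  move=> d0; have d2 : 0 < d / ln 2 by rewrite divr_gt0.
  have [r0 r01 hr0] := growth_order0 f0 d2; have [m hm] := pge r0.
  exists m => n /hm h; apply: le_trans (hr0 _ h) _.
  have -> : d * n%:R = d / ln 2 * (n%:R * ln 2) by rewrite [RHS]mulrC -mulrA [ln 2 * _]mulrC divfK ?gt_eqF // mulrC.
  have h0 : 0 < rho n by apply: lt_trans (lo n); rewrite divr_gt0.
  rewrite ler_wpM2l ?(ltW d2) // mulr_natl -lnXn // ler_ln ?posrE //.
  by apply: le_trans (ltW (hi n)) _; rewrite ler_pdivrMr // ler_peMr ?ler1n // ltW.
have [N0 hN0] := telescoping_density aJ c0 M0 sub ceM e0.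
exists (fun n => M < ln (t (n + (J + J))%N) - ln (t n)), n0, N0; split => // n hn.
apply: contraR; rewrite -leNgt => good; apply/asboolP => s /andP[s1 s2] gs.
have u1 := t1 n hn; have hnJ := leq_trans hn (leq_addr (J + J) n).
have u2 := t1 _ hnJ.
have tt : t (n + (J + J))%N <= expR M * t n.
  have t0 := lt_le_trans ltr01 u1; have t0' := lt_le_trans ltr01 u2.
  by rewrite -ler_ln ?posrE ?mulr_gt0 // lnM ?posrE // expRK -lerBlDr.
have s1' : 1 <= s by apply: le_trans s1; rewrite exprn_ege1 // ler1n.
have sr : 2 * rho n <= s by have := hi n; lra.
have Ts : t n <= 16 * nev_T s f.
  have := nev_T_quasi_monotone FMT (rho1 n hn) sr (gen n) (kgeneric0 gs).
  rewrite -/(t n); have := tK n hn; rewrite /K; lra.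
have rlo : 2 ^+ n * 2 ^+ J / 4 < rho (n + J)%N by rewrite -p2.
have rhi : rho (n + J)%N < 2 ^+ n * 2 ^+ J / 2 by rewrite -p2.
have r'lo : 2 ^+ n * 2 ^+ J * 2 ^+ J / 4 < rho (n + (J + J))%N by rewrite -!p2 -addnA.
have s2' : s < 2 * 2 ^+ n by rewrite -exprS.
have s0 : 0 < s by lra.
have [s2r r2r' XY0 XY] := dyadic_gap (p0 n) J4 s0 s2' rlo rhi r'lo.
rewrite -/c2 in XY; move: s2r r2r' XY0 XY.
set r := rho (n + J)%N; set r' := rho (n + (J + J))%N => s2r r2r' XY0 XY.
apply: (quotient_arith A0 XY0 eps0 u1 (le_trans ler01 u2) (ltW eM0) tt Ts _ _
          (hA s r r' s1' s2r r2r' gs (gen _) (gen _))).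
  apply: le_trans jW; have -> : W / j.+1%:R = A * (c2 / j.+1%:R) * (expR M + 1).
    by rewrite /W; ring.
  have E1 : 0 <= expR M + 1 by rewrite addr_ge0 // ltW.
  by apply: ler_wpM2r => //; apply: ler_wpM2l.
by have := tK n hn; rewrite /K; lra.
Qed.

End SmallQuotient.

Section ExceptionalRadii.
Context {R : realType}.
Local Notation C := (R[i]^o).
Local Notation nc := (@Normc.normc R).
Variables (f : C -> C) (zm pm : C -> nat) (D : divisor_spec f zm pm).
Variables (q : C) (k : nat).
Hypotheses (q0 : q != 0) (q1 : nc q < 1).

(** One finite list per [m], so that the union over [m] is countable. A zero or pole [a] with
    [nc a = nc q ^+ j * s] has modulus at most [s], and any [m >= s] catches it. *)
Definition exceptional_radii (m : nat) : seq R :=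
  [seq nc a / nc q ^+ j | a <- spec_list D m%:R, j <- iota 0 k.+1].

Lemma nonexceptional_kgeneric (s : R) : 0 < s ->
  ~ (\bigcup_m [set` exceptional_radii m]) s -> kgeneric zm pm q k s.
Proof.
move=> s0 hs j a jk ha; apply/eqP => e; apply: hs.
have nq0 : 0 < nc q by rewrite nc_gt0.
have as' : nc a <= s by rewrite e ler_piMl ?(ltW s0) // exprn_ile1 // ltW.
exists (Num.bound s) => //=; apply/allpairsP; exists (a, j); split.
- by rewrite mem_spec_list ha (le_trans as') // ltW // archi_boundP // ltW.
- by rewrite mem_iota.
- by rewrite /= e mulrC mulKf // expf_neq0 // gt_eqF.
Qed.

End ExceptionalRadii.

Theorem theorem2p1 (R : realType) (q : R[i]^o) (k : nat)
    (f : R[i]^o -> R[i]^o)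
    (hq : 0 < Normc.normc q < 1)
    (hk : (0 < k)%N)
    (f_mero : meromorphic f)
    (f_nonconst : ~ (exists c : R[i]^o, forall z, f z = c))
    (f_order : growth_order f = 0%E) :
  exists2 E : set R, log_density_one E &
    nev_m r (fun z => iter k (jackson q) f z / f z) / nev_T r f
      @[r --> within E (+oo : set_system R)] --> (0 : R).
Proof.
have /andP[q0' q1] := hq; have q0 : q != 0 by rewrite -nc_gt0.
have [zm [pm D]] := divisor_exists f_mero f_nonconst.
pose quot s := nev_m s (fun z => iter k (jackson q) f z / f z) / nev_T s f.
pose P i n := forall s : R, 2 ^+ n <= s < 2 ^+ n.+1 -> kgeneric zm pm q k s ->
  quot s <= i.+1%:R^-1.
have mono i j n : (i <= j)%N -> P j n -> P i n.
  move=> ij h s sn gs; apply: le_trans (h s sn gs) _.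
  by rewrite lef_pV2 ?posrE ?ltr0n // ler_nat.
have dens i : density_zero (R := R) (fun n => ~~ `[< P i n >]).
  by apply: (jackson_quotient_density D) => //; rewrite invr_gt0.
have [B B0 hB] := density_zero_diag mono dens.
exists (dyadic_set B (exceptional_radii D q k)); first exact: dyadic_log_density.
apply/cvgrPdist_le => e e0.
(* For this index the threshold [1 / (i + 1)] is at most [e]. *)
have [n0 hn0] := hB (Num.bound e^-1).
rewrite near_withinE; near=> r => -[r1 rZ [n [Bn rn]]].
have rn0 : 2 ^+ n0 <= r by near: r; apply: nbhs_pinfty_ge; rewrite num_real.
have gr : kgeneric zm pm q k r by apply: nonexceptional_kgeneric rZ => //; lra.
have nn0 : (n0 <= n)%N.
  have /andP[_ h] := rn; have := le_lt_trans rn0 h.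
  by rewrite ltr_eXn2l ?ltr1n // ltnS.
have qr0 : 0 <= quot r.
  have T0 : 0 <= nev_T r f by exact: nev_T_ge0 D _ (ltW r1).
  rewrite /quot; apply: divr_ge0 => //.
  apply: mulr_ge0; first by rewrite invr_ge0 mulr_ge0 // pi_ge0.
  by apply: Rintegral_ge0 => t _; rewrite logp_ge0.
rewrite sub0r normrN -/(quot r) ger0_norm //; apply: le_trans (hn0 n nn0 Bn r rn gr) _.
rewrite -[leRHS]invrK lef_pV2 ?posrE ?invr_gt0 ?ltr0n //.
apply: le_trans (ltW (archi_boundP _)) _; first by rewrite invr_ge0 ltW.
by rewrite ler_nat.
Unshelve. all: by end_near. Qed.
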